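(* Let $\Gamma$ be a group acting properly discontinuously and cocompactly by isometries on a complete $\mathrm{CAT}(0)$ space $X$. Then any amenable subgroup of $\Gamma$ is virtually abelian and finitely generated.
   Context: $\Gamma$ is regarded as a discrete group. The action is properly discontinuous if every $x \in X$ admits some $r > 0$ such that $\{\gamma \in \Gamma : \gamma B(x,r) \cap B(x,r) \neq \varnothing\}$ is finite; it is cocompact if there is a compact $C \subset X$ with $\Gamma \cdot C = X$. Virtually abelian means having an abelian subgroup of finite index. *)

(* Defs.v *)
From HB Require Import structures.
From mathcomp Require Import all_boot all_order all_algebra.
From mathcomp Require Import all_classical reals topology.

Set Implicit Arguments.
Unset Strict Implicit.
Unset Printing Implicit Defensive.

Import Order.TTheory GRing.Theory Num.Theory.

Local Open Scope classical_set_scope.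
Local Open Scope ring_scope.

(* [Complete] inherits from [PointedUniform], so these spaces are nonempty. *)
#[short(type="completeMetricType")]
HB.structure Definition CompleteMetric (R : numDomainType) :=
  {T of Metric R T & Complete T}.

Section CAT0.
Variable R : realType.

(* The Euclidean distance; the norm that the library puts on ['rV[R]_2] is the
   sup norm. *)
Definition edist (a b : 'rV[R]_2) : R :=
  Num.sqrt (\sum_(k < 2) (a 0 k - b 0 k) ^+ 2).

Variable X : metricType R.

Definition geodesic (x y : X) (c : R -> X) : Prop :=
  [/\ c 0 = x, c (mdist x y) = y &
      {in `[0, mdist x y] &, forall s t, mdist (c s) (c t) = `|s - t|}].

Definition geodesic_space : Prop :=
  forall x y : X, exists c : R -> X, geodesic x y c.

(* The sides of a triangle join consecutive vertices; indices are mod 3. *)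
Definition geodesic_triangle (v : 'I_3 -> X) (c : 'I_3 -> R -> X) : Prop :=
  forall i, geodesic (v i) (v (i + 1)) (c i).

Definition comparison_triangle (v : 'I_3 -> X) (w : 'I_3 -> 'rV[R]_2) : Prop :=
  forall i, edist (w i) (w (i + 1)) = mdist (v i) (v (i + 1)).

(* [p'] is the point of the side [[w i, w (i + 1)]] of the comparison triangle
   corresponding to [p], assumed to be on the side from [v i] to [v (i + 1)]. *)
Definition comparison_point (v : 'I_3 -> X) (w : 'I_3 -> 'rV[R]_2) (i : 'I_3)
    (p : X) (p' : 'rV[R]_2) : Prop :=
  (exists2 t : R, t \in `[0, 1] & p' = (1 - t) *: w i + t *: w (i + 1)) /\
  edist (w i) p' = mdist (v i) p.

Definition CAT0 : Prop :=
  geodesic_space /\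
  forall v c w, geodesic_triangle v c -> comparison_triangle v w ->
  forall (i j : 'I_3) (p q : X) (p' q' : 'rV[R]_2),
    (c i @` `[0, mdist (v i) (v (i + 1))]) p ->
    (c j @` `[0, mdist (v j) (v (j + 1))]) q ->
    comparison_point v w i p p' -> comparison_point v w j q q' ->
    mdist p q <= edist p' q'.

End CAT0.

Section Groups.
Variable G : groupType.

Definition subgroup (H : set G) : Prop := group_closed (mem H).

Definition generated (S : set G) : set G := smallest subgroup S.

Definition finitely_generated (H : set G) : Prop :=
  exists2 S : set G, finite_set S & generated S = H.

Definition ltranslate (g : G) (A : set G) : set G := [set (g * h)%g | h in A].

Definition finite_index (K H : set G) : Prop :=
  finite_set [set ltranslate h K | h in H].

Definition virtually_abelian (H : set G) : Prop :=
  exists K : set G, [/\ subgroup K, K `<=` H,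
    (forall x y, K x -> K y -> (x * y = y * x)%g) & finite_index K H].

(* Amenability of [H] as a discrete group: there is a left-invariant finitely
   additive probability measure defined on all subsets of [H]. *)
Definition amenable (R : realType) (H : set G) : Prop :=
  exists m : set G -> R,
  [/\ (forall A, A `<=` H -> 0 <= m A),
      m H = 1,
      (forall A B, A `<=` H -> B `<=` H -> A `&` B = set0 ->
         m (A `|` B) = m A + m B) &
      (forall h A, H h -> A `<=` H -> m (ltranslate h A) = m A)].

End Groups.

Section Actions.
Variables (R : realType) (G : groupType) (X : metricType R).
Variable act : G -> X -> X.

Definition group_action : Prop :=
  (forall x, act 1%g x = x) /\
  (forall g h x, act (g * h)%g x = act g (act h x)).

Definition isometric : Prop :=
  forall g x y, mdist (act g x) (act g y) = mdist x y.

Definition properly_discontinuous : Prop :=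
  forall x : X, exists2 r : R, 0 < r &
    finite_set [set g | (act g @` ball x r) `&` ball x r !=set0].

Definition cocompact : Prop :=
  exists2 C : set X, compact C & \bigcup_g (act g @` C) = setT.

End Actions.

(* Main.v *)
(* The space [X] is proper, because the group acts properly discontinuously and
   cocompactly, and an amenable group [H] of isometries without fixed points at
   infinity preserves a flat (Adams-Ballmann): on a minimal invariant convex
   set, the limits of the translates of a convex function along the mean are
   affine, and affine functions either split off a line or show that the set is
   flat.

   If [H] fixes a point at infinity, there are points [x n] tending to infinity
   that each [h] in [H] moves a bounded amount. Conjugating by elements which
   bring the midpoints of a base point and [x n] back to a bounded region, and
   passing to the limit, [H] acts through a twisted embedding [theta] in the
   group on a convex set that splits off one more line, on which [theta H] acts
   by translations. The dimension of such Euclidean factors is bounded, so a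
   maximal one leaves a transverse action without fixed points at infinity, and
   [theta H] preserves a flat. It acts properly on it, and Bieberbach's theorem
   concludes: after minimizing the dimension of the invariant subspace, the
   elements of small rotational part commute and act by translations. *)

From HB Require Import structures.
From mathcomp Require Import all_boot all_order all_algebra.
From mathcomp Require Import all_classical reals topology normedtype.
From mathcomp Require Import ring lra.
Require Import Defs.

Set Implicit Arguments.
Unset Strict Implicit.
Unset Printing Implicit Defensive.

Import Order.TTheory GRing.Theory Num.Theory.
Import numFieldNormedType.Exports.

Local Open Scope classical_set_scope.
Local Open Scope ring_scope.

(** The boundary at infinity never appears. A fixed point at infinity is replaced by the failure of
    [no_escape]: points arbitrarily far away, each moved a bounded amount by every element. Limits
    are taken along ultrafilters, and convexity is tested at midpoints only. No flat preserved by
    [H] itself is exhibited. The conclusion concerns the abstract group, so [H] may be replaced by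
    an isomorphic copy in [Gamma], which still acts properly. After recentring, the conjugates of an
    element move points of a bounded region by a bounded amount, so they take finitely many values
    and one of them is taken along the ultrafilter: this is the value of [theta]. Midpoints serve
    because both ends of the segment recede from them, so that the limit is a line and not just a
    ray, while convexity bounds the displacement there. The number of line factors is bounded
    because unit translates of one point along orthogonal lines are at distance at least 1 from each
    other, and cocompactness brings them all into one fixed ball. *)

Ltac rlra := intros; lra.
Ltac rnra := intros; nra.

(** * Hadamard spaces *)

Section RealLemmas.
Variable R : realType.
Implicit Types a b c : R.

Lemma ler_of_sqr a b : 0 <= b -> a ^+ 2 <= b ^+ 2 -> a <= b.
Proof. by move=> b0 ab; rewrite leNgt; apply/negP => ba; rnra. Qed.

Lemma le0_of_eps c a : 0 <= c -> (forall e, 0 < e -> a <= c * e) -> a <= 0.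
Proof.
move=> c0 H; rewrite leNgt; apply/negP => a0.
have e0 : 0 < a / (2 * (c + 1)) by apply: divr_gt0 => //; rlra.
have := H _ e0; apply/negP; rewrite -ltNge.
have -> : c * (a / (2 * (c + 1))) = a * (c / (2 * (c + 1))) by ring.
rewrite -[ltRHS]mulr1 ltr_pM2l// ltr_pdivrMr; rlra.
Qed.

(** Replaces a passage to the limit in the bisection arguments below, whose error halves at each
    step. *)
Lemma half_pow_lim a b : (forall n, a <= b / 2 ^+ n) -> a <= 0.
Proof.
move=> H; rewrite leNgt; apply/negP => a0.
have b0 : 0 < b by have := H 0%N; rewrite expr0 divr1; rlra.
have nP := archi_boundP (ltW (divr_gt0 b0 a0) : 0 <= b / a).
have := H (Num.bound (b / a)); apply/negP; rewrite -ltNge.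
rewrite ltr_pdivrMr ?exprn_gt0// mulrC -ltr_pdivrMr//.
apply: (lt_le_trans nP).
rewrite -natrX ler_nat; apply: ltnW; exact: ltn_expl.
Qed.

End RealLemmas.

Section Metric.
Variables (R : realType) (X : metricType R).
Local Notation d := (@mdist R X).
Implicit Types (x y z p q m : X) (Y : set X).

Definition is_mid x y m := d x m = d x y / 2 /\ d m y = d x y / 2.

(* Between-points exist, the Bruhat-Tits (CN) inequality holds, and bounded
   nets converge along ultrafilters (the space is proper). *)
Record proper_hadamard : Prop := ProperHadamard {
  hadamard_between : forall x y t, 0 <= t <= d x y ->
    exists z, d x z = t /\ d z y = d x y - t;
  hadamard_CN : forall p x y m, is_mid x y m ->
    d p m ^+ 2 <= (d p x ^+ 2 + d p y ^+ 2) / 2 - d x y ^+ 2 / 4;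
  hadamard_net : forall (I : Type) (U : set_system I), UltraFilter U ->
    forall (o : X) (u : I -> X) (M : R), U [set i | d o (u i) <= M] ->
    exists x, d (u i) x @[i --> U] --> (0 : R) }.

Definition mid x y := xget x (is_mid x y).

Definition mid_closed Y := forall x y, Y x -> Y y -> Y (mid x y).

Definition dist_closed Y :=
  forall x, (forall e, 0 < e -> exists2 y, Y y & d x y < e) -> Y x.

Definition cconvex Y := mid_closed Y /\ dist_closed Y.

Definition mid_convex Y (f : X -> R) :=
  forall x y, Y x -> Y y -> f (mid x y) <= (f x + f y) / 2.

Definition mid_affine Y (f : X -> R) :=
  forall x y, Y x -> Y y -> f (mid x y) = (f x + f y) / 2.

Definition lip1 Y (f : X -> R) := forall x y, Y x -> Y y -> `|f x - f y| <= d x y.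

Lemma distC x y : d x y = d y x. Proof. exact: metric_sym. Qed.
Lemma dist_ge0 x y : 0 <= d x y. Proof. exact: mdist_ge0. Qed.
Lemma distxx x : d x x = 0. Proof. exact: mdistxx. Qed.
Lemma dist_tri y x z : d x z <= d x y + d y z. Proof. exact: metric_triangle. Qed.
Lemma dist_eq0 x y : d x y <= 0 -> x = y.
Proof.
by move=> xy; apply: mdist_positivity; apply/le_anti; rewrite xy dist_ge0.
Qed.
Lemma dist_diff z x y : `|d x z - d y z| <= d x y.
Proof.
have := dist_tri y x z; have := dist_tri x y z; rewrite (distC y x) => *.
by rewrite ler_norml; apply/andP; split; rlra.
Qed.

Lemma lip1_dist Y z : lip1 Y (d ^~ z).
Proof. by move=> x y _ _; exact: dist_diff. Qed.

Lemma lip1_sub Y Y' f : Y' `<=` Y -> lip1 Y f -> lip1 Y' f.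
Proof. by move=> sub L x y Yx Yy; apply: L; apply: sub. Qed.

Hypothesis HX : proper_hadamard.

Lemma midP x y : is_mid x y (mid x y).
Proof.
rewrite /mid; case: xgetP => // none.
have dxy := dist_ge0 x y.
have [|m [m1 m2]] := hadamard_between HX (x := x) (y := y) (t := d x y / 2).
  by apply/andP; split; rlra.
by exfalso; apply: (none m); split; rlra.
Qed.

Lemma CN p x y :
  d p (mid x y) ^+ 2 <= (d p x ^+ 2 + d p y ^+ 2) / 2 - d x y ^+ 2 / 4.
Proof. exact/(hadamard_CN HX)/midP. Qed.

Lemma mid_uniq x y m : is_mid x y m -> m = mid x y.
Proof.
case=> m1 m2; apply: dist_eq0; apply: ler_of_sqr => //.
apply: (le_trans (CN m x y)); rewrite (distC m x) m1 m2.
have := dist_ge0 x y; rnra.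
Qed.

Lemma midC x y : mid x y = mid y x.
Proof.
apply: mid_uniq; have [m1 m2] := midP x y.
by split; rewrite distC ?m1 ?m2 (distC y x).
Qed.

Lemma dist_midl x y : d x (mid x y) = d x y / 2. Proof. by case: (midP x y). Qed.
Lemma dist_midr x y : d (mid x y) y = d x y / 2. Proof. by case: (midP x y). Qed.

Lemma midxx x : mid x x = x.
Proof. by apply/esym/mid_uniq; split; rewrite distxx mul0r. Qed.

(** If [z] and [w] differed, (CN) would put their midpoint strictly closer than them to both [x] and
    [y], against the triangle inequality. *)
Lemma between_uniq x y z w : d x z + d z y <= d x y ->
  d x w = d x z -> d w y = d z y -> z = w.
Proof.
move=> bz e1 e2; apply: dist_eq0.
have t := dist_tri (mid z w) x y.
have c1 := CN x z w; have c2 := CN y z w.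
rewrite !(distC y) e1 e2 in c1 c2.
have [p1 p2 p3 p4 p5] := And5 (dist_ge0 x z) (dist_ge0 z y) (dist_ge0 z w)
  (dist_ge0 x (mid z w)) (dist_ge0 (mid z w) y).
have q1 : d x (mid z w) <= d x z by apply: ler_of_sqr => //; rnra.
have q2 : d (mid z w) y <= d z y by apply: ler_of_sqr => //; rnra.
rewrite leNgt; apply/negP => zw; rnra.
Qed.

(** (CN) is used twice: from [mid x y] over the segment [x z], and from [z] over [x y]. *)
Lemma dist_mid_mid1 x y z : d (mid x y) (mid x z) <= d y z / 2.
Proof.
have := dist_ge0 y z => yz0; apply: ler_of_sqr; first by rlra.
have c1 := CN (mid x y) x z; have c2 := CN z x y.
move: c1 c2; rewrite (distC _ x) dist_midl (distC z x) (distC z y).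
by rewrite (distC z (mid x y)); rnra.
Qed.

Lemma dist_mid_mid x y x' y' :
  d (mid x y) (mid x' y') <= (d x x' + d y y') / 2.
Proof.
have := dist_tri (mid x y') (mid x y) (mid x' y').
have := dist_mid_mid1 x y y'; have := dist_mid_mid1 y' x x'.
by rewrite !(midC y'); rlra.
Qed.

(** The substitute for the parallelogram law: (CN) from [y] and from [w] over the diagonal [x z]. *)
Lemma quad x y z w : d x z ^+ 2 + d y w ^+ 2 <=
  d x y ^+ 2 + d y z ^+ 2 + d z w ^+ 2 + d w x ^+ 2.
Proof.
have c1 := CN y x z; have c2 := CN w x z; have t := dist_tri (mid x z) y w.
rewrite !(distC y x) (distC w z) (distC w (mid x z)) in c1 c2 t.
have [p1 p2 p3] := And3 (dist_ge0 y (mid x z)) (dist_ge0 (mid x z) w) (dist_ge0 y w).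
have : d y w ^+ 2 <= 2 * (d y (mid x z) ^+ 2 + d (mid x z) w ^+ 2).
  have := sqr_ge0 (d y (mid x z) - d (mid x z) w); rnra.
rlra.
Qed.

Lemma dist_convex Y z : mid_convex Y (d ^~ z).
Proof.
move=> x y _ _; have := dist_mid_mid x y z z; rewrite midxx.
by apply: le_trans; rlra.
Qed.

(** Bisection: [z] lies in one half of the segment, whose ends are again in [Y], so [Y] has points
    arbitrarily close to [z]. *)
Lemma between_in Y x y z : cconvex Y -> Y x -> Y y ->
  d x z + d z y <= d x y -> Y z.
Proof.
move=> [mY cY] Yx Yy bz; apply: cY => e e0.
have key : forall n x y, Y x -> Y y -> d x z + d z y <= d x y ->
    exists2 a, Y a & d z a <= d x y / 2 ^+ n.
  elim=> [|n IH] {Yx Yy bz}x {}y Yx Yy bz.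
    exists x => //; rewrite expr0 divr1 distC.
    by have := dist_ge0 z y; rlra.
  wlog zx : x y Yx Yy bz / d x z <= d x y / 2.
    move=> wl; have [xz|xz] := lerP (d x z) (d x y / 2); first exact: wl.
    have [||a Ya za] := wl y x Yy Yx.
    - by rewrite !(distC y) (distC z x) addrC.
    - by rewrite !(distC y); rlra.
    by exists a => //; rewrite (distC x).
  have [|z' [z1 z2]] := hadamard_between HX (x := x) (y := mid x y) (t := d x z).
    by rewrite dist_ge0 dist_midl.
  have t1 := dist_tri (mid x y) z' y; have t2 := dist_tri z' x y.
  have t3 := dist_tri z x y.
  rewrite dist_midl dist_midr z1 in z2 t1 t2.
  have zz' : z = z' by apply: (between_uniq bz) => //; rlra.
  have [|a Ya za] := IH x (mid x y) Yx (mY _ _ Yx Yy).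
    by rewrite dist_midl zz' z1 z2; rlra.
  exists a => //; apply: (le_trans za); rewrite dist_midl exprS.
  by rewrite invfM mulrA.
have [n nP] : exists n, d x y / 2 ^+ n < e.
  apply/not_existsP => H; have : e <= 0.
    by apply: (@half_pow_lim R _ (d x y)) => n; rewrite leNgt; apply/negP/H.
  rlra.
by have [a Ya za] := key n _ _ Yx Yy bz; exists a => //; exact: le_lt_trans nP.
Qed.

Lemma sublevel_cconvex Y f a : cconvex Y -> mid_convex Y f -> lip1 Y f ->
  cconvex (Y `&` [set x | f x <= a]).
Proof.
move=> [mY cY] cf lf; split.
  move=> x y [Yx /= fx] [Yy /= fy]; split; first exact: mY.
  by rewrite /=; have := cf _ _ Yx Yy; rlra.
move=> x H; have Yx : Y x by apply: cY => e /H[y [? _]] ?; exists y.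
split => //=; rewrite -subr_le0; apply: (@le0_of_eps R 1) => // e e0.
have [y [Yy /= fy]] := H _ e0.
by have := lf _ _ Yx Yy; rewrite ler_norml => /andP[]; rlra.
Qed.

End Metric.

Section CAT0_hadamard.
Variables (R : realType) (X : metricType R).
Hypothesis X_CAT0 : CAT0 X.
Local Notation d := (@mdist R X).
Implicit Types (x y z p q m : X).

Let row2 (a b : R) : 'rV[R]_2 := \row_k (if k == 0 then a else b).

Let edist_row2 a b a' b' :
  edist (row2 a b) (row2 a' b') = Num.sqrt ((a - a') ^+ 2 + (b - b') ^+ 2).
Proof. by rewrite /edist !big_ord_recl big_ord0 !mxE/= addr0. Qed.

Lemma CAT0_between x y t : 0 <= t <= d x y ->
  exists z, d x z = t /\ d z y = d x y - t.
Proof.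
move=> t0; have [geo _] := X_CAT0; have [c [c0 c1 cI]] := geo x y.
have [t1 t2] := andP t0.
exists (c t); split.
  by rewrite -[x in LHS]c0 cI ?in_itv/= ?sub0r ?normrN ?ger0_norm ?lexx ?dist_ge0.
rewrite -[y in LHS]c1 cI ?in_itv/= ?lexx ?dist_ge0//.
by rewrite distrC ger0_norm// subr_ge0.
Qed.

(** The midpoint is taken on a geodesic chosen before [p]. In the plane (CN) is an equality, so
    comparison with an explicit triangle suffices. *)
Let CN_ex x y :
  exists2 m, is_mid x y m & forall p,
    d p m ^+ 2 <= (d p x ^+ 2 + d p y ^+ 2) / 2 - d x y ^+ 2 / 4.
Proof.
have [xy|xy] := eqVneq x y.
  by exists x => [|p]; rewrite /is_mid xy distxx; [split|]; nra.
have [geo cmp] := X_CAT0.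
have [c0 c0P] := geo x y; have [c00 c01 c0I] := c0P.
have D0 : 0 < d x y by rewrite mdist_gt0.
set D := d x y in D0 c0P c01 c0I *.
pose m := c0 (D / 2).
have Dh : D / 2 \in `[0, D].
  by rewrite in_itv /=; apply/andP; split; lra.
have m1 : d x m = D / 2.
  rewrite -[x in LHS]c00 c0I ?sub0r ?normrN ?ger0_norm//; [lra|].
  by rewrite in_itv/= lexx ltW.
have m2 : d m y = D / 2.
  rewrite -[y in LHS]c01 c0I//; last by rewrite in_itv/= lexx ltW.
  rewrite distrC ger0_norm; lra.
exists m => // p; set e := d x p; set f := d y p.
pose v (i : 'I_3) := nth x [:: x; y; p] i.
have [c cP c0E] : exists2 c, geodesic_triangle v c & c 0 = c0.
  (* The first side has to be the geodesic [c0] that carries [m]. *)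
  have /choice[c cP] : forall i, exists c, geodesic (v i) (v (i + 1)) c.
    by move=> i; exact: geo.
  by exists (fun i => if i == 0 then c0 else c i) => // i; case: eqP => // ->.
have [_ c11 _] := cP 1.
(* Abscissa of the comparison vertex of [p], by the law of cosines, with [x] at the origin and [y]
   at [(D, 0)]. *)
pose a := (D ^+ 2 + e ^+ 2 - f ^+ 2) / (2 * D).
have aE : 2 * (D * a) = D ^+ 2 + e ^+ 2 - f ^+ 2.
  by rewrite /a; field; rewrite gt_eqF.
have [e0 f0] : 0 <= e /\ 0 <= f by split; exact: dist_ge0.
have t1 : D <= e + f by rewrite /D /f (distC y p); exact: dist_tri.
have t2 : e <= D + f by exact: dist_tri.
have t3 : f <= D + e by rewrite /D (distC x y); exact: dist_tri.
have a1 : a <= e by rewrite -(ler_pM2l D0); nra.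
have a2 : - e <= a by rewrite -(ler_pM2l D0); nra.
have b0 : 0 <= e ^+ 2 - a ^+ 2 by nra.
pose b := Num.sqrt (e ^+ 2 - a ^+ 2).
have bE : b ^+ 2 = e ^+ 2 - a ^+ 2 by rewrite sqr_sqrtr.
pose w (i : 'I_3) := nth (row2 0 0) [:: row2 0 0; row2 D 0; row2 a b] i.
have wP : comparison_triangle v w.
  move=> [[|[|[|i]]] Hi] //; rewrite /w /v /= edist_row2.
  - rewrite (_ : _ + _ = D ^+ 2); [|ring].
    by rewrite sqrtr_sqr gtr0_norm.
  - rewrite (_ : _ + _ = f ^+ 2); last by rewrite sub0r sqrrN bE; move: aE; rnra.
    by rewrite sqrtr_sqr ger0_norm.
  - rewrite (_ : _ + _ = e ^+ 2); last by rewrite !subr0 bE; ring.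
    by rewrite sqrtr_sqr ger0_norm// distC.
have : d m p <= edist (row2 (D / 2) 0) (row2 a b).
  (* [m] is on side 0, and [p] is the far end of side 1. *)
  apply: (cmp v c w cP wP 0 1) => /=.
  - by exists (D / 2); rewrite ?c0E.
  - exists (d (v 1) (v (1 + 1))) => //.
    by rewrite /= in_itv/= lexx dist_ge0.
  - split; last first.
      rewrite /w/= edist_row2 subrr expr0n/= addr0 sub0r sqrrN sqrtr_sqr.
      by rewrite ger0_norm; [exact/esym|rlra].
    exists (1 / 2); first by rewrite in_itv/=; apply/andP; split; rlra.
    by apply/rowP => k; rewrite /w /row2 /= !mxE; case: (k == 0); ring.
  - split; last by rewrite wP.
    exists 1; first by rewrite in_itv/= ler01 lexx.
    by rewrite subrr scale0r add0r scale1r.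
rewrite edist_row2 => le; rewrite (distC p m) (distC p x) (distC p y) -/D -/e -/f.
have s0 : 0 <= (D / 2 - a) ^+ 2 + (0 - b) ^+ 2 by rewrite addr_ge0 ?sqr_ge0.
have : d m p ^+ 2 <= (D / 2 - a) ^+ 2 + (0 - b) ^+ 2.
  rewrite -[leRHS](sqr_sqrtr s0) ler_sqr// nnegrE ?sqrtr_ge0//; exact: dist_ge0.
by move=> /le_trans; apply; rewrite sub0r sqrrN bE; nra.
Qed.

(** (CN) at the point [m] itself identifies any midpoint [m] with the one of [CN_ex]. *)
Lemma CAT0_CN p x y m : is_mid x y m ->
  d p m ^+ 2 <= (d p x ^+ 2 + d p y ^+ 2) / 2 - d x y ^+ 2 / 4.
Proof.
move=> [m1 m2]; have [m' _ c] := CN_ex x y.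
suff -> : m = m' by [].
apply: dist_eq0; apply: ler_of_sqr => //; apply: (le_trans (c m)).
by rewrite (distC m x) m1 m2; have := dist_ge0 x y; rnra.
Qed.

End CAT0_hadamard.

(** * Ultrafilters and limits of nets *)

Section Ultrafilters.

Lemma ultra_seq (I : Type) (T : eqType) (U : set_system I) (f : I -> T) (s : seq T) :
  UltraFilter U -> U [set i | f i \in s] -> exists2 t, t \in s & U [set i | f i = t].
Proof.
move=> UU; elim: s => [|t s IH].
  by move=> U0; exfalso; apply: (@filter_not_empty _ U) => //; apply: filterS U0.
have [Ut _|Ut Uts] := in_ultra_setVsetC [set i | f i = t] UU.
  by exists t; rewrite ?mem_head.
have [|t' t's ?] := IH; last by exists t'; rewrite // in_cons t's orbT.
apply: filterS (filterI Ut Uts) => i [/= fit]; rewrite in_cons => /orP[/eqP//|//].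
Qed.

Lemma ultra_finite (I : Type) (T : eqType) (U : set_system I) (f : I -> T) (S : set T) :
  UltraFilter U -> finite_set S -> U [set i | S (f i)] ->
  exists2 t, S t & U [set i | f i = t].
Proof.
by move=> UU /finite_seqP[s ->] /(ultra_seq UU) [t ts]; exists t.
Qed.

Lemma ultra_ex (I : Type) (U : set_system I) (A : set I) :
  UltraFilter U -> U A -> exists i, A i.
Proof. by move=> UU; apply: filter_ex. Qed.

Lemma infinite_ultra (T : Type) (A : set T) : ~ finite_set A ->
  exists2 U, UltraFilter U & U A /\ forall B, finite_set B -> ~ U B.
Proof.
move=> infA.
pose F : set_system T := [set B | finite_set (A `\` B)].
have FF : ProperFilter F.
  split; first by rewrite /F /mkset setD0.
  split; rewrite /F /mkset.
  - by rewrite setDT.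
  - by move=> P Q fP fQ; rewrite setDIr finite_setU.
  - by move=> P Q PQ; apply: sub_finite_set; exact: setDS.
have [U [UU FU]] := ultraFilterLemma FF.
exists U => //; split; first by apply: FU; rewrite /F /mkset setDv.
move=> B fB UB; apply: (@filter_not_empty _ U).
have UC : U (~` B) by apply: FU; apply: sub_finite_set fB => x [_ /=]; exact: contrapT.
by apply: filterS (filterI UB UC) => x [].
Qed.

Lemma nat_ultra : exists2 U : set_system nat, UltraFilter U &
  forall n, U [set k | (n <= k)%N].
Proof.
have [|U UU [_ Un]] := @infinite_ultra nat setT; first exact: infinite_nat.
exists U => // n; have [//|H] := in_ultra_setVsetC [set k | (n <= k)%N] UU.
exfalso; apply: (Un _ _ H); apply: sub_finite_set (finite_II n) => k /=.
by move/negP; rewrite -ltnNge.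
Qed.

End Ultrafilters.

Section Nets.
Variables (R : realType) (X : metricType R).
Local Notation d := (@mdist R X).

Section OneUltrafilter.
Variables (I : Type) (U : set_system I).
Hypothesis UU : UltraFilter U.

Lemma real_cvgP (f : I -> R) (l : R) :
  f i @[i --> U] --> l <-> forall e, 0 < e -> U [set i | `|f i - l| < e].
Proof.
split=> H.
  move=> e e0; have /cvgrPdist_lt/(_ e e0) := H.
  by apply: filterS => i /=; rewrite distrC.
apply/cvgrPdist_lt => e e0; apply: filterS (H e e0) => i /=.
by rewrite distrC.
Qed.

Lemma net_cvgP (u : I -> X) x :
  d (u i) x @[i --> U] --> (0 : R) <-> forall e, 0 < e -> U [set i | d (u i) x < e].
Proof.
rewrite real_cvgP; split => H e e0; apply: filterS (H e e0) => i /=;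
  by rewrite subr0 ger0_norm ?dist_ge0.
Qed.

Lemma real_cvg_unique (f : I -> R) (a b : R) :
  f i @[i --> U] --> a -> f i @[i --> U] --> b -> a = b.
Proof. by move=> fa fb; rewrite -(cvg_lim (@Rhausdorff R) fa) -(cvg_lim (@Rhausdorff R) fb). Qed.

Lemma bounded_cvg (f : I -> R) (M : R) : U [set i | `|f i| <= M] ->
  exists l : R, f i @[i --> U] --> l.
Proof.
move=> fM.
have FM : U (f @^-1` `[- M, M]%classic).
  by apply: filterS fM => i; rewrite /preimage /= in_itv/= ler_norml.
have [l [_ cl]] := @segment_compact R (- M) M (f @ U) _ FM.
exists l; apply/real_cvgP => e e0.
have [//|H] := in_ultra_setVsetC [set i | `|f i - l| < e] UU; exfalso.
have [z [/= nz bz]] := cl [set y | ~ `|y - l| < e] _ H (nbhsx_ballx l e e0).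
by apply: nz; rewrite distrC.
Qed.

Lemma dist_cvg (u v : I -> X) x y :
  d (u i) x @[i --> U] --> (0 : R) -> d (v i) y @[i --> U] --> (0 : R) ->
  d (u i) (v i) @[i --> U] --> d x y.
Proof.
move=> /net_cvgP ux /net_cvgP vy; apply/real_cvgP => e e0.
have e20 : 0 < e / 2 by rewrite divr_gt0.
apply: filterS (filterI (ux _ e20) (vy _ e20)) => i [/= h1 h2].
have := dist_diff (v i) (u i) x; have := dist_diff x (v i) y.
rewrite (distC x (v i)) (distC x y) !ltr_norml !ler_norml.
by move=> /andP[? ?] /andP[? ?]; apply/andP; split; lra.
Qed.

Lemma cst_net (x : X) : d x x @[i --> U] --> (0 : R).
Proof. by rewrite distxx; exact: cvg_cst. Qed.

Lemma net_unique (u : I -> X) x y :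
  d (u i) x @[i --> U] --> (0 : R) -> d (u i) y @[i --> U] --> (0 : R) -> x = y.
Proof.
move=> ux uy; apply: dist_eq0; have := dist_cvg ux uy.
under eq_fun do rewrite distxx.
by move=> /(real_cvg_unique (cvg_cst _)) <-.
Qed.

Lemma net_near (u v : I -> X) x :
  d (u i) x @[i --> U] --> (0 : R) -> d (u i) (v i) @[i --> U] --> (0 : R) ->
  d (v i) x @[i --> U] --> (0 : R).
Proof.
move=> /net_cvgP ux /real_cvgP uv; apply/net_cvgP => e e0.
have e20 : 0 < e / 2 by rewrite divr_gt0.
apply: filterS (filterI (ux _ e20) (uv _ e20)) => i [/= h1].
rewrite subr0 ger0_norm ?dist_ge0// => h2.
by have := dist_tri (u i) (v i) x; rewrite (distC (v i) (u i)); rlra.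
Qed.

Lemma squeeze0 (f g : I -> R) : U [set i | 0 <= f i <= g i] ->
  g i @[i --> U] --> (0 : R) -> f i @[i --> U] --> (0 : R).
Proof. by move=> fg; apply: (squeeze_cvgr fg); exact: cvg_cst. Qed.

Lemma lim_le (f g : I -> R) (a b : R) : f i @[i --> U] --> a -> g i @[i --> U] --> b ->
  U [set i | f i <= g i] -> a <= b.
Proof.
move=> /real_cvgP fa /real_cvgP gb fg; rewrite leNgt; apply/negP => ba.
have e0 : 0 < (a - b) / 2 by rewrite divr_gt0// subr_gt0.
have [i [/= [+ +] +]] := ultra_ex UU (filterI (filterI (fa _ e0) (gb _ e0)) fg).
by rewrite !ltr_norml => /andP[? ?] /andP[? ?] ?; lra.
Qed.

Lemma lim_eq (f g : I -> R) (a : R) : U [set i | f i = g i] ->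
  f i @[i --> U] --> a -> g i @[i --> U] --> a.
Proof.
move=> fg /real_cvgP fa; apply/real_cvgP => e e0.
by apply: filterS (filterI fg (fa _ e0)) => i [/= ->].
Qed.

Lemma lim_const (a : R) : (fun=> a) i @[i --> U] --> a.
Proof. exact: cvg_cst. Qed.

Lemma lim_add (f g : I -> R) (a b : R) : f i @[i --> U] --> a -> g i @[i --> U] --> b ->
  f i + g i @[i --> U] --> a + b.
Proof. by move=> fa gb; exact: cvgD. Qed.

Lemma lim_sub (f g : I -> R) (a b : R) : f i @[i --> U] --> a -> g i @[i --> U] --> b ->
  f i - g i @[i --> U] --> a - b.
Proof. by move=> fa gb; exact: cvgB. Qed.

Lemma lim_scale (f : I -> R) (a c : R) : f i @[i --> U] --> a ->
  c * f i @[i --> U] --> c * a.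
Proof. by move=> fa; exact: cvgMr. Qed.

End OneUltrafilter.
End Nets.

Arguments lim_const {R I U} UU a.

(** * Local compactness from a proper cocompact action *)

Section ProperAction.
Variables (R : realType) (X : metricType R) (G : groupType) (act : G -> X -> X).
Local Notation d := (@mdist R X).
Hypotheses (act_action : group_action act) (act_isometric : isometric act).
Hypotheses (act_pd : properly_discontinuous act) (act_cc : cocompact act).

Lemma actV g x : act g^-1%g (act g x) = x.
Proof. by case: act_action => a1 aM; rewrite -aM mulVg a1. Qed.

Lemma actVK g x : act g (act g^-1%g x) = x.
Proof. by case: act_action => a1 aM; rewrite -aM mulgV a1. Qed.

Let pd_radius x : exists2 r : R, 0 < r & exists2 S : set G, finite_set S &
  forall g y, d x y < r -> d x (act g y) < r -> S g.
Proof.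
have [r r0 fS] := act_pd x; exists r => //; eexists; first exact: fS.
move=> g y xy xgy; exists (act g y); split; last by rewrite ballEmdist.
by exists y => //; rewrite ballEmdist.
Qed.

Let fundamental_set : exists2 C : set X, (forall x, exists g, C (act g x)) &
  compact C.
Proof.
have [C cC CT] := act_cc; exists C => // x.
have [g _ [c Cc gc]] : (\bigcup_g (act g @` C)) x by rewrite CT.
by exists g^-1%g; rewrite -gc actV.
Qed.

Let compact_net (C : set X) : compact C -> forall I (U : set_system I), UltraFilter U ->
  forall u : I -> X, U [set i | C (u i)] -> exists x, d (u i) x @[i --> U] --> (0 : R).
Proof.
move=> cC I U UU u UC.
have [x [_ cl]] := cC (u @ U) _ UC.
exists x; apply/net_cvgP => e e0.
have [//|H] := in_ultra_setVsetC [set i | d (u i) x < e] UU; exfalso.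
have [z [/= nz bz]] := cl [set y | ~ d y x < e] _ H (nbhsx_ballx x e e0).
by apply: nz; rewrite distC; move: bz; rewrite ballEmdist.
Qed.

(** Compactness means clustering of filters here. Without a finite cover, the sets of points left
    uncovered generate a proper filter, and the ball around a cluster point refutes it. *)
Let compact_cover_seq (C : set X) (r : X -> R) : compact C -> (forall x, 0 < r x) ->
  exists s : seq X, forall x, C x -> exists2 c, c \in s & d c x < r c.
Proof.
move=> cC r0; apply: contrapT => /forallNP nocover.
pose W (s : seq X) := [set x | C x /\ forall c, c \in s -> r c <= d c x].
have FF : ProperFilter [set A | exists s, W s `<=` A].
  split.
    move=> [s sP]; apply: (nocover s) => x Cx; apply: contrapT => H.
    apply: (sP x); split => // c cs; rewrite leNgt; apply/negP => lt.
    by apply: H; exists c.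
  split; first by exists [::].
  - move=> A B [s sA] [t tB]; exists (s ++ t) => x [Cx H].
    split; [apply: sA|apply: tB]; split => // c cs; apply: H.
      by rewrite mem_cat cs.
    by rewrite mem_cat cs orbT.
  - by move=> A B AB [s sA]; exists s; apply: subset_trans AB.
have [|x [Cx cl]] := cC _ FF; first by exists [::] => x [].
have [||y [[_ yx]]] := cl (W [:: x]) (ball x (r x)); first by exists [:: x].
  exact: nbhsx_ballx.
by rewrite ballEmdist /= ltNge yx ?mem_head.
Qed.

Lemma cocompact_dist (o : X) : exists D, forall x, exists g, d (act g x) o <= D.
Proof.
have [C CT cC] := fundamental_set.
have [s sP] := compact_cover_seq (r := fun=> 1) cC (fun=> ltr01).
have [D DP] : exists D, forall c, c \in s -> d c o <= D.
  elim: s {sP} => [|c s [D DP]]; first by exists 0.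
  exists (Num.max (d c o) D) => x; rewrite in_cons => /orP[/eqP ->|/DP].
    by rewrite le_max lexx.
  by rewrite le_max => ->; rewrite orbT.
exists (D + 1) => x; have [g Cg] := CT x; exists g.
have [c cs dc] := sP _ Cg; have := DP _ cs; have := dist_tri c (act g x) o.
by rewrite (distC _ c); rlra.
Qed.

(** The net is carried into the compact set by elements [g i]. The products [g i0 * (g i)^-1] map a
    point of one good ball back into it, so they take finitely many values; on a member of [U] the
    net is then a fixed translate of a convergent one. *)
Lemma uniform_radius : exists2 rho : R, 0 < rho &
  forall I (U : set_system I), UltraFilter U ->
  forall (x : X) (u : I -> X), U [set i | d x (u i) < rho] ->
  exists y, d (u i) y @[i --> U] --> (0 : R).
Proof.
have [C CT cC] := fundamental_set.
have /choice [r rP] : forall x, exists r, 0 < r /\ exists2 S : set G, finite_set S &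
  forall g y, d x y < r -> d x (act g y) < r -> S g.
  by move=> x; have [r r0 rS] := pd_radius x; exists r.
(* A quarter leaves room: [a i0] is within [r c0 / 4] of [c0], and [u i] within
   [2 * rho <= r c0 / 2] of [u i0]. *)
have [|s sP] := compact_cover_seq (r := fun x => r x / 4) cC.
  by move=> x; have [] := rP x; rlra.
have [rho rho0 rhoP] : exists2 rho : R, 0 < rho & forall c, c \in s -> rho <= r c / 4.
  elim: s {sP} => [|c s [D D0 DP]]; first by exists 1.
  exists (Num.min (r c / 4) D); first by have [c0 _] := rP c; rewrite lt_min D0 divr_gt0.
  move=> x; rewrite in_cons => /orP[/eqP ->|/DP].
    by rewrite ge_min lexx.
  by rewrite ge_min => ->; rewrite orbT.
exists rho => // I U UU x u Ux.
have /choice[g gP] : forall i, exists g, C (act g (u i)) by move=> i; exact: CT.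
pose a i := act (g i) (u i).
have /choice[c cP] : forall i, exists c, c \in s /\ d c (a i) < r c / 4.
  by move=> i; have [c ? ?] := sP _ (gP i); exists c.
have [|c0 c0s Uc0] := @ultra_seq _ _ U c s UU.
  by apply: filterS filterT => i _ /=; have [] := cP i.
have [i0 [/= ci0 xi0]] := ultra_ex UU (filterI Uc0 Ux).
have [r0 [S fS SP]] := rP c0.
have [|k Sk Uk] := @ultra_finite _ _ U (fun i => (g i0 * (g i)^-1)%g) S UU fS.
  apply: filterS (filterI Uc0 Ux) => i [/= ci xi].
  apply: (SP _ (a i)).
    by have [_] := cP i; rewrite ci; lra.
  have -> : act (g i0 * (g i)^-1)%g (a i) = act (g i0) (u i).
    by case: act_action => _ ->; rewrite /a actV.
  have := dist_tri (a i0) c0 (act (g i0) (u i)).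
  have [_] := cP i0; rewrite ci0 => h1; rewrite act_isometric => h2.
  have := dist_tri x (u i0) (u i); rewrite (distC _ x) => h3.
  by have := rhoP _ c0s; lra.
have [|y yP] := compact_net cC UU (u := a).
  by apply: filterS filterT => i _; exact: gP.
exists (act ((g i0)^-1 * k)%g y); apply: lim_eq yP.
apply: filterS Uk => i /= gk.
rewrite -[in RHS](actV (g i) (u i)) -[in RHS](mulKg (g i0) (g i)^-1%g) gk.
by rewrite act_isometric.
Qed.

End ProperAction.

Section HadamardOfAction.
Variables (R : realType) (X : metricType R) (G : groupType) (act : G -> X -> X).
Local Notation d := (@mdist R X).
Hypotheses (act_action : group_action act) (act_isometric : isometric act).
Hypotheses (act_pd : properly_discontinuous act) (act_cc : cocompact act).

(* Hopf-Rinow: the radius of the balls in which nets converge can be increased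
   by a fixed amount, moving along geodesics. *)
Lemma CAT0_proper_hadamard : CAT0 X -> proper_hadamard X.
Proof.
move=> X_CAT0; split; first exact: CAT0_between.
  by move=> p x y m; exact: CAT0_CN.
have [rho rho0 rhoP] := uniform_radius act_action act_isometric act_pd act_cc.
have step (n : nat) : forall (I : Type) (U : set_system I), UltraFilter U ->
    forall (o : X) (u : I -> X), U [set i | d o (u i) <= n%:R * (rho / 2)] ->
    exists x, d (u i) x @[i --> U] --> (0 : R).
  elim: n => [|n IH] I U UU o u Uu.
    exists o; apply/net_cvgP => e e0; apply: filterS Uu => i /=.
    by rewrite mul0r distC => /le_lt_trans; exact.
  have /choice[w wP] : forall i, exists w, d o (u i) <= n.+1%:R * (rho / 2) ->
      d o w <= n%:R * (rho / 2) /\ d w (u i) <= rho / 2.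
    move=> i; have [le|gt] := lerP (d o (u i)) (n%:R * (rho / 2)).
      by exists (u i) => _; rewrite distxx; split => //; rlra.
    have n0 : 0 <= n%:R * (rho / 2) by apply: mulr_ge0 => //; rlra.
    have [|w [w1 w2]] := CAT0_between X_CAT0 (x := o) (y := u i) (t := n%:R * (rho / 2)).
      by rewrite n0 ltW.
    by exists w => H; rewrite w1 w2 lexx; split => //; rewrite -natr1 mulrDl in H; lra.
  have [|w0 w0P] := IH I U UU o w; first by apply: filterS Uu => i /= /wP[].
  apply: (rhoP I U UU w0 u).
  have r20 : 0 < rho / 2 by rewrite divr_gt0.
  have {}w0P := (net_cvgP UU _ _).1 w0P _ r20.
  apply: filterS (filterI Uu w0P) => i [/= /wP[_ h1] h2].
  by have := dist_tri (w i) w0 (u i); rewrite (distC w0 (w i)); rlra.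
move=> I U UU o u M Uu.
pose n := Num.bound (`|M| / (rho / 2)); apply: (step n I U UU o).
apply: filterS Uu => i /= /le_trans; apply; apply: (le_trans (ler_norm M)).
rewrite -ler_pdivrMr ?divr_gt0//; apply/ltW/archi_boundP.
by rewrite divr_ge0// divr_ge0// ltW.
Qed.

Hypothesis HX : proper_hadamard X.

(** Otherwise the orbit points converge along a nonprincipal ultrafilter. Proper discontinuity at
    the limit leaves finitely many values for [g * g0^-1], so a single [g] carries the
    ultrafilter. *)
Lemma finite_displacement (o : X) (M : R) :
  finite_set [set g | d (act g o) o <= M].
Proof.
apply: contrapT => inf; have [U UU [UA Ufin]] := infinite_ultra inf.
have [|p pP] := hadamard_net HX UU (o := o) (u := fun g => act g o) (M := M).
  by apply: filterS UA => g /=; rewrite distC.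
have [r r0 fS] := act_pd p.
have {}pP := (net_cvgP UU _ _).1 pP _ r0.
have [g0 /= g0P] := ultra_ex UU pP.
set S := (X in finite_set X) in fS.
have [|k Sk Uk] := @ultra_finite _ _ U (fun g => (g * g0^-1)%g) S UU fS.
  apply: filterS pP => g /= gP; exists (act g o).
  split; last by rewrite ballEmdist /= distC.
  exists (act g0 o); first by rewrite ballEmdist /= distC.
  by case: act_action => _ ->; rewrite actV.
apply: (Ufin [set (k * g0)%g]); first exact: finite_set1.
by apply: filterS Uk => g /= <-; rewrite mulgVK.
Qed.

End HadamardOfAction.

Section Packing.
Variables (R : realType) (X : metricType R).
Local Notation d := (@mdist R X).
Hypothesis HX : proper_hadamard X.

(** Ever larger separated families would have an infinite separated sequence as ultralimit, and this
    sequence would have a cluster point. *)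
Lemma packing (o : X) (M : R) : exists N : nat, forall n (f : nat -> X),
  (forall i, (i < n)%N -> d o (f i) <= M) ->
  (forall i j, (i < j < n)%N -> 1 <= d (f i) (f j)) -> (n <= N)%N.
Proof.
apply: contrapT => /forallNP H.
have /choice[f fP] : forall N, exists f : nat -> X,
    (forall i, (i < N)%N -> d o (f i) <= M) /\
    (forall i j, (i < j < N)%N -> 1 <= d (f i) (f j)).
  move=> N; have := H N => /existsNP[n /existsNP[f]].
  move=> /not_implyP[f1 /not_implyP[f2 /negP]]; rewrite -ltnNge => Nn.
  exists f; split; first by move=> i /ltn_trans/(_ Nn); exact: f1.
  by move=> i j /andP[ij /ltn_trans/(_ Nn) jn]; apply: f2; rewrite ij.
have [U UU Un] := nat_ultra.
have /choice[y yP] : forall i, exists y, d (f N i) y @[N --> U] --> (0 : R).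
  move=> i; apply: (hadamard_net HX UU (o := o) (M := M)).
  by apply: filterS (Un i.+1) => N /= iN; have [f1 _] := fP N; exact: f1.
have y1 i j : (i < j)%N -> 1 <= d (y i) (y j).
  move=> ij; apply: (lim_le UU (cvg_cst _) (dist_cvg UU (yP i) (yP j))).
  by apply: filterS (Un j.+1) => N /= iN; have [_ f2] := fP N; apply: f2; rewrite ij.
have [|p pP] := hadamard_net HX UU (o := o) (u := y) (M := M).
  apply: filterS filterT => i _ /=.
  apply: (lim_le UU (dist_cvg UU (cst_net UU o) (yP i)) (cvg_cst _)).
  by apply: filterS (Un i.+1) => N /= iN; have [f1 _] := fP N; exact: f1.
have h0 : (0 : R) < 1 / 2 by rlra.
have {}pP := (net_cvgP UU _ _).1 pP _ h0.
have [i /= ip] := ultra_ex UU pP.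
have [j [/= ij jp]] := ultra_ex UU (filterI (Un i.+1) pP).
have := y1 i j ij; have := dist_tri p (y i) (y j); rewrite (distC p (y j)); rlra.
Qed.

End Packing.

Section Resolvent.
Variables (R : realType) (X : metricType R).
Local Notation d := (@mdist R X).
Hypothesis HX : proper_hadamard X.
Implicit Types (x y z q : X) (Y : set X) (F : X -> R).

Lemma argmin Y (g : X -> R) o y0 M : Y y0 ->
  dist_closed Y -> (forall y, Y y -> g y <= g y0 -> d o y <= M) ->
  (forall (U : set_system X) x, UltraFilter U -> U Y -> Y x ->
     d y x @[y --> U] --> (0 : R) -> g y @[y --> U] --> g x) ->
  exists2 x, Y x & forall y, Y y -> g x <= g y.
Proof.
move=> Yy0 cY coer cont.
pose F := [set A | exists2 z, Y z & [set y | Y y /\ g y <= g z] `<=` A].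
have FF : ProperFilter F.
  split; first by move=> [z Yz /(_ z)]; apply; split.
  split; first by exists y0.
  - move=> A B [z Yz zA] [w Yw wB].
    have [zw|wz] := leP (g z) (g w).
      by exists z => // y [Yy gy]; split; [exact: zA|apply: wB; split=> //; exact: le_trans zw].
    by exists w => // y [Yy gy]; split; [apply: zA; split=> //; exact: le_trans (ltW wz)|exact: wB].
  - by move=> A B AB [z Yz zA]; exists z => //; exact: subset_trans AB.
have [U [UU FU]] := ultraFilterLemma FF.
have Uz z : Y z -> U [set y | Y y /\ g y <= g z] by move=> Yz; apply: FU; exists z.
have [|x xP] := hadamard_net HX UU (o := o) (u := id) (M := M).
  by apply: filterS (Uz _ Yy0) => y [/= Yy]; exact: coer.
have UY : U Y by apply: filterS (Uz _ Yy0) => y [].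
have Yx : Y x.
  apply: cY => e e0; have [y [/= Yy yx]] := ultra_ex UU (filterI UY ((net_cvgP UU _ _).1 xP _ e0)).
  by exists y => //; rewrite distC.
exists x => // z Yz.
apply: (lim_le UU (cont U x UU UY Yx xP) (cvg_cst _)).
by apply: filterS (Uz _ Yz) => y [].
Qed.

(** The penalty gives a unique minimizer even when [F] is unbounded below, and one that depends
    equivariantly on [x]. With [F = 0] it is the nearest point. *)
Definition moreau F (k : R) x y := F y + k * d x y ^+ 2.

Definition resolvent Y F k x :=
  xget x [set y | Y y /\ forall z, Y z -> moreau F k x y <= moreau F k x z].

Section Fixed.
Variables (Y : set X) (F : X -> R) (k : R).
Hypotheses (k0 : 0 < k) (Yne : Y !=set0) (cY : cconvex Y).
Hypotheses (cF : mid_convex Y F) (lF : lip1 Y F).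
Local Notation J := (resolvent Y F k).

Lemma resolventP x : Y (J x) /\ forall z, Y z -> moreau F k x (J x) <= moreau F k x z.
Proof.
rewrite /resolvent; case: xgetP => [y _ []//|none]; exfalso.
have [y0 Yy0] := Yne.
pose c := (d x y0 + k * d x y0 ^+ 2) / k.
have c0 : 0 <= c.
  apply: divr_ge0; last exact: ltW.
  by apply: addr_ge0; [exact: dist_ge0|apply: mulr_ge0; [exact: ltW|exact: sqr_ge0]].
(* A better [y] than [y0], at distance [D] from [x], satisfies [k * D ^+ 2 <= D + k * c], which
   fails beyond [1 + 1 / k + c]. *)
have [||y Yy ymin] := @argmin Y (moreau F k x) x y0 (1 + 1 / k + c) Yy0 cY.2.
- move=> y Yy; rewrite /moreau => le.
  have := lF Yy Yy0; have := dist_tri x y y0; rewrite (distC y x) => t.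
  rewrite ler_norml => /andP[l1 l2].
  have : k * d x y ^+ 2 <= d x y + k * c.
    have -> : k * c = d x y0 + k * d x y0 ^+ 2 by rewrite /c mulrC divfK ?gt_eqF.
    lra.
  have : k * (1 / k) = 1 by rewrite mulrC divfK ?gt_eqF.
  have : 0 < 1 / k by rewrite divr_gt0.
  move: (1 / k) => k' k'0 kk' h; rewrite leNgt; apply/negP => lt.
  have : 0 < (d x y - (1 + k' + c)) by lra.
  move: (d x y) (dist_ge0 x y) h lt => D D0 h lt h2.
  have h1 : k * D ^+ 2 > k * (1 + k' + c) * D by nra.
  have h3 : k * D * c >= k * c by apply: ler_pM => //; nra.
  nra.
- move=> U y UU UY Yy yP; apply: cvgD.
    apply/(real_cvgP UU) => e e0.
    apply: filterS (filterI UY ((net_cvgP UU _ _).1 yP _ e0)) => z [/= Yz] .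
    by apply: le_lt_trans; exact: lF.
  apply: cvgMr => //; rewrite expr2; under eq_fun do rewrite expr2.
  by apply: cvgM; apply: (dist_cvg UU (cst_net UU x) yP).
by apply: (none y).
Qed.

Lemma resolvent_in x : Y (J x). Proof. by have [] := resolventP x. Qed.

Lemma resolvent_min x z : Y z -> moreau F k x (J x) <= moreau F k x z.
Proof. by have [_] := resolventP x; exact. Qed.

Lemma moreau_mid x y z : Y y -> Y z -> moreau F k x (mid y z) <=
  (moreau F k x y + moreau F k x z) / 2 - k / 4 * d y z ^+ 2.
Proof.
move=> Yy Yz; rewrite /moreau; have := cF Yy Yz; have := ler_wpM2l (ltW k0) (CN HX x y z); rlra.
Qed.

(* Strong convexity of the Moreau functional at its minimizer, from midpoints
   by iteration. *)
Lemma moreau_strong x y q : Y y -> (forall z, Y z -> moreau F k x y <= moreau F k x z) ->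
  Y q -> moreau F k x y + k * d y q ^+ 2 <= moreau F k x q.
Proof.
move=> Yy ymin Yq; rewrite -subr_le0.
apply: (@half_pow_lim R _ (k * d y q ^+ 2)) => n.
suff : moreau F k x y + k * d y q ^+ 2 * (1 - 1 / 2 ^+ n) <= moreau F k x q by rlra.
elim: n q Yq => [|n IH] q Yq; first by rewrite expr0 divr1 subrr mulr0 addr0; exact: ymin.
have := moreau_mid x Yy Yq; have := IH _ (cY.1 _ _ Yy Yq).
have -> : 1 / 2 ^+ n.+1 = 1 / 2 ^+ n / 2 :> R.
  by rewrite (exprS _ n); field; rewrite ?expf_neq0 ?pnatr_eq0.
rewrite dist_midl//; move: (1 / 2 ^+ n : R) => t h1 h2.
have : k * (d y q / 2) ^+ 2 * (1 - t) =
  k * d y q ^+ 2 * (1 - t / 2) / 2 - k / 4 * d y q ^+ 2 by field.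
lra.
Qed.

Lemma resolvent_uniq x y : Y y ->
  (forall z, Y z -> moreau F k x y <= moreau F k x z) -> y = J x.
Proof.
move=> Yy ymin; apply: dist_eq0; apply: ler_of_sqr => //.
have := moreau_strong Yy ymin (resolvent_in x); have := resolvent_min x Yy.
by move=> h1 h2; rewrite expr0n /= -(pmulr_rle0 _ k0); lra.
Qed.

(** In the sum of the strong convexity inequalities at the two minimizers the values of [F] cancel;
    [quad] bounds what is left. *)
Lemma resolvent_nonexp x y : d (J x) (J y) <= d x y.
Proof.
apply: ler_of_sqr; first exact: dist_ge0.
have := moreau_strong (resolvent_in x) (@resolvent_min x) (resolvent_in y).
have := moreau_strong (resolvent_in y) (@resolvent_min y) (resolvent_in x).
have := quad HX x y (J y) (J x).
rewrite /moreau (distC (J y) (J x)) (distC (J x) x) => q h1 h2.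
rewrite -(ler_pM2l k0); have := ler_wpM2l (ltW k0) q; rlra.
Qed.

(** The Moreau functional is only shifted by the constant [c], so uniqueness of the minimizer
    applies. *)
Lemma resolvent_equiv x (f f' : X -> X) c :
  (forall y, Y y -> Y (f y)) -> (forall y, Y y -> Y (f' y) /\ f (f' y) = y) ->
  (forall y, Y y -> d (f x) (f y) = d x y) -> (forall y, Y y -> F (f y) = F y + c) ->
  J (f x) = f (J x).
Proof.
move=> fY f'Y fI fF; apply/esym/resolvent_uniq; first exact/fY/resolvent_in.
move=> z /f'Y[Yz' <-]; rewrite /moreau !fF ?fI//; last 2 first.
- exact: resolvent_in.
- exact: resolvent_in.
by have := resolvent_min x Yz'; rewrite /moreau; lra.
Qed.

End Fixed.

Definition proj Y := resolvent Y (fun=> 0) 1.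

Section Projection.
Variable Y : set X.
Hypotheses (Yne : Y !=set0) (cY : cconvex Y).

Let cF0 : mid_convex Y (fun=> 0). Proof. by move=> x y _ _; rlra. Qed.
Let lF0 : lip1 Y (fun=> 0).
Proof. by move=> x y _ _; rewrite subrr normr0; exact: dist_ge0. Qed.

Lemma proj_in x : Y (proj Y x).
Proof. exact: resolvent_in. Qed.

Lemma proj_min x y : Y y -> d x (proj Y x) <= d x y.
Proof.
move=> Yy; have := resolvent_min ltr01 Yne cY lF0 x Yy.
by rewrite /moreau !add0r !mul1r; apply: ler_of_sqr; exact: dist_ge0.
Qed.

Lemma proj_nonexp x y : d (proj Y x) (proj Y y) <= d x y.
Proof. exact: resolvent_nonexp. Qed.

Lemma proj_equiv x (f f' : X -> X) :
  (forall y, Y y -> Y (f y)) -> (forall y, Y y -> Y (f' y) /\ f (f' y) = y) ->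
  (forall y, Y y -> d (f x) (f y) = d x y) -> proj Y (f x) = f (proj Y x).
Proof.
move=> fY f'Y fI; apply: (@resolvent_equiv _ _ _ _ Yne cY cF0 lF0 x f f' 0) => //.
by move=> y _; rewrite addr0.
Qed.

Lemma dist_proj_lip : lip1 setT (fun x => d x (proj Y x)).
Proof.
move=> x y _ _; rewrite ler_norml; apply/andP.
have := proj_min x (proj_in y); have := proj_min y (proj_in x).
have := dist_tri y x (proj Y y); have := dist_tri x y (proj Y x).
by rewrite (distC y x); split; lra.
Qed.

Lemma dist_proj_convex Z : mid_convex Z (fun x => d x (proj Y x)).
Proof.
move=> x y _ _; apply: (le_trans _ (dist_mid_mid HX _ _ _ _)).
by apply: proj_min; apply: cY.1; exact: proj_in.
Qed.

End Projection.
End Resolvent.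

(** * Euclidean factors *)

Section LineSplittings.
Variables (R : realType) (X : metricType R).
Local Notation d := (@mdist R X).
Implicit Types (x y z q : X) (Y : set X) (b : X -> R) (T : R -> X -> X).

(* [Y] splits off a line: [b] is the coordinate along the line, [T] the
   translations; the last clause is the Pythagorean theorem, in the form of a
   law of cosines. *)
Definition line_split Y b T :=
  [/\ forall t y, Y y -> Y (T t y),
      forall t y, Y y -> b (T t y) = b y + t &
      forall t x y, Y x -> Y y ->
        d x (T t y) ^+ 2 = d x y ^+ 2 + t ^+ 2 - 2 * t * (b x - b y)].

(** This encodes a product decomposition of [Y] with a Euclidean factor of dimension [k]; the second
    clause makes the lines orthogonal. *)
Definition split_sys Y k (b : nat -> X -> R) (T : nat -> R -> X -> X) :=
  (forall i, (i < k)%N -> line_split Y (b i) (T i)) /\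
  (forall i j t x, (i < k)%N -> (j < k)%N -> i != j -> Y x -> b i (T j t x) = b i x).

Lemma sqr_dist_eq x y z w : d x y ^+ 2 = d z w ^+ 2 -> d x y = d z w.
Proof. by move/eqP; rewrite eqrXn2 ?dist_ge0// => /eqP. Qed.

Section One.
Variables (Y : set X) (b : X -> R) (T : R -> X -> X).
Hypothesis bT : line_split Y b T.

Lemma split_in t y : Y y -> Y (T t y). Proof. by case: bT => + _ _; exact. Qed.
Lemma split_coord t y : Y y -> b (T t y) = b y + t.
Proof. by case: bT => _ + _; exact. Qed.
Lemma split_cos t x y : Y x -> Y y ->
  d x (T t y) ^+ 2 = d x y ^+ 2 + t ^+ 2 - 2 * t * (b x - b y).
Proof. by case: bT => _ _; exact. Qed.

Lemma split_disp t y : Y y -> d y (T t y) = `|t|.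
Proof.
move=> Yy; have := split_cos t Yy Yy.
rewrite distxx subrr mulr0 subr0 expr0n add0r => e; apply/eqP.
by rewrite -(@eqrXn2 _ 2)// ?dist_ge0// e real_normK ?num_real.
Qed.

Lemma split_lip1 : lip1 Y b.
Proof.
move=> x y Yx Yy; apply: ler_of_sqr; first exact: dist_ge0.
rewrite real_normK ?num_real//; have := split_cos (b x - b y) Yx Yy.
have := sqr_ge0 (d x (T (b x - b y) y)); rnra.
Qed.

(** In (CN) at [T t (mid x y)] everything cancels except a term linear in [t]; its coefficient
    vanishes by taking both signs of [t]. *)
Lemma split_affine : proper_hadamard X -> mid_closed Y -> mid_affine Y b.
Proof.
move=> HX mY x y Yx Yy; have Ym := mY _ _ Yx Yy.
have key t : t * (b x + b y - 2 * b (mid x y)) <= 0.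
  have := CN HX (T t (mid x y)) x y; rewrite !(distC (T t _)) !split_cos//.
  rewrite distxx dist_midl// (distC y) dist_midr// subrr; rnra.
by apply/le_anti; have := key 1; have := key (- 1) => *; apply/andP; split; lra.
Qed.

Lemma split_iso t x y : Y x -> Y y -> d (T t x) (T t y) = d x y.
Proof.
move=> Yx Yy; apply: sqr_dist_eq; rewrite split_cos ?split_coord//; last exact: split_in.
by rewrite distC split_cos// (distC y); ring.
Qed.

Lemma split_uniq t x z : Y x -> Y z -> d x z <= `|t| -> b z = b x + t -> z = T t x.
Proof.
move=> Yx Yz xz bz; apply: dist_eq0; apply: ler_of_sqr => //.
rewrite split_cos// bz distC; have := dist_ge0 x z.
have : d x z ^+ 2 <= t ^+ 2 by rewrite -[leRHS]real_normK ?num_real// ler_sqr ?nnegrE ?dist_ge0.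
rlra.
Qed.

End One.

(** The distance from [T t y] to [T' 1 y] is computed with each of the two laws of cosines. *)
Lemma split_orth Y b T b' T' : line_split Y b T -> line_split Y b' T' ->
  (forall t y, Y y -> b (T' t y) = b y) ->
  forall t y, Y y -> b' (T t y) = b' y.
Proof.
move=> bT bT' H t y Yy; have Yt := split_in bT t Yy; have Y1 := split_in bT' 1 Yy.
have := split_cos bT' 1 Yt Yy; rewrite (distC (T t y) (T' 1 y)) (split_cos bT)//.
rewrite H// (distC (T' 1 y)) (distC (T t y)) (split_disp bT)// (split_disp bT')//.
by rewrite normr1 real_normK ?num_real//; lra.
Qed.

Lemma split_conj Y Y' b T (f f' : X -> X) :
  (forall x, Y x -> Y' (f x)) -> (forall x, Y' x -> Y (f' x)) ->
  (forall x, Y x -> f' (f x) = x) -> (forall x, Y' x -> f (f' x) = x) ->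
  (forall x y, Y x -> Y y -> d (f x) (f y) = d x y) ->
  line_split Y b T -> line_split Y' (b \o f') (fun t => f \o T t \o f').
Proof.
move=> fY f'Y fK f'K fI bT; split=> /=.
- by move=> t y /f'Y Yy; apply/fY/(split_in bT).
- by move=> t y /f'Y Yy; rewrite fK ?(split_coord bT)//; exact: (split_in bT).
- move=> t x y Yx Yy; have [Yx' Yy'] := (f'Y _ Yx, f'Y _ Yy).
  rewrite -{1}(f'K x)// fI ?(split_cos bT)//; last exact: (split_in bT).
  by rewrite -(fI (f' x))// !f'K.
Qed.

Lemma sys_conj Y Y' k (b : nat -> X -> R) (T : nat -> R -> X -> X) (f f' : X -> X) :
  (forall x, Y x -> Y' (f x)) -> (forall x, Y' x -> Y (f' x)) ->
  (forall x, Y x -> f' (f x) = x) -> (forall x, Y' x -> f (f' x) = x) ->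
  (forall x y, Y x -> Y y -> d (f x) (f y) = d x y) ->
  split_sys Y k b T ->
  split_sys Y' k (fun i => b i \o f') (fun i t => f \o T i t \o f').
Proof.
move=> fY f'Y fK f'K fI [lT oT]; split.
  by move=> i ik; apply: (split_conj fY f'Y fK f'K fI); exact: lT.
move=> i j t x ik jk ij /f'Y Yx; rewrite /= fK ?oT//.
exact: (split_in (lT j jk)).
Qed.

(* The lower law of cosines for a one-sided ray along which an affine function
   decreases at unit speed. *)
Lemma affine_ray_cos Y (f : X -> R) s x x' y :
  proper_hadamard X -> mid_closed Y -> mid_affine Y f -> lip1 Y f ->
  Y x -> Y x' -> Y y -> d x x' <= s -> f x' = f x - s ->
  d x y ^+ 2 + s ^+ 2 - 2 * s * (f x - f y) <= d y x' ^+ 2.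
Proof.
move=> HX mY af lf Yx Yx' Yy xs fx'.
have s0 : 0 <= s := le_trans (dist_ge0 x x') xs.
have xs2 : d x x' ^+ 2 <= s ^+ 2 by rewrite ler_sqr// nnegrE dist_ge0.
(* The Lipschitz bound gives the inequality up to an error [d x y ^+ 2]; passing to the midpoint of
   [x] and [y] and applying (CN) halves this error. *)
rewrite -subr_le0; apply: (@half_pow_lim R _ (d x y ^+ 2)) => n.
elim: n y Yy => [|n IH] y Yy.
  have := lf _ _ Yy Yx'; rewrite expr0 divr1 fx' => l.
  have : (f y - (f x - s)) ^+ 2 <= d y x' ^+ 2.
    by rewrite -[leLHS]real_normK ?num_real// ler_sqr// nnegrE ?dist_ge0.
  by have := sqr_ge0 (f x - f y); rnra.
have := IH _ (mY _ _ Yx Yy); rewrite dist_midl// af//.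
have := CN HX x' x y; rewrite !(distC x') => c.
have -> : d x y ^+ 2 / 2 ^+ n.+1 = 2 * ((d x y / 2) ^+ 2 / 2 ^+ n).
  by rewrite (exprS _ n); field; rewrite ?expf_neq0 ?pnatr_eq0.
move: (_ / 2 ^+ n) => w; lra.
Qed.

(** The lower law of cosines for [t], and the one for [- t] at [T t y], give equality because
    [T (- t)] undoes [T t]. The sign of [f] changes because [T t] lowers it. *)
Lemma affine_line_split Y (f : X -> R) :
  proper_hadamard X -> mid_closed Y -> mid_affine Y f -> lip1 Y f ->
  (forall t x, Y x -> exists y, [/\ Y y, d x y <= `|t| & f y = f x - t]) ->
  exists T, line_split Y (fun x => - f x) T.
Proof.
move=> HX mY af lf ex.
have /choice[T TP] : forall t, exists S : X -> X, forall x, Y x ->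
    [/\ Y (S x), d x (S x) <= `|t| & f (S x) = f x - t].
  move=> t; have /choice[S SP] : forall x, exists y, Y x ->
      [/\ Y y, d x y <= `|t| & f y = f x - t].
    move=> x; have [Yx|nYx] := pselect (Y x); last by exists x.
    by have [y yP] := ex t x Yx; exists y.
  by exists S.
have low t x y : Y x -> Y y ->
    d x y ^+ 2 + t ^+ 2 - 2 * t * (f x - f y) <= d y (T t x) ^+ 2.
  move=> Yx Yy; have [Yt dt ft] := TP t x Yx.
  have [t0|t0] := lerP 0 t; first by apply: (affine_ray_cos HX mY af lf) => //; rewrite ger0_norm in dt.
  have := @affine_ray_cos Y (fun x => - f x) (- t) x (T t x) y HX mY.
  rewrite -(ltr0_norm t0) ltr0_norm// ft => H.
  have : d x y ^+ 2 + (- t) ^+ 2 - 2 * - t * (- f x - - f y) <= d y (T t x) ^+ 2.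
    apply: H => //.
    - by move=> u v Yu Yv; rewrite af//; lra.
    - by move=> u v Yu Yv; rewrite opprK addrC distrC; exact: lf.
    - by rewrite -(ltr0_norm t0).
    - lra.
  lra.
have inv t x : Y x -> T (- t) (T t x) = x.
  move=> Yx; have [Yt dt ft] := TP t x Yx; have [Yt' dt' ft'] := TP (- t) _ Yt.
  apply: dist_eq0; apply: ler_of_sqr => //.
  have := low t x (T (- t) (T t x)) Yx Yt'; rewrite (distC _ (T t x)) ft' ft.
  have : d (T t x) (T (- t) (T t x)) ^+ 2 <= t ^+ 2.
    by rewrite -[leRHS]real_normK ?num_real// -normrN ler_sqr ?nnegrE ?dist_ge0.
  by rewrite (distC x); rlra.
exists T; split.
- by move=> t y Yy; have [] := TP t y Yy.
- by move=> t y Yy; have [_ _ ->] := TP t y Yy; lra.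
- move=> t x y Yx Yy; have [Yt _ ft] := TP t y Yy.
  have h1 := low t y x Yy Yx; have := low (- t) _ x Yt Yx.
  rewrite inv// ft (distC (T t y)) (distC x y) in h1 * => h2.
  by apply/le_anti/andP; split; lra.
Qed.

End LineSplittings.

Section SystemPseudometric.
Variables (R : realType) (X : metricType R).
Local Notation d := (@mdist R X).
Hypothesis HX : proper_hadamard X.
Variables (Y : set X) (k : nat) (b : nat -> X -> R) (T : nat -> R -> X -> X).
Hypothesis sys : split_sys Y k b T.
Implicit Types (x y z q : X).

(* [level n q z] is [z] translated to the values of [b 0 .. b n.-1] at [q]. *)
Fixpoint level n q z :=
  if n is n'.+1 then T n' (b n' q - b n' z) (level n' q z) else z.

Definition trans2 x y := d x y ^+ 2 - \sum_(i < k) (b i x - b i y) ^+ 2.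

(* The distance in the quotient of [Y] by the translations. *)
Definition trans x y := Num.sqrt (trans2 x y).

Let level_spec n q z : (n <= k)%N -> Y z ->
  [/\ Y (level n q z), (forall i, (i < n)%N -> b i (level n q z) = b i q),
      (forall i, (n <= i < k)%N -> b i (level n q z) = b i z) &
      forall y, Y y -> d y (level n q z) ^+ 2 = d y z ^+ 2 + \sum_(i < n)
        ((b i q - b i z) ^+ 2 - 2 * (b i q - b i z) * (b i y - b i z))].
Proof.
case: sys => lT oT nk Yz; elim: n nk => [|n IH] nk.
  by split=> // y Yy; rewrite big_ord0 addr0.
have [Yl l1 l2 l3] := IH (ltnW nk); have lTn := lT n nk.
split => /=.
- exact: (split_in lTn).
- move=> i; rewrite ltnS leq_eqVlt => /orP[/eqP ->|lt_in].
    by rewrite (split_coord lTn)// l2 ?leqnn//; ring.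
  by rewrite oT ?l1 ?(ltn_eqF lt_in) ?(ltn_trans lt_in nk).
- move=> i /andP[ni ik]; rewrite oT// ?gtn_eqF// l2// ik andbT; exact: ltnW.
- by move=> y Yy; rewrite (split_cos lTn)// l3// l2 ?leqnn// big_ord_recr /=; ring.
Qed.

Lemma level_in q z : Y z -> Y (level k q z).
Proof. by move=> Yz; have [] := level_spec q (leqnn k) Yz. Qed.

Lemma level_coord q z i : Y z -> (i < k)%N -> b i (level k q z) = b i q.
Proof. by move=> Yz; have [_ + _ _] := level_spec q (leqnn k) Yz; exact. Qed.

Lemma level_dist q x y : Y x -> Y y ->
  d (level k q x) (level k q y) ^+ 2 = trans2 x y.
Proof.
move=> Yx Yy; have [Yl l1 _ _] := level_spec q (leqnn k) Yx.
have [_ _ _ ->//] := level_spec q (leqnn k) Yy.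
rewrite distC; have [_ _ _ ->//] := level_spec q (leqnn k) Yx.
rewrite -addrA -big_split /trans2 -sumrN (distC y x); congr (_ + _).
by apply: eq_bigr => i _; rewrite /= l1//; ring.
Qed.

Lemma trans_level q x y : Y x -> Y y ->
  trans x y = d (level k q x) (level k q y).
Proof.
by move=> Yx Yy; rewrite /trans -(level_dist q Yx Yy) sqrtr_sqr ger0_norm// dist_ge0.
Qed.

Lemma trans_ge0 x y : 0 <= trans x y. Proof. exact: sqrtr_ge0. Qed.

Lemma trans2_sym x y : trans2 x y = trans2 y x.
Proof.
rewrite /trans2 distC; congr (_ - _); apply: eq_bigr => i _.
by rewrite -sqrrN opprB.
Qed.

Lemma trans_sym x y : trans x y = trans y x.
Proof. by rewrite /trans trans2_sym. Qed.

Lemma sqr_trans x y : Y x -> Y y -> trans x y ^+ 2 = trans2 x y.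
Proof. by move=> Yx Yy; rewrite (trans_level x)// level_dist. Qed.

Lemma trans_tri y x z : Y x -> Y y -> Y z -> trans x z <= trans x y + trans y z.
Proof. by move=> Yx Yy Yz; rewrite !(trans_level x)//; exact: dist_tri. Qed.

Lemma trans_le_dist x y : Y x -> Y y -> trans x y <= d x y.
Proof.
move=> Yx Yy; apply: ler_of_sqr; first exact: dist_ge0.
rewrite sqr_trans// /trans2 gerBl; apply: sumr_ge0 => i _; exact: sqr_ge0.
Qed.

Lemma transxx x : Y x -> trans x x = 0.
Proof. by move=> Yx; rewrite (trans_level x)// distxx. Qed.

Lemma trans_same x y : (forall i, (i < k)%N -> b i x = b i y) -> trans x y = d x y.
Proof.
move=> xy; rewrite /trans /trans2 big1 ?subr0 ?sqrtr_sqr ?ger0_norm ?dist_ge0// => i _.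
by rewrite xy// subrr expr0n.
Qed.

Lemma dist_level x y : Y x -> Y y -> d x (level k x y) = trans x y.
Proof.
move=> Yx Yy; rewrite -(trans_same (x := x)); last by move=> i ik; rewrite level_coord.
rewrite (trans_level x)//; last exact: level_in.
rewrite (trans_level x Yx Yy); congr d; apply: dist_eq0; apply: ler_of_sqr => //.
rewrite level_dist//; last exact: level_in.
have [_ l1 _ l3] := level_spec x (leqnn k) Yy.
rewrite trans2_sym /trans2 l3// distxx expr0n add0r -sumrB big1// => i _.
by rewrite l1//; ring.
Qed.

Lemma trans_level0 q x : Y x -> trans x (level k q x) = 0.
Proof.
move=> Yx; have [Yl l1 _ l3] := level_spec q (leqnn k) Yx.
apply/eqP; rewrite -sqrf_eq0 sqr_trans// /trans2 l3// distxx expr0n.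
rewrite add0r -sumrB big1// => i _; rewrite l1//; ring.
Qed.

(** The coordinates are affine, so their squared differences satisfy (CN) with equality and can be
    subtracted. *)
Lemma trans_CN p x y : mid_closed Y -> Y p -> Y x -> Y y ->
  trans p (mid x y) ^+ 2 <= (trans p x ^+ 2 + trans p y ^+ 2) / 2 - trans x y ^+ 2 / 4.
Proof.
move=> mY Yp Yx Yy; rewrite !sqr_trans//; last exact: mY.
have := CN HX p x y; rewrite /trans2.
have -> : \sum_(i < k) (b i p - b i (mid x y)) ^+ 2 =
   (\sum_(i < k) (b i p - b i x) ^+ 2 + \sum_(i < k) (b i p - b i y) ^+ 2) / 2
   - (\sum_(i < k) (b i x - b i y) ^+ 2) / 4.
  rewrite -big_split /= !mulr_suml -sumrB; apply: eq_bigr => i _.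
  by case: sys => lT _; rewrite (split_affine (lT i (ltn_ord i)))//; field.
rlra.
Qed.

End SystemPseudometric.

(** * Limits of convex sets and of their splittings *)

Section SplittingLimits.
Variables (R : realType) (X : metricType R).
Local Notation d := (@mdist R X).
Hypothesis HX : proper_hadamard X.
Variables (I : Type) (U : set_system I).
Hypothesis UU : UltraFilter U.
Variable Ys : I -> set X.

Definition limit_set := [set y | exists2 u : I -> X, forall i, Ys i (u i) &
  d (u i) y @[i --> U] --> (0 : R)].

Variables (p : I -> X) (o : X) (M : R).
Hypotheses (Yp : forall i, Ys i (p i)) (pM : U [set i | d o (p i) <= M]).

(** Subtracting the value at [p i] keeps the net bounded, and the Lipschitz bound makes the limit
    independent of the net chosen for [y]. *)
Lemma lip_limit (f : I -> X -> R) : (forall i, lip1 (Ys i) (f i)) ->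
  exists2 g, lip1 limit_set g & forall u y, (forall i, Ys i (u i)) ->
    d (u i) y @[i --> U] --> (0 : R) -> f i (u i) - f i (p i) @[i --> U] --> g y.
Proof.
move=> lf.
have /choice[g gP] : forall y, exists l : R, forall u, (forall i, Ys i (u i)) ->
    d (u i) y @[i --> U] --> (0 : R) -> f i (u i) - f i (p i) @[i --> U] --> l.
  move=> y; have [[u0 Yu0 u0y]|no] := pselect (limit_set y); last first.
    by exists 0 => u Yu uy; case: no; exists u.
  have [|l lP] := @bounded_cvg R I U UU (fun i => f i (u0 i) - f i (p i)) (1 + d y o + M).
    have h1 := (net_cvgP UU _ _).1 u0y _ ltr01.
    apply: filterS (filterI h1 pM) => i [/= h2 h3].
    apply: (le_trans (lf i _ _ (Yu0 i) (Yp i))).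
    by have := dist_tri y (u0 i) (p i); have := dist_tri o y (p i); rlra.
  exists l => u Yu uy.
  have -> : (fun i => f i (u i) - f i (p i)) =
      (fun i => (f i (u i) - f i (u0 i)) + (f i (u0 i) - f i (p i))).
    by apply/funext => i; rewrite addrA subrK.
  rewrite -[l]add0r; apply: cvgD => //.
  apply/(real_cvgP UU) => e e0.
  have /(real_cvgP UU)/(_ e e0) := dist_cvg UU uy u0y.
  apply: filterS => i /=; rewrite distxx !subr0; apply: le_lt_trans.
  by rewrite [leRHS]ger0_norm ?dist_ge0//; exact: lf.
exists g; last by move=> u y; exact: gP.
move=> x y [u Yu ux] [v Yv vy].
apply: (lim_le UU (cvg_norm (cvgB (gP x u Yu ux) (gP y v Yv vy))) (dist_cvg UU ux vy)).
apply: filterS filterT => i _; move: (lf i _ _ (Yu i) (Yv i)).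
by congr (is_true (`|_| <= _)); rewrite /= ?fctE; ring.
Qed.

(** Translations are isometries with displacement independent of [i], so their images of nets
    converge, and the law of cosines is a closed condition. *)
Lemma line_limit (b : I -> X -> R) (T : I -> R -> X -> X) :
  (forall i, line_split (Ys i) (b i) (T i)) ->
  exists b' T', line_split limit_set b' T' /\
   forall u y, (forall i, Ys i (u i)) -> d (u i) y @[i --> U] --> (0 : R) ->
     (b i (u i) - b i (p i) @[i --> U] --> b' y) /\
     forall t, d (T i t (u i)) (T' t y) @[i --> U] --> (0 : R).
Proof.
move=> bT.
have [b' _ b'P] := lip_limit (fun i => split_lip1 (bT i)).
have /choice[T' T'P] : forall t, exists T' : X -> X, forall y u, (forall i, Ys i (u i)) ->
    d (u i) y @[i --> U] --> (0 : R) -> d (T i t (u i)) (T' y) @[i --> U] --> (0 : R).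
  move=> t; suff /choice[T' T'P] : forall y, exists z, forall u, (forall i, Ys i (u i)) ->
      d (u i) y @[i --> U] --> (0 : R) -> d (T i t (u i)) z @[i --> U] --> (0 : R).
    by exists T'.
  move=> y; have [[u0 Yu0 u0y]|no] := pselect (limit_set y); last first.
    by exists y => u Yu uy; case: no; exists u.
  have [|z zP] := hadamard_net HX UU (o := y) (u := fun i => T i t (u0 i)) (M := 1 + `|t|).
    apply: filterS ((net_cvgP UU _ _).1 u0y _ ltr01) => i /= h.
    have := dist_tri (u0 i) y (T i t (u0 i)); rewrite (split_disp (bT i))// (distC y (u0 i)); rlra.
  exists z => u Yu uy; apply: (net_near UU zP).
  under eq_fun do rewrite (split_iso (bT _)) ?Yu ?Yu0//.
  have -> : (0 : R) = d y y by rewrite distxx.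
  exact: (dist_cvg UU u0y uy).
exists b', T'; split; last by move=> u y Yu uy; split; [exact: b'P|move=> t; exact: T'P].
split.
- move=> t y [u Yu uy]; exists (fun i => T i t (u i)); last exact: T'P.
  by move=> i; exact: (split_in (bT i)).
- move=> t y [u Yu uy].
  have Yu' i : Ys i (T i t (u i)) by exact: (split_in (bT i)).
  apply: (real_cvg_unique UU (b'P _ _ Yu' (T'P t _ _ Yu uy))).
  under eq_fun do rewrite (split_coord (bT _))// addrAC.
  by apply: cvgD; [exact: b'P|exact: cvg_cst].
- move=> t x y [u Yu ux] [v Yv vy].
  have c1 := dist_cvg UU ux (T'P t _ _ Yv vy).
  have c2 := dist_cvg UU ux vy.
  have {}c1 : d (u i) (T i t (v i)) ^+ 2 @[i --> U] --> d x (T' t y) ^+ 2.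
    by rewrite expr2; under eq_fun do rewrite expr2; exact: cvgM.
  apply: (real_cvg_unique UU c1).
  under eq_fun do rewrite (split_cos (bT _))//.
  apply: cvgB; first apply: cvgD; last 1 first.
  - apply: cvgMr.
    have -> : (fun i => b i (u i) - b i (v i)) =
      (fun i => (b i (u i) - b i (p i)) - (b i (v i) - b i (p i))).
      by apply/funext => i; ring.
    by apply: cvgB; exact: b'P.
  - by rewrite expr2; under eq_fun do rewrite expr2; exact: cvgM.
  - exact: cvg_cst.
Qed.

Lemma sys_limit k (b : I -> nat -> X -> R) (T : I -> nat -> R -> X -> X) :
  (forall i, split_sys (Ys i) k (b i) (T i)) ->
  exists b' T', split_sys limit_set k b' T' /\
   forall u y, (forall i, Ys i (u i)) -> d (u i) y @[i --> U] --> (0 : R) ->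
     forall j, (j < k)%N -> (b i j (u i) - b i j (p i) @[i --> U] --> b' j y) /\
     forall t, d (T i j t (u i)) (T' j t y) @[i --> U] --> (0 : R).
Proof.
move=> sys.
have /choice[bT' bTP] : forall j, exists bT' : (X -> R) * (R -> X -> X), (j < k)%N ->
   line_split limit_set bT'.1 bT'.2 /\
   forall u y, (forall i, Ys i (u i)) -> d (u i) y @[i --> U] --> (0 : R) ->
     (b i j (u i) - b i j (p i) @[i --> U] --> bT'.1 y) /\
     forall t, d (T i j t (u i)) (bT'.2 t y) @[i --> U] --> (0 : R).
  move=> j; have [jk|jk] := ltnP j k; last by exists ((fun=> 0), (fun _ x => x)).
  have [b' [T' H]] := line_limit (fun i => (sys i).1 j jk).
  by exists (b', T').
exists (fun j => (bT' j).1), (fun j => (bT' j).2); split; last first.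
  by move=> u y Yu uy j jk; have [_] := bTP j jk; exact.
split; first by move=> j jk; have [] := bTP j jk.
move=> i j t y ik jk ij [u Yu uy].
have [_ /(_ _ _ Yu uy)[_ Tj]] := bTP j jk; have [_ si] := bTP i ik.
have [c1 _] := si _ _ Yu uy.
have [|c2 _] := si _ _ _ (Tj t).
  by move=> n; exact: (split_in ((sys n).1 j jk)).
apply: (real_cvg_unique UU c2); apply: lim_eq c1 => //.
by apply: filterS filterT => n _ /=; rewrite (sys n).2.
Qed.

End SplittingLimits.

(** * Means *)

Section Subgroups.
Variables (G : groupType) (H : set G).
Hypothesis sH : subgroup H.

Lemma subgroup1 : H 1%g.
Proof. by case: sH => + _; rewrite unfold_in /= => /set_mem. Qed.

Lemma subgroup_div x y : H x -> H y -> H (x / y)%g.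
Proof.
by case: sH => _ dH Hx Hy; apply/set_mem/dH; rewrite unfold_in /=; exact/mem_set.
Qed.

Lemma subgroupV x : H x -> H x^-1%g.
Proof. by move=> Hx; rewrite -[x^-1%g]mul1g; exact: subgroup_div subgroup1 Hx. Qed.

Lemma subgroupM x y : H x -> H y -> H (x * y)%g.
Proof. by move=> Hx /subgroupV Hy; rewrite -[y]invgK; exact: subgroup_div. Qed.

End Subgroups.

Section Mean.
Variables (R : realType) (G : groupType) (H : set G).
Implicit Types (f g phi : G -> R).

Definition bdd_on f := exists M : R, forall h, H h -> `|f h| <= M.

Record is_mean (I : (G -> R) -> R) : Prop := IsMean {
  mean_add : forall f g, bdd_on f -> bdd_on g -> I (fun h => f h + g h) = I f + I g;
  mean_le : forall f g, bdd_on f -> bdd_on g -> (forall h, H h -> f h <= g h) -> I f <= I g;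
  mean_cst : forall c, I (fun=> c) = c;
  mean_inv : forall f k, bdd_on f -> H k -> I (fun h => f (k * h)%g) = I f }.

Lemma bdd_add f g : bdd_on f -> bdd_on g -> bdd_on (fun h => f h + g h).
Proof.
move=> [M fM] [N gN]; exists (M + N) => h Hh; apply: (le_trans (ler_normD _ _)).
by apply: lerD; [exact: fM|exact: gN].
Qed.

Lemma bdd_cst c : bdd_on (fun=> c).
Proof. by exists `|c|. Qed.

Section Construction.
Variable m : set G -> R.
Hypothesis sH : subgroup H.
Hypotheses (m_ge0 : forall A, A `<=` H -> 0 <= m A) (mH : m H = 1)
  (mU : forall A B, A `<=` H -> B `<=` H -> A `&` B = set0 ->
     m (A `|` B) = m A + m B)
  (m_inv : forall h A, H h -> A `<=` H -> m (ltranslate h A) = m A).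

(** The measure [m] is only specified on subsets of [H]. *)
Let mu A := m (A `&` H).

Let mu_ge0 A : 0 <= mu A. Proof. by apply: m_ge0 => x []. Qed.

Let mu0 : mu set0 = 0.
Proof.
have := mU (@sub0set _ H) (@sub0set _ H) (setI0 _).
by rewrite setU0 /mu set0I; lra.
Qed.

Let mu_partition (J : finType) (q : G -> J) A :
  \sum_j mu (A `&` [set h | q h = j]) = mu A.
Proof.
suff H1 (s : seq J) : uniq s ->
    \sum_(j <- s) mu (A `&` [set h | q h = j]) = mu (A `&` [set h | q h \in s]).
  rewrite -[LHS](big_enum _ _ predT) H1 ?enum_uniq//; congr mu.
  by apply/seteqP; split => [x []//|x Ax]; split => //=; rewrite mem_enum.
elim: s => [_|j s IH /= /andP[js us]].
  by rewrite big_nil (_ : _ `&` _ = set0) ?mu0//; apply/seteqP; split => x [].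
rewrite big_cons IH// /mu -mU.
- congr m; apply/seteqP; split => [x [[[Ax /= qx] Hx]|[[Ax /= qx] Hx]]|x [[Ax /=]]].
  + by split=> //; split => //=; rewrite qx mem_head.
  + by split=> //; split => //=; rewrite in_cons qx orbT.
  + by rewrite in_cons => /orP[/eqP|] qx Hx; [left|right].
- by move=> x [].
- by move=> x [].
- by apply/seteqP; split => // x [[[_ /= qj] _] [[_ /=]]]; rewrite qj (negPf js).
Qed.

(** The integral of the step function [c \o q]. A finite labelling encodes the partition, so that
    common refinements are labellings by pairs. *)
Let simple (J : finType) (q : G -> J) (c : J -> R) := \sum_j c j * mu [set h | q h = j].

Let simple_le (J J' : finType) (q : G -> J) (q' : G -> J') c c' :
  (forall h, H h -> c (q h) <= c' (q' h)) -> simple q c <= simple q' c'.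
Proof.
move=> cc'; rewrite /simple.
(* Both sums are refined over pairs of labels; a pair matters only if its cell meets [H], where
   [cc'] applies. *)
under eq_bigr => j _ do rewrite -(mu_partition q') mulr_sumr.
under [leRHS]eq_bigr => j _ do rewrite -(mu_partition q) mulr_sumr.
rewrite exchange_big /=; apply: ler_sum => j' _; apply: ler_sum => j _.
rewrite setIC; have [[h [[/= h1 h2] Hh]]|no] := pselect
   (([set h | q' h = j'] `&` [set h | q h = j]) `&` H !=set0).
  by apply: ler_wpM2r => //; rewrite -h1 -h2; exact: cc'.
rewrite (_ : mu _ = 0) ?mulr0// /mu -[RHS]mu0 /mu set0I; congr m.
by apply/seteqP; split => // x Hx; apply: no; exists x.
Qed.

Let simple_cst (J : finType) (q : G -> J) a : simple q (fun=> a) = a.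
Proof.
rewrite /simple -mulr_sumr (_ : \sum_j _ = 1) ?mulr1// -mH.
have := mu_partition q setT; under eq_bigr do rewrite setTI.
by rewrite /mu setTI.
Qed.

Let simple_add (J : finType) (q : G -> J) c c' :
  simple q (fun j => c j + c' j) = simple q c + simple q c'.
Proof. by rewrite /simple -big_split; apply: eq_bigr => j _; rewrite mulrDl. Qed.

Let simples f := [set s | exists (J : finType) (q : G -> J) (c : J -> R),
  (forall h, H h -> c (q h) <= f h) /\ s = simple q c].

Let mean f := sup (simples f).

Let has_sup_simples f : bdd_on f -> has_sup (simples f).
Proof.
move=> [M fM]; split.
  exists (simple (fun=> tt) (fun=> - M)); exists unit, (fun=> tt), (fun=> - M).
  by split => // h /fM; rewrite ler_norml => /andP[].
exists M => _ [J [q [c [cf ->]]]]; rewrite -(simple_cst (fun=> tt) M).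
by apply: simple_le => h Hh; apply: (le_trans (cf h Hh)); exact: (le_trans (ler_norm _) (fM h Hh)).
Qed.

Let mean_ge f (J : finType) (q : G -> J) c : bdd_on f ->
  (forall h, H h -> c (q h) <= f h) -> simple q c <= mean f.
Proof.
move=> bf cf; have [_ ub] := has_sup_simples bf.
by apply: ub_le_sup => //; exists J, q, c.
Qed.

Let mean_le_simple f (J : finType) (q : G -> J) c : bdd_on f ->
  (forall h, H h -> f h <= c (q h)) -> mean f <= simple q c.
Proof.
move=> bf cf; have [ne _] := has_sup_simples bf.
apply: ge_sup => // _ [J' [q' [c' [cf' ->]]]].
by apply: simple_le => h Hh; apply: le_trans (cf h Hh); exact: cf'.
Qed.

Let approx f e : bdd_on f -> 0 < e -> exists (J : finType) (q : G -> J) (c : J -> R),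
  forall h, H h -> c (q h) <= f h <= c (q h) + e.
Proof.
move=> [M fM] e0.
pose N := Num.truncn (2 * M / e).
(* The labels number intervals of length [e] starting at [- M]; [f h + M] is between [0] and
   [2 * M]. *)
exists 'I_N.+1, (fun h => inord (Num.truncn ((f h + M) / e))), (fun j : 'I_N.+1 => (j : nat)%:R * e - M).
move=> h /fM; rewrite ler_norml => /andP[h1 h2].
have t0 : 0 <= (f h + M) / e by apply: divr_ge0; lra.
have le : (f h + M) / e <= 2 * M / e by rewrite ler_pM2r ?invr_gt0//; lra.
rewrite inordK; last by rewrite ltnS; exact: le_truncn.
have /andP[k1 k2] := truncn_itv t0.
rewrite -(ler_pM2r e0) divfK ?gt_eqF// in k1.
rewrite -(ltr_pM2r e0) divfK ?gt_eqF// in k2.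
by rewrite -natr1 mulrDl in k2; apply/andP; split; lra.
Qed.

Let mean_approx f e : bdd_on f -> 0 < e -> exists (J : finType) (q : G -> J) (c : J -> R),
  [/\ forall h, H h -> c (q h) <= f h, forall h, H h -> f h <= c (q h) + e &
    simple q c <= mean f <= simple q c + e].
Proof.
move=> bf e0; have [J [q [c cP]]] := approx bf e0; exists J, q, c.
have c1 h : H h -> c (q h) <= f h by move=> /cP/andP[].
have c2 h : H h -> f h <= c (q h) + e by move=> /cP/andP[].
split=> //; rewrite mean_ge//=.
have := @mean_le_simple f J q (fun j => c j + e) bf c2.
by rewrite simple_add simple_cst.
Qed.

Let meanD f g : bdd_on f -> bdd_on g -> mean (fun h => f h + g h) = mean f + mean g.
Proof.
move=> bf bg.
have key e : 0 < e -> `|mean (fun h => f h + g h) - (mean f + mean g)| <= 2 * e.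
  move=> e0; have [J [q [c [c1 c2 /andP[c3 c4]]]]] := mean_approx bf e0.
  have [J' [q' [c' [c1' c2' /andP[c3' c4']]]]] := mean_approx bg e0.
  pose qq h := (q h, q' h).
  have e1 : simple qq (fun j => c j.1) = simple q c.
    by apply/le_anti/andP; split; apply: simple_le.
  have e2 : simple qq (fun j => c' j.2) = simple q' c'.
    by apply/le_anti/andP; split; apply: simple_le.
  have H1 h : H h -> c (qq h).1 + c' (qq h).2 <= f h + g h.
    by move=> Hh; apply: lerD; [exact: c1|exact: c1'].
  have H2 h : H h -> f h + g h <= c (qq h).1 + c' (qq h).2 + (e + e).
    by move=> Hh; have := c2 h Hh; have := c2' h Hh; rewrite /=; rlra.
  have := @mean_ge _ _ qq (fun j => c j.1 + c' j.2) (bdd_add bf bg) H1.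
  have := @mean_le_simple _ _ qq (fun j => c j.1 + c' j.2 + (e + e)) (bdd_add bf bg) H2.
  rewrite !simple_add simple_cst e1 e2 => H3 H4.
  by rewrite ler_norml; apply/andP; split; lra.
apply/eqP; rewrite -subr_eq0 -normr_le0; exact: (@le0_of_eps R 2).
Qed.

Lemma mean_exists_of_measure : exists I, is_mean I.
Proof.
exists mean; split.
- exact: meanD.
- move=> f g bf bg fg; have [ne _] := has_sup_simples bf.
  apply: ge_sup => // _ [J [q [c [cf ->]]]]; apply: mean_ge => // h Hh.
  by apply: (le_trans (cf h Hh)); exact: fg.
- move=> c; have := @mean_ge _ _ (fun=> tt) (fun=> c) (bdd_cst c) (fun h _ => lexx c).
  have := @mean_le_simple _ _ (fun=> tt) (fun=> c) (bdd_cst c) (fun h _ => lexx c).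
  by rewrite !simple_cst => h1 h2; apply/le_anti; rewrite h1 h2.
- move=> f k bf Hk.
  have bf' : bdd_on (fun h => f (k * h)%g).
    by have [M fM] := bf; exists M => h Hh; apply: fM; exact: subgroupM.
  have key e : 0 < e -> `|mean (fun h => f (k * h)%g) - mean f| <= 1 * e.
    move=> e0; have [J [q [c [c1 c2 /andP[c3 c4]]]]] := mean_approx bf e0.
    (* Translation by [k] carries the cells of the shifted labelling to those of [q]. *)
    have E : simple (fun h => q (k * h)%g) c = simple q c.
      apply: eq_bigr => j _; congr (_ * _); rewrite /mu -(m_inv Hk); last by move=> x [].
      congr m; apply/seteqP; split=> [_ [x [/= qx Hx] <-]|x [/= qx Hx]].
        by split=> //; exact: subgroupM.
      exists (k^-1 * x)%g; last by rewrite mulVKg.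
      split; first by rewrite /= mulVKg.
      by apply: subgroupM => //; exact: subgroupV.
    have := @mean_ge _ _ (fun h => q (k * h)%g) c bf' (fun h Hh => c1 _ (subgroupM sH Hk Hh)).
    have := @mean_le_simple _ _ (fun h => q (k * h)%g) (fun j => c j + e) bf'
      (fun h Hh => c2 _ (subgroupM sH Hk Hh)).
    by rewrite simple_add simple_cst E => h1 h2; rewrite ler_norml; apply/andP; split; lra.
  by apply/eqP; rewrite -subr_eq0 -normr_le0; exact: (@le0_of_eps R 1).
Qed.

End Construction.

Lemma amenable_mean : subgroup H -> amenable R H -> exists I, is_mean I.
Proof. by move=> sH [m [? ? ? ?]]; exact: (@mean_exists_of_measure m). Qed.

(** A finite sum of such functions still has mean at most 0, so no positive constant bounds it below
    on [H]: the sets where these functions are small generate a proper filter. One ultrafilter thus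
    serves all of them. *)
Lemma mean_ultra (I : (G -> R) -> R) : is_mean I ->
  exists2 U : set_system G, UltraFilter U & U H /\ forall phi, bdd_on phi ->
    (forall h, H h -> 0 <= phi h) -> I phi <= 0 -> phi h @[h --> U] --> (0 : R).
Proof.
move=> mI.
pose F : set_system G := [set A | exists phi e, [/\ bdd_on phi,
  forall h, H h -> 0 <= phi h, I phi <= 0, 0 < e & [set h | H h /\ phi h < e] `<=` A]].
have FF : ProperFilter F.
  split.
    move=> [phi [e [b p0 I0 e0 sub]]].
    have : e <= I phi.
      rewrite -(mean_cst mI e); apply: (mean_le mI) => // [|h Hh]; first exact: bdd_cst.
      by rewrite leNgt; apply/negP => lt; exact: (sub h).
    lra.
  split.
  - exists (fun=> 0), 1; split=> //; first exact: bdd_cst.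
    by rewrite (mean_cst mI).
  - move=> A B [phi [e [b p0 I0 e0 sub]]] [phi' [e' [b' p0' I0' e0' sub']]].
    exists (fun h => phi h + phi' h), (Num.min e e'); split.
    + exact: bdd_add.
    + by move=> h Hh; apply: addr_ge0; auto.
    + by rewrite (mean_add mI)//; lra.
    + by rewrite lt_min e0.
    + move=> h [Hh]; rewrite lt_min => /andP[h1 h2].
      have := p0 h Hh; have := p0' h Hh => k1 k2.
      by split; [apply: sub|apply: sub']; split=> //; lra.
  - by move=> A B AB [phi [e [b p0 I0 e0 sub]]]; exists phi, e; split=> //; exact: subset_trans AB.
have [U [UU FU]] := ultraFilterLemma FF.
have UH : U H.
  apply: FU; exists (fun=> 0), 1; split=> //; first exact: bdd_cst.
    by rewrite (mean_cst mI).
  by move=> h [].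
exists U; first exact: UU.
split; first exact: UH.
move=> phi b p0 I0; apply/(real_cvgP UU) => e e0.
have : U [set h | H h /\ phi h < e] by apply: FU; exists phi, e; split.
apply: filterS => h /= [Hh pe]; rewrite subr0 ger0_norm//; exact: p0.
Qed.

End Mean.

(** * Amenable groups without fixed points at infinity *)

Section SystemBounds.
Variables (R : realType) (X : metricType R).
Local Notation d := (@mdist R X).
Hypothesis HX : proper_hadamard X.

(** The unit translates of [y] along the [k] lines have pairwise distance at least 1, since a
    coordinate separates them. *)
Lemma sys_bound (o : X) (M : R) : exists N : nat, forall Y k b T y,
  @split_sys R X Y k b T -> Y y -> d o y <= M -> (k <= N)%N.
Proof.
have [N NP] := packing HX o (M + 1); exists N => Y k b T y [lT oT] Yy oy.
apply: (NP k (fun i => T i 1 y)).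
  move=> i ik; have := split_disp (lT i ik) 1 Yy; rewrite normr1.
  by have := dist_tri y o (T i 1 y); rlra.
move=> i j /andP[ij jk]; have ik := ltn_trans ij jk.
have Yi := split_in (lT i ik) 1 Yy; have Yj := split_in (lT j jk) 1 Yy.
apply: (le_trans _ (split_lip1 (lT i ik) Yi Yj)).
rewrite (split_coord (lT i ik))// oT//; last by rewrite ltn_eqF.
by rewrite addrAC subrr add0r normr1.
Qed.

Lemma sys_extend Y k b T b' T' : @split_sys R X Y k b T -> line_split Y b' T' ->
  (forall i t y, (i < k)%N -> Y y -> b' (T i t y) = b' y) ->
  split_sys Y k.+1 (fun i => if (i < k)%N then b i else b')
    (fun i => if (i < k)%N then T i else T').
Proof.
move=> [lT oT] lT' o'; split.
  by move=> i _; case: ltnP => // ik; exact: lT.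
move=> i j t x; rewrite !ltnS => ik jk ij Yx.
have [ik'|ki] := ltnP i k; have [jk'|kj] := ltnP j k.
- exact: oT.
- by apply: (split_orth lT' (lT i ik')) => // t' y Yy; exact: o'.
- exact: o'.
- have ei : i = k by apply/anti_leq; rewrite ik.
  have ej : j = k by apply/anti_leq; rewrite jk.
  by rewrite ei ej eqxx in ij.
Qed.

Lemma lim_sum (I : Type) (U : set_system I) (UU : UltraFilter U) k
  (f : I -> nat -> R) (l : nat -> R) :
  (forall j, (j < k)%N -> f i j @[i --> U] --> l j) ->
  \sum_(j < k) f i j @[i --> U] --> \sum_(j < k) l j.
Proof.
elim: k => [|k IH] fl.
  under eq_fun do rewrite big_ord0; rewrite big_ord0; exact: cvg_cst.
under eq_fun do rewrite big_ord_recr /=; rewrite big_ord_recr /=.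
apply: cvgD; last exact: fl.
by apply: IH => j jk; apply: fl; exact: ltnW.
Qed.

Lemma lim_sqr (I : Type) (U : set_system I) (UU : UltraFilter U) (f : I -> R) (l : R) :
  f i @[i --> U] --> l -> f i ^+ 2 @[i --> U] --> l ^+ 2.
Proof. by move=> fl; rewrite expr2; under eq_fun do rewrite expr2; exact: cvgM. Qed.

Lemma maximal_nat (P : nat -> Prop) N : P 0%N -> (forall k, P k -> (k <= N)%N) ->
  exists k, P k /\ ~ P k.+1.
Proof.
move=> P0 PN; apply: contrapT => /forallNP H.
have Pall k : P k.
  by elim: k => // k Pk; apply: contrapT => nP; apply: (H k).
by have := PN _ (Pall N.+1); rewrite ltnn.
Qed.

End SystemBounds.

Section IsometricActions.
Variables (R : realType) (X : metricType R) (G : groupType) (H : set G).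
Local Notation d := (@mdist R X).
Hypothesis HX : proper_hadamard X.
Hypothesis sH : subgroup H.

(** Relative to [H] and [Z], because the actions induced on transverse slices are defined neither on
    the whole group nor on the whole space. *)
Definition isom_on (Z : set X) (rho : G -> X -> X) :=
  [/\ forall h x, H h -> Z x -> Z (rho h x), forall x, Z x -> rho 1%g x = x,
      forall g h x, H g -> H h -> Z x -> rho (g * h)%g x = rho g (rho h x) &
      forall h x y, H h -> Z x -> Z y -> d (rho h x) (rho h y) = d x y].

Lemma isom_on_sub Y Z rho : isom_on Z rho -> Y `<=` Z ->
  (forall h x, H h -> Y x -> Y (rho h x)) -> isom_on Y rho.
Proof.
by case=> r1 r2 r3 r4 sub rY; split=> //; auto.
Qed.

Section Action.
Variables (Z : set X) (rho : G -> X -> X).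
Hypothesis rhoP : isom_on Z rho.

Lemma rho_in h x : H h -> Z x -> Z (rho h x).
Proof. by case: rhoP => + _ _ _; exact. Qed.

Lemma rho_iso h x y : H h -> Z x -> Z y -> d (rho h x) (rho h y) = d x y.
Proof. by case: rhoP => _ _ _; exact. Qed.

Lemma rhoM g h x : H g -> H h -> Z x -> rho (g * h)%g x = rho g (rho h x).
Proof. by case: rhoP => _ _ + _; exact. Qed.

Lemma rhoK h x : H h -> Z x -> rho h^-1%g (rho h x) = x.
Proof.
case: rhoP => _ r1 rM _ Hh Zx; rewrite -rM ?mulVg ?r1//; exact: subgroupV.
Qed.

Lemma rhoVK h x : H h -> Z x -> rho h (rho h^-1%g x) = x.
Proof.
case: rhoP => _ r1 rM _ Hh Zx; rewrite -rM ?mulgV ?r1//; exact: subgroupV.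
Qed.

Lemma rho_mid h x y : mid_closed Z -> H h -> Z x -> Z y ->
  rho h (mid x y) = mid (rho h x) (rho h y).
Proof.
move=> mZ Hh Zx Zy; apply: mid_uniq => //; have Zm := mZ _ _ Zx Zy.
by have [m1 m2] := midP HX x y; split; rewrite !rho_iso.
Qed.

(* [H] has no fixed point at infinity, in a quantitative form. *)
Definition no_escape (o : X) := forall M : G -> R, exists B : R, forall x, Z x ->
  (forall h, H h -> d x (rho h x) <= M h) -> d o x <= B.

Definition inv_convex (Y : set X) := [/\ Y `<=` Z, Y !=set0, cconvex Y &
  forall h x, H h -> Y x -> Y (rho h x)].

Variable o : X.
Hypotheses (Zo : Z o) (cZ : cconvex Z) (NE : no_escape o).

Lemma proj_rho Y h x : inv_convex Y -> H h -> Z x -> proj Y (rho h x) = rho h (proj Y x).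
Proof.
move=> [YZ Yne cY Yinv] Hh Zx; apply: (proj_equiv HX Yne cY (f' := rho h^-1%g)).
- by move=> y; exact: Yinv.
- move=> y Yy; split; first by apply: Yinv => //; exact: subgroupV.
  by apply: rhoVK => //; exact: YZ.
- by move=> y /YZ Zy; exact: rho_iso.
Qed.

(** Zorn's lemma. The projection of [o] to an invariant convex set is moved by [h] no more than [o]
    is, so [NE] bounds these projections, and a limit of them lies in every member of a chain. *)
Lemma minimal_inv_convex : exists Y, inv_convex Y /\
  forall Y', inv_convex Y' -> Y' `<=` Y -> Y `<=` Y'.
Proof.
pose S := {Y : set X | inv_convex Y}.
have ZS : inv_convex Z.
  by split=> //; [exists o|move=> h x; exact: rho_in].
have [B BP] := NE (fun h => d o (rho h o)).
pose le (a b : S) := `[< proj1_sig b `<=` proj1_sig a >].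
have [||A tA|[Y IY] Ymin] := @ZL_preorder S (exist _ Z ZS) le.
- by move=> a; apply/asboolP.
- by move=> a1 a2 a3 /asboolP h1 /asboolP h2; apply/asboolP; exact: subset_trans h1.
- have [[a0 Aa0]|noA] := pselect (A !=set0); last first.
    by exists (exist _ Z ZS) => s As; exfalso; apply: noA; exists s.
  pose F : set_system S := [set D | exists2 a, A a & [set b | A b /\ le a b] `<=` D].
  have lexx a : le a a by apply/asboolP.
  have FF : ProperFilter F.
    split; first by move=> [a Aa sub]; apply: (sub a); split.
    split; first by exists a0.
    + move=> D E [a Aa aD] [b Ab bE].
      have le_trans a1 a2 a3 : le a1 a2 -> le a2 a3 -> le a1 a3.
        by move=> /asboolP h1 /asboolP h2; apply/asboolP; exact: subset_trans h1.
      have [ab|ba] := tA a b Aa Ab.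
        by exists b => // c [Ac bc]; split; [apply: aD; split=> //; exact: le_trans bc|exact: bE].
      by exists a => // c [Ac ac]; split; [exact: aD|apply: bE; split=> //; exact: le_trans ac].
    + by move=> D E DE [a Aa aD]; exists a => //; exact: subset_trans DE.
  have [U [UU FU]] := ultraFilterLemma FF.
  have Ua a : A a -> U [set b | A b /\ le a b] by move=> Aa; apply: FU; exists a.
  pose p (a : S) := proj (proj1_sig a) o.
  have pB a : d o (p a) <= B.
    case: a => Y IY; rewrite /p /=; have [YZ Yne cY Yinv] := IY.
    apply: BP; first by apply: YZ; exact: proj_in.
    by move=> h Hh; rewrite -proj_rho//; exact: proj_nonexp.
  have [|x xP] := hadamard_net HX UU (o := o) (u := p) (M := B).
    by apply: filterS filterT => a _; exact: pB.
  have xin a : A a -> proj1_sig a x.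
    move=> Aa; case: a Aa (Ua _ Aa) => Y IY Aa Uab /=; have [YZ Yne cY Yinv] := IY.
    apply: cY.2 => e e0.
    have [[Y' IY'] [/= [_ /asboolP/= sub] xe]] :=
      ultra_ex UU (filterI Uab ((net_cvgP UU _ _).1 xP _ e0)).
    exists (p (exist _ Y' IY')); last by rewrite distC.
    by apply: sub; have [_ ? ? _] := IY'; exact: proj_in.
  have IW : inv_convex [set y | forall a, A a -> proj1_sig a y].
    split.
    + by move=> y /(_ _ Aa0); have [sub _ _ _] := proj2_sig a0; exact: sub.
    + by exists x.
    + split.
        move=> y z Wy Wz a Aa; have [_ _ [ma _] _] := proj2_sig a.
        by apply: ma; [exact: Wy|exact: Wz].
      move=> y Wy a Aa; have [_ _ [_ ca] _] := proj2_sig a.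
      by apply: ca => e e0; have [z Wz yz] := Wy e e0; exists z => //; exact: Wz.
    + move=> h y Hh Wy a Aa; have [_ _ _ inva] := proj2_sig a.
      by apply: inva => //; exact: Wy.
  by exists (exist _ _ IW) => a Aa; apply/asboolP => y; exact.
exists Y; split=> // Y' IY' sub.
by have /asboolP := Ymin (exist _ Y' IY') (asboolT sub).
Qed.

Variables (Y : set X).
Hypotheses (IY : inv_convex Y).
Hypothesis Ymin : forall Y', inv_convex Y' -> Y' `<=` Y -> Y `<=` Y'.

(* The resolvents of [F] stay in a bounded set, hence [F] is bounded below,
   [c] vanishes and the sublevel sets of [F] are invariant. *)
Lemma quasi_invariant_cst (F : X -> R) (c : G -> R) : mid_convex Y F -> lip1 Y F ->
  (forall h x, H h -> Y x -> F (rho h x) = F x + c h) ->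
  forall x y, Y x -> Y y -> F x <= F y.
Proof.
have [YZ Yne cY Yinv] := IY; move=> cF lF qF x y Yx Yy.
have [B BP] := NE (fun h => d x (rho h x)).
have lowb z : Y z -> F x - (d x o + B) <= F z.
  (* [F q <= F z + k * d x z ^+ 2], where [q] stays near [o] uniformly in [k]; then [k] tends to
     0. *)
  move=> Yz; rewrite -subr_le0; apply: (@le0_of_eps R (d x z ^+ 2)); first exact: sqr_ge0.
  move=> k k0; pose q := resolvent Y F k x.
  have Yq : Y q by exact: (resolvent_in HX k0 Yne cY lF).
  have qB : d o q <= B.
    apply: BP; first exact: YZ.
    move=> h Hh.
    have <- : resolvent Y F k (rho h x) = rho h q.
      apply: (resolvent_equiv HX k0 Yne cY cF lF (f' := rho h^-1%g) (c := c h)).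
      - by move=> w; exact: Yinv.
      - move=> w Yw; split; first by apply: Yinv => //; exact: subgroupV.
        by apply: rhoVK => //; exact: YZ.
      - by move=> w /YZ Zw; apply: rho_iso => //; exact: YZ.
      - by move=> w; exact: qF.
    exact: (resolvent_nonexp HX k0 Yne cY cF lF).
  have := resolvent_min HX k0 Yne cY lF x Yz; rewrite -/q /moreau.
  have := lF _ _ Yx Yq; rewrite ler_norml => /andP[_ h1].
  have := dist_tri o x q; have := mulr_ge0 (ltW k0) (sqr_ge0 (d x q)).
  by rewrite (mulrC k (d x z ^+ 2)); rlra.
(* Iterating an [h] with [c h < 0] would make [F] unbounded below. *)
have c_ge0 h : H h -> 0 <= c h.
  move=> Hh; have it n : Y (iter n (rho h) x) /\ F (iter n (rho h) x) = F x + n%:R * c h.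
    elim: n => [|n [IH1 IH2]]; first by rewrite mul0r addr0.
    by rewrite iterS; split; [exact: Yinv|rewrite qF// IH2 -natr1; ring].
  rewrite leNgt; apply/negP => ch.
  have K0 : 0 <= d x o + B + 1.
    have := lowb x Yx; rlra.
  have ch0 : 0 < - c h by rewrite oppr_gt0.
  have := archi_boundP (divr_ge0 K0 (ltW ch0)).
  set n := Num.bound _; rewrite ltr_pdivrMr// => nP.
  by have [Yn Fn] := it n; have := lowb _ Yn; rewrite Fn; lra.
have c0 h : H h -> c h = 0.
  move=> Hh; have Hh' := subgroupV sH Hh.
  have := qF _ _ Hh (Yinv _ _ Hh' Yx); rewrite rhoVK ?(qF h^-1%g)//; last exact: YZ.
  by have := c_ge0 _ Hh; have := c_ge0 _ Hh'; rlra.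
have IL : inv_convex (Y `&` [set z | F z <= F y]).
  split.
  - by move=> z [/YZ].
  - by exists y; split => /=.
  - exact: sublevel_cconvex.
  - by move=> h z Hh [Yz /= Fz]; split; [exact: Yinv|rewrite /= qF// c0// addr0].
by have [] := Ymin IL (@subIsetl _ _ _) Yx.
Qed.

Variable I : (G -> R) -> R.
Hypothesis mI : is_mean H I.

Lemma mean_ext f g : bdd_on H f -> (forall h, H h -> f h = g h) -> I f = I g.
Proof.
move=> bf fg; have bg : bdd_on H g by have [M fM] := bf; exists M => h Hh; rewrite -fg//; exact: fM.
by apply/le_anti/andP; split; apply: (mean_le mI) => // h Hh; rewrite fg.
Qed.

(* The mean over [h] of [f (h^-1 x) - f (h^-1 y0)] is a quasi-invariant convex
   function of [x], hence constant. *)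
Lemma mean_defect (f : X -> R) x y : mid_convex Y f -> lip1 Y f -> Y x -> Y y ->
  I (fun h => f (rho h^-1%g x) + f (rho h^-1%g y) - 2 * f (rho h^-1%g (mid x y))) <= 0.
Proof.
have [YZ Yne cY Yinv] := IY; move=> cf lf Yx Yy.
pose phi z w (h : G) := f (rho h^-1%g z) - f (rho h^-1%g w).
have inV h z : H h -> Y z -> Y (rho h^-1%g z).
  by move=> Hh Yz; apply: Yinv => //; exact: subgroupV.
have phib z w : Y z -> Y w -> bdd_on H (phi z w).
  move=> Yz Yw; exists (d z w) => h Hh; apply: (le_trans (lf _ _ _ _)); try exact: inV.
  by rewrite rho_iso//; [exact: subgroupV|exact: YZ|exact: YZ].
pose F z := I (phi z x).
have Fdiff z w : Y z -> Y w -> F z = F w + I (phi z w).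
  move=> Yz Yw; rewrite /F -(mean_add mI); try exact: phib.
  by apply: mean_ext => [|h Hh]; [exact: phib|rewrite /phi; ring].
have Flip : lip1 Y F.
  have key z w : Y z -> Y w -> F z <= F w + d z w.
    move=> Yz Yw; rewrite (Fdiff z w)// lerD2l -[leRHS](mean_cst mI).
    apply: (mean_le mI); [exact: phib|exact: bdd_cst|move=> h Hh].
    apply: (le_trans (ler_norm _)); apply: (le_trans (lf _ _ _ _)); try exact: inV.
    by rewrite rho_iso//; [exact: subgroupV|exact: YZ|exact: YZ].
  move=> z w Yz Yw; have := key z w Yz Yw; have := key w z Yw Yz.
  by rewrite (distC w) => ? ?; rewrite ler_norml; apply/andP; split; lra.
have defb z w : Y z -> Y w -> bdd_on H (fun h => f (rho h^-1%g z) + f (rho h^-1%g w)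
    - 2 * f (rho h^-1%g (mid z w))).
  move=> Yz Yw; have Ym := cY.1 _ _ Yz Yw.
  have [M fM] := bdd_add (phib _ _ Yz Ym) (phib _ _ Yw Ym); exists M => h /fM.
  by rewrite /phi; congr (`|_| <= _); ring.
have Fdef z w : Y z -> Y w -> F z + F w - 2 * F (mid z w) =
    I (fun h => f (rho h^-1%g z) + f (rho h^-1%g w) - 2 * f (rho h^-1%g (mid z w))).
  move=> Yz Yw; have Ym := cY.1 _ _ Yz Yw.
  rewrite (Fdiff z (mid z w))// (Fdiff w (mid z w))//.
  have -> : F (mid z w) + I (phi z (mid z w)) + (F (mid z w) + I (phi w (mid z w)))
     - 2 * F (mid z w) = I (phi z (mid z w)) + I (phi w (mid z w)) by ring.
  rewrite -(mean_add mI); try exact: phib.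
  by apply: mean_ext => [|h Hh]; [apply: bdd_add; exact: phib|rewrite /phi; ring].
have Fconv : mid_convex Y F.
  move=> z w Yz Yw; suff : 0 <= F z + F w - 2 * F (mid z w) by rlra.
  rewrite Fdef// -[leLHS](mean_cst mI); apply: (mean_le mI); [exact: bdd_cst|exact: defb|].
  move=> h Hh; have Hh' := subgroupV sH Hh.
  have Zz := YZ _ Yz; have Zw := YZ _ Yw.
  rewrite rho_mid//; last exact: cZ.1.
  by have := cf _ _ (inV _ _ Hh Yz) (inV _ _ Hh Yw); rlra.
have Fcst := @quasi_invariant_cst F (fun g => I (phi (rho g x) x)) Fconv Flip.
have {}Fcst z w : Y z -> Y w -> F z <= F w.
  apply: Fcst => h v Hh Yv; rewrite (Fdiff _ (rho h x)); try exact: Yinv.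
  rewrite addrC; congr (_ + _).
  rewrite /F -(mean_inv mI (f := phi v x) (k := h^-1%g)); [|exact: phib|exact: subgroupV].
  apply: mean_ext; first by apply: phib; exact: Yinv.
  by move=> k Hk; rewrite /phi invgM invgK !rhoM//; try (exact: subgroupV); exact: YZ.
rewrite -(Fdef x y Yx Yy); have := Fcst _ _ Yx (cY.1 _ _ Yx Yy); have := Fcst _ _ Yy (cY.1 _ _ Yx Yy); rlra.
Qed.

End Action.
End IsometricActions.

(** * Limits along the mean on a minimal invariant convex set *)

Section Inner.
Variables (R : realType) (X : metricType R) (G : groupType) (H : set G).
Local Notation d := (@mdist R X).
Hypothesis HX : proper_hadamard X.
Hypothesis sH : subgroup H.
Variables (Z : set X) (rho : G -> X -> X) (o : X).
Hypotheses (rhoP : isom_on H Z rho) (Zo : Z o) (cZ : cconvex Z).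
Hypothesis NE : no_escape H Z rho o.
Hypothesis Zmin : forall Y, inv_convex H Z rho Y -> Z `<=` Y.
Variables (I : (G -> R) -> R) (U : set_system G).
Hypotheses (mI : is_mean H I) (UU : UltraFilter U) (UH : U H).
Hypothesis Umean : forall phi, bdd_on H phi -> (forall h, H h -> 0 <= phi h) ->
  I phi <= 0 -> phi h @[h --> U] --> (0 : R).

(** Nets are indexed by the whole group, so the action is completed by the identity outside [H],
    which [U] does not see. *)
Let fwd h x := if `[< H h >] then rho h x else x.
Let bwd h x := if `[< H h >] then rho h^-1%g x else x.

Let fwd_in h x : Z x -> Z (fwd h x).
Proof. by rewrite /fwd; case: asboolP => // Hh; apply: (rho_in rhoP). Qed.

Let bwd_in h x : Z x -> Z (bwd h x).
Proof. by rewrite /bwd; case: asboolP => // Hh; apply: (rho_in rhoP) => //; exact: subgroupV. Qed.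

Let fwdK h x : Z x -> bwd h (fwd h x) = x.
Proof. by rewrite /fwd /bwd; case: asboolP => // Hh Zx; exact: (rhoK sH rhoP). Qed.

Let bwdK h x : Z x -> fwd h (bwd h x) = x.
Proof. by rewrite /fwd /bwd; case: asboolP => // Hh Zx; exact: (rhoVK sH rhoP). Qed.

Let fwd_iso h x y : Z x -> Z y -> d (fwd h x) (fwd h y) = d x y.
Proof. by rewrite /fwd; case: asboolP => // Hh Zx Zy; exact: (rho_iso rhoP). Qed.

Let bwd_iso h x y : Z x -> Z y -> d (bwd h x) (bwd h y) = d x y.
Proof.
rewrite /bwd; case: asboolP => // Hh Zx Zy.
by apply: (rho_iso rhoP) => //; exact: subgroupV.
Qed.

Let dist_bwd h x y : Z x -> Z y -> d (bwd h x) y = d x (fwd h y).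
Proof. by move=> Zx Zy; rewrite -(fwdK h Zy) bwd_iso ?fwdK//; exact: fwd_in. Qed.

Let bwd_mid h x y : Z x -> Z y -> bwd h (mid x y) = mid (bwd h x) (bwd h y).
Proof.
move=> Zx Zy; apply: mid_uniq => //; have Zm := cZ.1 _ _ Zx Zy.
by have [m1 m2] := midP HX x y; split; rewrite !bwd_iso.
Qed.

Let limitZ : limit_set U (fun=> Z) = Z.
Proof.
apply/seteqP; split=> [y [u Zu uy]|y Zy]; last by exists (fun=> y) => //; exact: cst_net.
apply: cZ.2 => e e0; have [i /= uie] := ultra_ex UU ((net_cvgP UU _ _).1 uy _ e0).
by exists (u i); rewrite // distC.
Qed.

Let UT (P : G -> Prop) : (forall h, P h) -> U [set h | P h].
Proof. by move=> PT; apply: filterS filterT => h _; exact: PT. Qed.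

Let oB : U [set i : G | d o o <= 0].
Proof. by apply: UT => _; rewrite distxx. Qed.

(** The convexity defect is nonnegative with mean at most 0 by [mean_defect], so [Umean] makes it
    vanish along [U]. *)
Let lim_affine (f : X -> R) x y : mid_convex Z f -> lip1 Z f -> Z x -> Z y ->
  f (bwd h x) + f (bwd h y) - 2 * f (bwd h (mid x y)) @[h --> U] --> (0 : R).
Proof.
move=> cf lf Zx Zy; have Zm := cZ.1 _ _ Zx Zy.
have IZ : inv_convex H Z rho Z.
  by split => //; [exists o|move=> h z; exact: (rho_in rhoP)].
have inV h z : H h -> Z z -> Z (rho h^-1%g z).
  by move=> Hh Zz; apply: (rho_in rhoP) => //; exact: subgroupV.
have := mean_defect HX sH rhoP cZ NE IZ (fun Y IY _ => Zmin IY) mI cf lf Zx Zy.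
move=> /Umean; set phi := (X in bdd_on H X) => H1.
have : phi h @[h --> U] --> (0 : R).
  apply: H1.
    exists (d x (mid x y) + d y (mid x y)) => h Hh; rewrite /phi.
    have l1 := lf _ _ (inV _ _ Hh Zx) (inV _ _ Hh Zm).
    have l2 := lf _ _ (inV _ _ Hh Zy) (inV _ _ Hh Zm).
    have := ler_normD (f (rho h^-1%g x) - f (rho h^-1%g (mid x y)))
      (f (rho h^-1%g y) - f (rho h^-1%g (mid x y))).
    have Hh' := subgroupV sH Hh; rewrite !(rho_iso rhoP)// in l1 l2.
    have -> : f (rho h^-1%g x) + f (rho h^-1%g y) - 2 * f (rho h^-1%g (mid x y)) =
     f (rho h^-1%g x) - f (rho h^-1%g (mid x y)) +
     (f (rho h^-1%g y) - f (rho h^-1%g (mid x y))) by ring.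
    by rlra.
  move=> h Hh; rewrite /phi (rho_mid HX rhoP)//; [|exact: cZ.1|exact: subgroupV].
  by have := cf _ _ (inV _ _ Hh Zx) (inV _ _ Hh Zy); rlra.
apply: lim_eq => //; apply: filterS UH => h /= Hh; rewrite /phi /bwd.
by case: asboolP.
Qed.

Let trans_limit (f : X -> R) : lip1 Z f -> exists2 g, lip1 Z g &
  forall u y, (forall h, Z (u h)) -> Z y -> d (u h) y @[h --> U] --> (0 : R) ->
    f (bwd h (u h)) - f (bwd h o) @[h --> U] --> g y.
Proof.
move=> lf.
have [|g lg gP] := @lip_limit R X G U UU (fun=> Z) (fun=> o) o 0 (fun=> Zo) oB (fun h x => f (bwd h x)).
  by move=> h x y Zx Zy; rewrite -(bwd_iso h Zx Zy); apply: lf; exact: bwd_in.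
by exists g; [rewrite -limitZ|move=> u y Zu Zy; exact: gP].
Qed.

Let trans_sys_limit k (b : nat -> X -> R) (T : nat -> R -> X -> X) : split_sys Z k b T ->
  exists b' T', split_sys Z k b' T' /\
   forall u y, (forall h, Z (u h)) -> Z y -> d (u h) y @[h --> U] --> (0 : R) ->
     forall j, (j < k)%N -> (b j (bwd h (u h)) - b j (bwd h o) @[h --> U] --> b' j y) /\
     forall t, d (fwd h (T j t (bwd h (u h)))) (T' j t y) @[h --> U] --> (0 : R).
Proof.
move=> sys.
have [|b' [T' [sys' H']]] := @sys_limit R X HX G U UU (fun=> Z) (fun=> o) o 0 (fun=> Zo) oB
   k (fun h j => b j \o bwd h) (fun h j t => fwd h \o T j t \o bwd h).
  move=> h; apply: (@sys_conj R X Z Z k b T (fwd h) (bwd h)) => //.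
  - by move=> x; exact: fwd_in.
  - by move=> x; exact: bwd_in.
  - by move=> x; exact: fwdK.
  - by move=> x; exact: bwdK.
  - by move=> x y; exact: fwd_iso.
exists b', T'; split; first by rewrite -limitZ.
by move=> u y Zu Zy uy j jk; have [h1 h2] := H' u y Zu uy j jk.
Qed.

Let fwd_net (u : G -> X) (M : R) : (forall h, Z (u h)) -> U [set h | d o (fwd h (u h)) <= M] ->
  exists2 y, Z y & d (fwd h (u h)) y @[h --> U] --> (0 : R).
Proof.
move=> Zu uM; have [y yP] := hadamard_net HX UU uM.
by exists y => //; rewrite -limitZ; exists (fun h => fwd h (u h)) => // h; exact: fwd_in.
Qed.

Section Step.
Variables (k : nat) (b : nat -> X -> R) (T : nat -> R -> X -> X).

(* The Busemann function of a ray transverse to the flat factor. *)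
Definition ray_function b T phi :=
  [/\ split_sys Z k b T, mid_affine Z phi, lip1 Z phi,
    forall j t x, (j < k)%N -> Z x -> phi (T j t x) = phi x &
    forall t x, 0 <= t -> Z x -> exists y, [/\ Z y, d x y <= t & phi y <= phi x - t]].

Let ray_mid phi : ray_function b T phi -> forall t x, 0 <= t -> Z x ->
  exists y, [/\ Z y, d x y <= t & phi y = phi x - t].
Proof.
case=> _ _ lp _ ray t x t0 Zx; have [y [Zy xy py]] := ray t x t0 Zx.
exists y; split=> //; apply/le_anti; rewrite py /=.
by have := lp _ _ Zx Zy; rewrite ler_norml => /andP[_]; rlra.
Qed.

(* [back phi t] is the set of points at the end of a segment of length [t] of a
   ray; its distance function is convex and bounded, so that its limit along [U]
   is affine and bounded on rays, hence vanishes. *)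
Let back (phi : X -> R) t := [set x | Z x /\ exists w, [/\ Z w, d x w <= t & phi x + t <= phi w]].

Let back_cconvex phi t : mid_affine Z phi -> lip1 Z phi -> cconvex (back phi t).
Proof.
move=> ap lp; split.
  move=> x y [Zx [w [Zw xw pw]]] [Zy [v [Zv yv pv]]]; split; first exact: cZ.1.
  exists (mid w v); split; first exact: cZ.1.
    by have := dist_mid_mid HX x y w v; rlra.
  by rewrite !ap//; rlra.
move=> x H1.
have Zx : Z x by apply: cZ.2 => e /H1[y [Zy _]]; exists y.
split=> //; have [V VV Vn] := nat_ultra.
have /choice[u uP] : forall n, exists u : X * X, [/\ Z u.1, Z u.2, d x u.1 < n.+1%:R^-1,
    d u.1 u.2 <= t & phi u.1 + t <= phi u.2].
  move=> n; have [|y [Zy [w [Zw yw pw]]] xy] := H1 n.+1%:R^-1; first by rewrite invr_gt0.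
  by exists (y, w).
have small (e : R) : 0 < e -> V [set n | n.+1%:R^-1 < e].
  move=> e0; apply: filterS (Vn (Num.bound e^-1)) => n /= nb.
  rewrite invf_plt ?posrE ?ltr0Sn//.
  apply: (lt_le_trans (archi_boundP _)); first by rewrite ltW ?invr_gt0.
  by rewrite ler_nat; apply: leqW.
have u1 : d (u n).1 x @[n --> V] --> (0 : R).
  apply/(net_cvgP VV) => e /small; apply: filterS => n /=.
  by have [_ _ h _ _] := uP n; rewrite distC; apply: lt_trans.
have [|w wP] := hadamard_net HX VV (o := x) (u := fun n => (u n).2) (M := 1 + t).
  apply: filterS (small 1 ltr01) => n /= n1; have [_ _ h1 h2 _] := uP n.
  have {h1 n1} := lt_trans h1 n1; have := dist_tri (u n).1 x (u n).2; rlra.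
have Zw : Z w.
  apply: cZ.2 => e e0; have [i /= uie] := ultra_ex VV ((net_cvgP VV _ _).1 wP _ e0).
  by exists (u i).2; [have [] := uP i|rewrite distC].
exists w; split => //.
  apply: (lim_le VV (dist_cvg VV u1 wP) (lim_const VV _)).
  by apply: filterS filterT => n _ /=; have [] := uP n.
have c1 := dist_cvg VV u1 (cst_net VV x); have c2 := dist_cvg VV wP (cst_net VV w).
have := lim_add VV c1 c2; rewrite !distxx addr0 => c3.
rewrite -subr_le0; apply: (lim_le VV (lim_const VV _) c3).
apply: filterS filterT => n _ /=; have [Zu Zv _ _ pu] := uP n.
have := lp _ _ Zu Zx; have := lp _ _ Zv Zw; rewrite !ler_norml => /andP[h1 h2] /andP[h3 h4].
by rewrite /= /=; rlra.
Qed.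

Let lip_shift (f : X -> R) u v : lip1 Z f -> (forall h, Z (u h)) -> (forall h, Z (v h)) ->
  d (u h) (v h) @[h --> U] --> (0 : R) -> f (u h) - f (v h) @[h --> U] --> (0 : R).
Proof.
move=> lf Zu Zv /(real_cvgP UU) uv; apply/(real_cvgP UU) => e e0.
apply: filterS (uv _ e0) => h /=; rewrite !subr0 (ger0_norm (dist_ge0 _ _)).
by apply: le_lt_trans; exact: lf.
Qed.

(** The limit [psi] of the translates of [phi] inherits its descending rays directly. The work is to
    extend them backwards: [bwd h x] turns out to be asymptotically in [back phi t], although [x]
    was arbitrary. *)
Lemma ray_function_split phi : ray_function b T phi ->
  exists b' T', split_sys Z k.+1 b' T'.
Proof.
move=> rf; have [sys ap lp pT _] := rf; have ray := ray_mid rf.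
have [psi lpsi psiP] := trans_limit lp.
have [b2 [T2 [sys2 sysP]]] := trans_sys_limit sys.
have psiC x : Z x -> phi (bwd h x) - phi (bwd h o) @[h --> U] --> psi x.
  by move=> Zx; apply: (psiP (fun=> x)) => //; exact: cst_net.
have apsi : mid_affine Z psi.
  move=> x y Zx Zy; have Zm := cZ.1 _ _ Zx Zy.
  apply: (real_cvg_unique UU (psiC _ Zm)).
  have -> : (fun h => phi (bwd h (mid x y)) - phi (bwd h o)) =
    (fun h => (phi (bwd h x) - phi (bwd h o) + (phi (bwd h y) - phi (bwd h o))) * 2^-1).
    apply/funext => h; rewrite bwd_mid// ap; [|exact: bwd_in|exact: bwd_in].
    rlra.
  by apply: cvgMl; apply: (lim_add UU); exact: psiC.
have psiT j t x : (j < k)%N -> Z x -> psi (T2 j t x) = psi x.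
  move=> jk Zx; have [_ /(_ t) tP] := sysP (fun=> x) x (fun=> Zx) Zx (cst_net UU x) j jk.
  have sj := sys.1 j jk; have ZT h : Z (T j t (bwd h x)) by apply: (split_in sj); exact: bwd_in.
  have := psiP _ _ (fun h => fwd_in h (ZT h)) (split_in (sys2.1 j jk) t Zx) tP.
  move=> /real_cvg_unique; apply => //; apply: lim_eq (psiC _ Zx) => //; apply: UT => h /=.
  by rewrite fwdK// pT//; exact: bwd_in.
have fray t x : 0 <= t -> Z x -> exists eta : G -> X, [/\ forall h, Z (eta h),
    forall h, d (bwd h x) (eta h) <= t & forall h, phi (eta h) = phi (bwd h x) - t].
  move=> t0 Zx; have /choice[eta etaP] : forall h, exists y,
    [/\ Z y, d (bwd h x) y <= t & phi y = phi (bwd h x) - t].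
    by move=> h; apply: ray => //; exact: bwd_in.
  by exists eta; split=> h; have [] := etaP h.
have net t x eta : 0 <= t -> Z x -> (forall h, Z (eta h)) ->
    (forall h, d (bwd h x) (eta h) <= t) -> exists y, [/\ Z y, d x y <= t &
    d (fwd h (eta h)) y @[h --> U] --> (0 : R)].
  move=> t0 Zx Ze xe; have [|y Zy yP] := @fwd_net eta (d o x + t) Ze.
    apply: UT => h; have := dist_tri x o (fwd h (eta h)).
    by have := xe h; rewrite dist_bwd//; rlra.
  exists y; split=> //; apply: (lim_le UU (dist_cvg UU (cst_net UU x) yP) (lim_const UU _)).
  by apply: UT => h; rewrite -dist_bwd.
have fwdray t x : 0 <= t -> Z x -> exists y, [/\ Z y, d x y <= t & psi y = psi x - t].
  move=> t0 Zx; have [eta [Ze e1 e2]] := fray t x t0 Zx.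
  have [y [Zy xy yP]] := net t x eta t0 Zx Ze e1.
  exists y; split=> //; have := psiP _ _ (fun h => fwd_in h (Ze h)) Zy yP.
  move=> /(real_cvg_unique UU); apply.
  have := lim_sub UU (psiC _ Zx) (lim_const UU t); apply: lim_eq => //; apply: UT => h /=.
  by rewrite fwdK// e2 /=; rlra.
have backray t x : 0 <= t -> Z x -> exists y, [/\ Z y, d x y <= t & psi y = psi x + t].
  (* The ray is followed for [2 * t], so that the point [mu] halfway and the end [eta] both have a
     point of the ray at distance [t] behind them. *)
  move=> t0 Zx; have t20 : 0 <= 2 * t by lra.
  have [eta [Ze e1 e2]] := fray (2 * t) x t20 Zx.
  have [y [Zy xy yP]] := net (2 * t) x eta t20 Zx Ze e1.
  pose W := back phi t.
  pose mu h := mid (bwd h x) (eta h).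
  have Zmu h : Z (mu h) by apply: cZ.1 => //; exact: bwd_in.
  have pmu h : phi (mu h) = phi (bwd h x) - t.
    by rewrite /mu ap// ?e2; [rlra|exact: bwd_in].
  have Wmu h : W (mu h).
    split=> //; exists (bwd h x); split; first exact: bwd_in.
      by rewrite /mu distC dist_midl//; have := e1 h; rlra.
    by rewrite pmu; rlra.
  have Weta h : W (eta h).
    split=> //; exists (mu h); split => //.
      by rewrite /mu distC dist_midr//; have := e1 h; rlra.
    by rewrite pmu e2; rlra.
  have cW : cconvex W by exact: back_cconvex.
  have Wne : W !=set0 by exists (mu 1%g).
  pose f x := d x (proj W x).
  have lf : lip1 Z f by apply: lip1_sub (dist_proj_lip HX Wne cW).
  have f0 x' : W x' -> f x' = 0.
    move=> Wx'; apply/le_anti; rewrite dist_ge0 andbT.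
    by have := proj_min HX Wne cW x' Wx'; rewrite distxx.
  have Zm := cZ.1 _ _ Zx Zy.
  have c1 := lim_affine (@dist_proj_convex R X HX W Wne cW Z) lf Zx Zy.
  have dy : d (bwd h y) (eta h) @[h --> U] --> (0 : R).
    apply: lim_eq yP => //; apply: UT => h /=.
    by rewrite dist_bwd// distC.
  have c2 : f (bwd h y) @[h --> U] --> (0 : R).
    have := lip_shift lf (fun h => bwd_in h Zy) Ze dy; apply: lim_eq => //.
    by apply: UT => h /=; rewrite (f0 (eta h))// subr0.
  have c3 : f (bwd h (mid x y)) @[h --> U] --> (0 : R).
    have : f (bwd h (mid x y)) - f (mu h) @[h --> U] --> (0 : R).
      apply: lip_shift => //; first by move=> h; exact: bwd_in.
      apply: (squeeze0 UU) dy; apply: UT => h; rewrite dist_ge0 /= bwd_mid//.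
      apply: (le_trans (dist_mid_mid HX _ _ _ _)); rewrite distxx.
      by have := dist_ge0 (bwd h y) (eta h); rlra.
    by apply: lim_eq => //; apply: UT => h /=; rewrite (f0 (mu h))// subr0.
  (* The limit of [f] is affine and vanishes at [y] and at the midpoint of [x] and [y], hence at
     [x]. *)
  have c4 : f (bwd h x) @[h --> U] --> (0 : R).
    have := lim_add UU (lim_sub UU c1 c2) (lim_scale UU (c := 2) c3); rewrite mulr0 subr0 addr0.
    by apply: lim_eq => //; apply: UT => h /=; rewrite /f /=; ring.
  pose q h := proj W (bwd h x).
  have Wq h : W (q h) by exact: proj_in.
  have /choice[w wP] : forall h, exists w, [/\ Z w, d (q h) w <= t & phi (q h) + t <= phi w].
    by move=> h; have [_] := Wq h.
  have Zw h : Z (w h) by have [] := wP h.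
  have Zq h : Z (q h) by have [] := Wq h.
  have [|w' Zw' w'P] := @fwd_net w (d o x + 1 + t) Zw.
    apply: filterS ((real_cvgP UU _ _).1 c4 1 ltr01) => h /=.
    rewrite subr0 ger0_norm ?dist_ge0// => h1.
    have [_ h2 _] := wP h; have := dist_tri x o (fwd h (w h)).
    have := dist_tri (q h) (bwd h x) (w h); rewrite dist_bwd//.
    move: h1; rewrite /f -/(q h); rlra.
  have xw : d x w' <= t.
    have := lim_add UU c4 (lim_const UU t); rewrite add0r => c5.
    apply: (lim_le UU (dist_cvg UU (cst_net UU x) w'P) c5); apply: UT => h /=.
    rewrite -dist_bwd//; have [_ h2 _] := wP h.
    by have := dist_tri (q h) (bwd h x) (w h); rewrite /f /= -/(q h); rlra.
  exists w'; split=> //; apply/le_anti/andP; split.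
    by have := lpsi _ _ Zw' Zx; rewrite ler_norml (distC w') => /andP[_]; rlra.
  have c6 := lip_shift lp Zq (fun h => bwd_in h Zx).
  have {}c6 : phi (q h) - phi (bwd h x) @[h --> U] --> (0 : R).
    by apply: c6; under eq_fun do rewrite distC.
  have c7 := psiP _ _ (fun h => fwd_in h (Zw h)) Zw' w'P.
  have c8 := lim_add UU (lim_add UU (psiC _ Zx) c6) (lim_const UU t).
  rewrite addr0 in c8; apply: (lim_le UU c8 c7); apply: UT => h /=.
  by have [_ _] := wP h; rewrite fwdK// /=; rlra.
have [|T' lT'] := affine_line_split HX cZ.1 apsi lpsi.
  move=> t x Zx; have [t0|t0] := lerP 0 t.
    by rewrite ger0_norm//; exact: fwdray.
  have [|y yP] := @backray (- t) x _ Zx; first by rewrite oppr_ge0 ltW.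
  by exists y; rewrite ltr0_norm// -[psi x - t]/(psi x + - t).
exists (fun i => if (i < k)%N then b2 i else fun x => - psi x).
exists (fun i => if (i < k)%N then T2 i else T').
by apply: sys_extend => // i t y ik Zy; rewrite psiT.
Qed.

End Step.

Section Dichotomy.
Variables (k : nat) (b : nat -> X -> R) (T : nat -> R -> X -> X).
Hypothesis sys : split_sys Z k b T.
Let f x := trans k b x o.
(* Unlike [f], strictly convex transversally. *)
Let fh x := Num.sqrt (1 + f x ^+ 2).

Let f_ge0 x : 0 <= f x. Proof. exact: trans_ge0. Qed.

Let fhE x : fh x ^+ 2 = 1 + f x ^+ 2.
Proof. by rewrite sqr_sqrtr// addr_ge0// sqr_ge0. Qed.

Let fh_ge0 x : 0 <= fh x. Proof. exact: sqrtr_ge0. Qed.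

Let f_fh x : f x < fh x.
Proof. have := fhE x; have := fh_ge0 x; have := f_ge0 x; rnra. Qed.

Let f_tri x y : Z x -> Z y -> `|f x - f y| <= trans k b x y.
Proof.
move=> Zx Zy; have := trans_tri sys Zx Zy Zo; have := trans_tri sys Zy Zx Zo.
rewrite (trans_sym k b y x) -/(f x) -/(f y) => h1 h2.
by rewrite ler_norml; apply/andP; split; lra.
Qed.

Let fh_f x y : `|fh x - fh y| <= `|f x - f y|.
Proof.
apply: ler_of_sqr; first exact: normr_ge0.
rewrite !real_normK ?num_real//.
have := fhE x; have := fhE y; have := fh_ge0 x; have := fh_ge0 y.
have := f_ge0 x; have := f_ge0 y.
move: (f x) (f y) (fh x) (fh y) => u v p q u0 v0 p0 q0 qE pE.
suff : 1 + u * v <= q * p by nra.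
apply: ler_of_sqr; first exact: mulr_ge0.
by rewrite exprMn qE pE; have := sqr_ge0 (u - v); rnra.
Qed.

Let f_lip : lip1 Z f.
Proof.
move=> x y Zx Zy; apply: (le_trans (f_tri Zx Zy)); exact: (trans_le_dist sys).
Qed.

Let fh_lip : lip1 Z fh.
Proof. by move=> x y Zx Zy; apply: (le_trans (fh_f x y)); exact: f_lip. Qed.

Let fh_CN x y : Z x -> Z y ->
  fh (mid x y) ^+ 2 <= (fh x ^+ 2 + fh y ^+ 2) / 2 - trans k b x y ^+ 2 / 4.
Proof.
move=> Zx Zy; rewrite !fhE /f !(trans_sym k b _ o).
by have := trans_CN HX sys cZ.1 Zo Zx Zy; rlra.
Qed.

Let fh_convex : mid_convex Z fh.
Proof.
move=> x y Zx Zy; apply: ler_of_sqr; first by have := fh_ge0 x; have := fh_ge0 y; rlra.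
apply: (le_trans (fh_CN Zx Zy)).
have : (fh x - fh y) ^+ 2 <= trans k b x y ^+ 2.
  rewrite -[leLHS]real_normK ?num_real// ler_sqr ?nnegrE ?trans_ge0 ?normr_ge0//.
  by apply: (le_trans (fh_f x y)); exact: f_tri.
rnra.
Qed.

Let f_bwd_dist h x : Z x -> `|f (bwd h x) - f (bwd h o)| <= d x o.
Proof.
move=> Zx; apply: (le_trans (f_lip (bwd_in h Zx) (bwd_in h Zo))).
by rewrite bwd_iso.
Qed.

(* The defect of convexity of [fh] vanishes along [U], whereas [fh] is uniformly
   convex transversally where [f] is bounded. *)
Let flat_of_bounded M : U [set h | f (bwd h o) <= M] ->
  exists b' T', split_sys Z k b' T' /\ forall x y, Z x -> Z y -> trans k b' x y = 0.
Proof.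
move=> fM; have [b' [T' [sys' sysP]]] := trans_sys_limit sys.
exists b', T'; split=> // x y Zx Zy.
have fx z : Z z -> U [set h | `|f (bwd h z)| <= M + d z o].
  move=> Zz; apply: filterS fM => h /= h1; rewrite ger0_norm//.
  by have := f_bwd_dist h Zz; rewrite ler_norml => /andP[_]; rlra.
have fhx z : Z z -> U [set h | `|fh (bwd h z)| <= 1 + M + d z o].
  move=> Zz; apply: filterS (fx z Zz) => h /=; rewrite !ger0_norm//.
  have := fhE (bwd h z); have := fh_ge0 (bwd h z); have := f_ge0 (bwd h z); rnra.
have Zm := cZ.1 _ _ Zx Zy.
have [Fx FxP] := bounded_cvg UU (fx x Zx); have [Fy FyP] := bounded_cvg UU (fx y Zy).
have [ax axP] := bounded_cvg UU (fhx x Zx); have [ay ayP] := bounded_cvg UU (fhx y Zy).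
have [am amP] := bounded_cvg UU (fhx _ Zm).
have cb z j : Z z -> (j < k)%N -> b j (bwd h z) - b j (bwd h o) @[h --> U] --> b' j z.
  by move=> Zz jk; have [] := sysP (fun=> z) z (fun=> Zz) Zz (cst_net UU z) j jk.
have E2 : trans k b (bwd h x) (bwd h y) ^+ 2 @[h --> U] --> trans k b' x y ^+ 2.
  rewrite (sqr_trans sys')//.
  have := lim_sub UU (lim_const UU (d x y ^+ 2)) (@lim_sum R G U UU k
     (fun h j => (b j (bwd h x) - b j (bwd h y)) ^+ 2) (fun j => (b' j x - b' j y) ^+ 2) _).
  set P := (X in (X -> _) -> _) => H1.
  have HP : P.
    move=> j jk; apply: lim_sqr.
    have := lim_sub UU (cb x j Zx jk) (cb y j Zy jk); apply: lim_eq => //.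
    by apply: UT => h /=; ring.
  have := H1 HP; apply: lim_eq => //; apply: UT => h /=.
  by rewrite (sqr_trans sys) ?/trans2 ?bwd_iso//; exact: bwd_in.
have e1 : Fx ^+ 2 + 1 = ax ^+ 2.
  apply: (real_cvg_unique UU (lim_add UU (lim_sqr UU FxP) (lim_const UU 1))).
  by apply: lim_eq (lim_sqr UU axP) => //; apply: UT => h /=; rewrite fhE addrC.
have e2 : Fy ^+ 2 + 1 = ay ^+ 2.
  apply: (real_cvg_unique UU (lim_add UU (lim_sqr UU FyP) (lim_const UU 1))).
  by apply: lim_eq (lim_sqr UU ayP) => //; apply: UT => h /=; rewrite fhE addrC.
have e3 : ax + ay - 2 * am = 0.
  apply: (real_cvg_unique UU _ (lim_affine fh_convex fh_lip Zx Zy)).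
  exact: (lim_sub UU (lim_add UU axP ayP) (lim_scale UU amP)).
have e4 : 4 * am ^+ 2 + trans k b' x y ^+ 2 <= 2 * (ax ^+ 2 + ay ^+ 2).
  apply: (lim_le UU (lim_add UU (lim_scale UU (c := 4) (lim_sqr UU amP)) E2)
    (lim_scale UU (c := 2) (lim_add UU (lim_sqr UU axP) (lim_sqr UU ayP)))).
  by apply: UT => h /=; have := fh_CN (bwd_in h Zx) (bwd_in h Zy); rewrite bwd_mid//; rlra.
have e5 : (Fx - Fy) ^+ 2 <= trans k b' x y ^+ 2.
  apply: (lim_le UU (lim_sqr UU (lim_sub UU FxP FyP)) E2); apply: UT => h /=.
  rewrite -[leLHS]real_normK ?num_real// ler_sqr ?nnegrE ?trans_ge0 ?normr_ge0//.
  by apply: f_tri; exact: bwd_in.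
have p1 : 0 <= ax by apply: (lim_le UU (lim_const UU 0) axP); exact: UT.
have p2 : 0 <= ay by apply: (lim_le UU (lim_const UU 0) ayP); exact: UT.
have p3 : 0 <= Fx by apply: (lim_le UU (lim_const UU 0) FxP); exact: UT.
have p4 : 0 <= Fy by apply: (lim_le UU (lim_const UU 0) FyP); exact: UT.
have := trans_ge0 k b' x y; move: (trans k b' x y) e4 e5 => E e4 e5 E0.
(* The limits satisfy [|Fx - Fy| <= E <= |ax - ay|], while [ax ^+ 2 - ay ^+ 2 = Fx ^+ 2 - Fy ^+ 2]
   and [Fx + Fy < ax + ay]; this forces [E = 0]. *)
have e6 : E ^+ 2 <= (ax - ay) ^+ 2.
  have am2 : am = (ax + ay) / 2 by lra.
  by rewrite am2 in e4; lra.
have q1 : Fx < ax by nra.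
have q2 : Fy < ay by nra.
have e7 : (ax - ay) * (ax + ay) = (Fx - Fy) * (Fx + Fy) by lra.
have e8 : E ^+ 2 * (ax + ay) ^+ 2 <= E ^+ 2 * (Fx + Fy) ^+ 2.
  apply: (@le_trans _ _ ((ax - ay) ^+ 2 * (ax + ay) ^+ 2)).
    by apply: ler_wpM2r => //; exact: sqr_ge0.
  by rewrite -exprMn e7 exprMn; apply: ler_wpM2r => //; exact: sqr_ge0.
apply/eqP; rewrite -sqrf_eq0; apply/eqP/le_anti; rewrite sqr_ge0 andbT.
have e9 : 0 < (ax + ay) ^+ 2 - (Fx + Fy) ^+ 2 by nra.
by rewrite -(pmulr_lle0 _ e9); lra.
Qed.

(** Where [f] tends to infinity, [fh - f] tends to 0, so the limit of the normalized [f] is affine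
    like that of [fh]. Its rays are limits of segments towards the zero set of [f]. *)
Let ray_of_unbounded : (forall M, U [set h | M < f (bwd h o)]) ->
  exists b' T' phi, ray_function k b' T' phi.
Proof.
move=> fM; have [b' [T' [sys' sysP]]] := trans_sys_limit sys.
have [phi lphi phiP] := trans_limit f_lip.
exists b', T', phi.
have phiC x : Z x -> f (bwd h x) - f (bwd h o) @[h --> U] --> phi x.
  by move=> Zx; apply: (phiP (fun=> x)) => //; exact: cst_net.
have big x M : Z x -> U [set h | M < f (bwd h x)].
  move=> Zx; apply: filterS (fM (M + d x o)) => h /=.
  by have := f_bwd_dist h Zx; rewrite ler_norml => /andP[+ _]; rlra.
have diff x : Z x -> fh (bwd h x) - f (bwd h x) @[h --> U] --> (0 : R).
  move=> Zx; apply/(real_cvgP UU) => e e0; apply: filterS (big x e^-1 Zx) => h /=.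
  have fp := f_fh (bwd h x); rewrite subr0 gtr0_norm ?subr_gt0// => fe.
  have ei : e * e^-1 = 1 by rewrite mulfV ?gt_eqF.
  have e10 : 0 < e^-1 by rewrite invr_gt0.
  have := fhE (bwd h x); move: (fh _) (f _) (e^-1) fp fe ei e10 => p q e' *; nra.
split=> //.
- move=> x y Zx Zy; have Zm := cZ.1 _ _ Zx Zy.
  have c1 := lim_affine fh_convex fh_lip Zx Zy.
  have c2 := lim_sub UU (lim_add UU (diff _ Zx) (diff _ Zy)) (lim_scale UU (c := 2) (diff _ Zm)).
  have c3 := lim_sub UU (lim_add UU (phiC _ Zx) (phiC _ Zy)) (lim_scale UU (c := 2) (phiC _ Zm)).
  have := lim_sub UU c1 c2; rewrite mulr0 addr0 !subr0 => c4.
  suff : phi x + phi y - 2 * phi (mid x y) = 0 by lra.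
  apply: (real_cvg_unique UU c3); apply: lim_eq c4 => //; apply: UT => h /=; ring.
- move=> j t x jk Zx; have [_ /(_ t) tP] := sysP (fun=> x) x (fun=> Zx) Zx (cst_net UU x) j jk.
  have sj := sys.1 j jk; have ZT h : Z (T j t (bwd h x)) by apply: (split_in sj); exact: bwd_in.
  have := phiP _ _ (fun h => fwd_in h (ZT h)) (split_in (sys'.1 j jk) t Zx) tP.
  move=> /real_cvg_unique; apply => //; apply: lim_eq (phiC _ Zx) => //; apply: UT => h /=.
  rewrite fwdK//; congr (_ - _); apply/eqP; rewrite -(@eqrXn2 _ 2)// ?f_ge0//.
  have Zb := bwd_in h Zx.
  have eS : \sum_(i < k | i != Ordinal jk) (b i (T j t (bwd h x)) - b i o) ^+ 2 =
      \sum_(i < k | i != Ordinal jk) (b i (bwd h x) - b i o) ^+ 2.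
    by apply: eq_bigr => i ij; rewrite sys.2.
  rewrite !(sqr_trans sys)// /trans2 (bigD1 (Ordinal jk))//= [in eqbRHS](bigD1 (Ordinal jk))//=.
  rewrite eS (split_coord sj)// (distC (T j t (bwd h x)) o) (split_cos sj)// (distC o).
  by apply/eqP; ring.
- move=> t x t0 Zx.
  have /choice[eta etaP] : forall h, exists y, Z y /\ (t < f (bwd h x) ->
      d (bwd h x) y = t /\ f y <= f (bwd h x) - t).
    move=> h; have [ft|_] := ltrP t (f (bwd h x)); last by exists o.
    (* [q] is a translate of [o], so [f] vanishes there, and it is at distance exactly
       [f (bwd h x)]. *)
    have Zb := bwd_in h Zx; pose q := level b T k (bwd h x) o.
    have Zq : Z q by exact: (level_in sys).
    have dq : d (bwd h x) q = f (bwd h x) by rewrite (dist_level sys).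
    have [|y [y1 y2]] := hadamard_between HX (x := bwd h x) (y := q) (t := t).
      by rewrite t0 dq ltW.
    have Zy : Z y by apply: (between_in HX cZ Zb Zq); rewrite y1 y2; lra.
    exists y; split=> // _; split=> //; apply: (le_trans (trans_tri sys Zy Zq Zo)).
    rewrite (trans_sym k b q) (trans_level0 sys)// addr0 -dq -y2.
    exact: (trans_le_dist sys).
  have Ze h : Z (eta h) by have [] := etaP h.
  have xe : U [set h | d x (fwd h (eta h)) <= t].
    apply: filterS (big x t Zx) => h /=; have [_ H1] := etaP h => /H1[<- _].
    by rewrite dist_bwd.
  have [|y Zy yP] := @fwd_net eta (d o x + t) Ze.
    by apply: filterS xe => h /=; have := dist_tri x o (fwd h (eta h)); rlra.
  exists y; split=> //.
    exact: (lim_le UU (dist_cvg UU (cst_net UU x) yP) (lim_const UU t)).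
  have := phiP _ _ (fun h => fwd_in h (Ze h)) Zy yP => c1.
  apply: (lim_le UU c1 (lim_sub UU (phiC _ Zx) (lim_const UU t))).
  apply: filterS (big x t Zx) => h /=; have [_ H1] := etaP h => /H1[_ H2].
  by rewrite fwdK//; lra.
Qed.

Lemma flat_or_split :
  (exists b' T', split_sys Z k b' T' /\ forall x y, Z x -> Z y -> trans k b' x y = 0) \/
  (exists b' T', split_sys Z k.+1 b' T').
Proof.
have [[M fM]|unb] := pselect (exists M, U [set h | f (bwd h o) <= M]).
  by left; exact: flat_of_bounded fM.
right; have [|b' [T' [phi rf]]] := ray_of_unbounded; last exact: ray_function_split rf.
move=> M; have [fM|] := in_ultra_setVsetC [set h | f (bwd h o) <= M] UU.
  by exfalso; apply: unb; exists M.
by apply: filterS => h /= /negP; rewrite -ltNge.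
Qed.

End Dichotomy.

(** For a maximal number of line factors the second alternative of [flat_or_split] is excluded. *)
Lemma minimal_flat : exists k b T, split_sys Z k b T /\
  forall x y, Z x -> Z y -> trans k b x y = 0.
Proof.
have [N NP] := sys_bound HX o 0.
have [|k [b [T sys]]|k [[b [T sys]] max]] := @maximal_nat
   (fun k => exists b T, split_sys Z k b T) N.
- by exists (fun _ _ => 0), (fun _ _ x => x); split.
- by apply: (NP _ _ _ _ _ sys Zo); rewrite distxx.
have [[b' [T' [sys' flat]]]|//] := flat_or_split sys.
by exists k, b', T'.
Qed.

End Inner.

(* Adams-Ballmann: an amenable group without fixed points at infinity
   preserves a flat. *)
Theorem amenable_flat (R : realType) (X : metricType R) (G : groupType) (H : set G)
    (Z : set X) (rho : G -> X -> X) (o : X) (I : (G -> R) -> R) :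
  proper_hadamard X -> subgroup H -> isom_on H Z rho -> Z o -> cconvex Z ->
  no_escape H Z rho o -> is_mean H I ->
  exists Y k b T, [/\ inv_convex H Z rho Y, split_sys Y k b T &
    forall x y, Y x -> Y y -> trans k b x y = 0].
Proof.
move=> HX sH rhoP Zo cZ NE mI.
have [Y [IY Ymin]] := minimal_inv_convex HX sH rhoP Zo cZ NE.
have [YZ [y0 Yy0] cY Yinv] := IY.
have [U UU [UH Umean]] := mean_ultra mI.
have rhoY := isom_on_sub rhoP YZ Yinv.
have NEY : no_escape H Y rho y0.
  move=> M; have [B BP] := NE M; exists (mdist y0 o + B) => x Yx xM.
  by have := BP x (YZ _ Yx) xM; have := dist_tri o y0 x; rlra.
have Ymin' Y' : inv_convex H Y rho Y' -> Y `<=` Y'.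
  move=> [sub ne cY' inv]; apply: Ymin => //; split=> //; exact: subset_trans YZ.
have [k [b [T [sys flat]]]] :=
  minimal_flat HX sH rhoY Yy0 cY NEY Ymin' mI UU UH Umean.
by exists Y, k, b, T.
Qed.

(** * Fixed points at infinity *)

Section LimitSets.
Variables (R : realType) (X : metricType R).
Local Notation d := (@mdist R X).
Hypothesis HX : proper_hadamard X.
Variables (I : Type) (U : set_system I).
Hypothesis UU : UltraFilter U.
Variable Ys : I -> set X.
Hypotheses (Yne : forall i, Ys i !=set0) (cY : forall i, cconvex (Ys i)).

Lemma limit_set_cconvex : cconvex (limit_set U Ys).
Proof.
split.
  move=> x y [u Yu ux] [v Yv vy]; exists (fun i => mid (u i) (v i)).
    by move=> i; exact: (cY i).1.
  have := lim_add UU ux vy; rewrite addr0; apply: squeeze0.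
  apply: filterS filterT => i _ /=; rewrite dist_ge0 /=.
  have := dist_mid_mid HX (u i) (v i) x y; have := dist_ge0 (u i) x.
  by have := dist_ge0 (v i) y; rlra.
(* Nearest points give one net that is good for all [e] at once, which avoids a diagonal
   argument. *)
move=> y H1; exists (fun i => proj (Ys i) y); first by move=> i; exact: proj_in.
apply/(net_cvgP UU) => e e0; have e20 : 0 < e / 2 by rewrite divr_gt0.
have [z [v Yv vz] yz] := H1 _ e20.
apply: filterS ((net_cvgP UU _ _).1 vz _ e20) => i /= h.
have := proj_min HX (Yne i) (cY i) y (Yv i); rewrite (distC _ y).
by have := dist_tri z y (v i); rewrite (distC z (v i)); rlra.
Qed.

Lemma lim_inv0 (B : I -> R) (C : R) (f : I -> R) :
  (forall K : R, U [set i | K < B i]) -> U [set i | `|f i| * B i <= C] ->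
  f i @[i --> U] --> (0 : R).
Proof.
move=> Binf fB; apply/(real_cvgP UU) => e e0.
apply: filterS (filterI (filterI fB (Binf 0)) (Binf (C / e))) => i [/= [h1 h2] h3].
rewrite subr0 ltNge; apply/negP => h4.
have : C < e * B i by rewrite mulrC -ltr_pdivrMr.
by have := ler_wpM2r (ltW h2) h4; lra.
Qed.

(* Bounded perturbations of the points [p i] going to infinity define the same
   Busemann function. *)
Lemma horofunction_shift (u v p p' : I -> X) (K1 K2 : R) :
  U [set i | d (u i) (v i) <= K1] -> U [set i | d (p i) (p' i) <= K2] ->
  (forall K : R, U [set i | K < d (v i) (p i)]) ->
  (d (u i) (p i) - d (v i) (p i)) - (d (u i) (p' i) - d (v i) (p' i)) @[i --> U] --> (0 : R).
Proof.
move=> uv pp inf; pose C := K1 ^+ 2 + K2 ^+ 2 + 2 * K1 * K2 + K1 ^+ 2.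
apply: (lim_inv0 (C := C) inf); apply: filterS (filterI uv pp) => i [/= h1 h2].
(* Applied to both orders of [p] and [p'], [quad] bounds the difference of the two differences of
   squared distances. The plain distances tend to infinity, and dividing by them gives the limit
   0. *)
have q1 := quad HX (u i) (v i) (p i) (p' i).
have q2 := quad HX (u i) (v i) (p' i) (p i).
have l1 := dist_diff (p i) (u i) (v i); have l2 := dist_diff (p' i) (u i) (v i).
have l3 := dist_diff (v i) (p i) (p' i).
move: q1 q2 l1 l2 l3; rewrite !(distC (p' i) (u i)) !(distC (p i) (u i)) !(distC (p' i) (p i)).
rewrite !(distC (p i) (v i)) !(distC (p' i) (v i)).
have := dist_ge0 (u i) (v i); have := dist_ge0 (p i) (p' i).
have := dist_ge0 (v i) (p i); have := dist_ge0 (v i) (p' i).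
move: (d (u i) (p i)) (d (v i) (p i)) (d (u i) (p' i)) (d (v i) (p' i)) (d (u i) (v i))
  (d (p i) (p' i)) h1 h2 => A B A' B' a c h1 h2 B'0 B0 c0 a0 q1 q2.
move=> l1 l2 l3.
have k1 : a ^+ 2 <= K1 ^+ 2 by rewrite ler_sqr ?nnegrE//; exact: le_trans h1.
have k2 : c ^+ 2 <= K2 ^+ 2 by rewrite ler_sqr ?nnegrE//; exact: le_trans h2.
have l1' : `|A - B| <= K1 by exact: le_trans h1.
have l2' : `|A' - B'| <= K1 by exact: le_trans h1.
have l3' : `|B - B'| <= K2 by exact: le_trans h2.
have n1 : `|(B - B') * (A' - B')| <= K2 * K1 by rewrite normrM; apply: ler_pM.
have n2 : (A - B) ^+ 2 <= K1 ^+ 2.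
  by rewrite -[leLHS]real_normK ?num_real//; rewrite ler_sqr ?nnegrE//; apply: le_trans l1'.
have n3 : (A' - B') ^+ 2 <= K1 ^+ 2.
  by rewrite -[leLHS]real_normK ?num_real//; rewrite ler_sqr ?nnegrE//; apply: le_trans l2'.
have n4 := sqr_ge0 (A - B); have n5 := sqr_ge0 (A' - B').
rewrite -[X in _ * X <= _](ger0_norm B0) -normrM ler_norml; move: n1; rewrite ler_norml => /andP[n1 n1'].
have k0 : 0 <= K1 ^+ 2 by apply: sqr_ge0.
have k3 : 0 <= K2 ^+ 2 by apply: sqr_ge0.
have k4 : 0 <= K2 * K1 by apply: mulr_ge0; [exact: le_trans h2|exact: le_trans h1].
by apply/andP; split; rewrite /C; lra.
Qed.

End LimitSets.

Section SystemRestriction.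
Variables (R : realType) (X : metricType R).

Lemma sys_sub (Y Y' : set X) k (b : nat -> X -> R) T : split_sys Y k b T -> Y' `<=` Y ->
  (forall j t y, (j < k)%N -> Y' y -> Y' (T j t y)) -> split_sys Y' k b T.
Proof.
move=> [lT oT] sub inv; split; last by move=> i j t x ik jk ij /sub; exact: oT.
move=> i ik; have lTi := lT i ik; split.
- by move=> t y; exact: inv.
- by move=> t y /sub; exact: (split_coord lTi).
- by move=> t x y /sub Yx /sub; exact: (split_cos lTi).
Qed.

End SystemRestriction.

Section Outer.
Variables (R : realType) (X : metricType R) (Gamma : groupType) (act : Gamma -> X -> X).
Local Notation d := (@mdist R X).
Hypotheses (act_action : group_action act) (act_isometric : isometric act).
Hypotheses (act_pd : properly_discontinuous act) (act_cc : cocompact act).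
Hypothesis HX : proper_hadamard X.
Variable H : set Gamma.
Hypothesis sH : subgroup H.

Let aM g h x : act (g * h)%g x = act g (act h x). Proof. by case: act_action. Qed.
Let aK g x : act g^-1%g (act g x) = x. Proof. exact: actV. Qed.
Let aVK g x : act g (act g^-1%g x) = x. Proof. exact: actVK. Qed.
Let dist_actl g x y : d (act g x) y = d x (act g^-1%g y).
Proof. by rewrite -{1}(aVK g y) act_isometric. Qed.

Let act_mid g x y : act g (mid x y) = mid (act g x) (act g y).
Proof.
by apply: mid_uniq => //; have [m1 m2] := midP HX x y; split; rewrite !act_isometric.
Qed.

(* The twist [theta] arises as a limit of conjugations [g n * h * (g n)^-1], and
   need not be a conjugation. *)
Definition equivariant_sys (theta : Gamma -> Gamma) (Y : set X) k
    (b : nat -> X -> R) (T : nat -> R -> X -> X) :=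
  [/\ (forall g h, H g -> H h -> theta (g * h)%g = (theta g * theta h)%g) /\
      (forall g h, H g -> H h -> theta g = theta h -> g = h),
    Y !=set0 /\ cconvex Y,
    forall h y, H h -> Y y -> Y (act (theta h) y),
    split_sys Y k b T &
    forall h i t y, H h -> (i < k)%N -> Y y ->
      T i t (act (theta h) y) = act (theta h) (T i t y)].

Section OneSystem.
Variables (theta : Gamma -> Gamma) (Y : set X) (k : nat)
  (b : nat -> X -> R) (T : nat -> R -> X -> X).
Hypothesis E : equivariant_sys theta Y k b T.
Variable o : X.
Hypothesis Yo : Y o.

Let thM g h : H g -> H h -> theta (g * h)%g = (theta g * theta h)%g.
Proof. by case: E => -[+ _] _ _ _ _; exact. Qed.
Let thI g h : H g -> H h -> theta g = theta h -> g = h.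
Proof. by case: E => -[_ +] _ _ _ _; exact. Qed.
Let cY : cconvex Y. Proof. by case: E => _ []. Qed.
Let thY h y : H h -> Y y -> Y (act (theta h) y).
Proof. by case: E => _ _ + _ _; exact. Qed.
Let sys : split_sys Y k b T. Proof. by case: E. Qed.
Let thT h i t y : H h -> (i < k)%N -> Y y ->
  T i t (act (theta h) y) = act (theta h) (T i t y).
Proof. by case: E => _ _ _ _; exact. Qed.

Let th1 : theta 1%g = 1%g.
Proof.
have H1 := subgroup1 sH; have := thM H1 H1; rewrite mulg1.
by move=> /(congr1 (fun g => (theta 1%g)^-1 * g)%g); rewrite mulVg mulKg.
Qed.

Let th_coord h i x y : H h -> (i < k)%N -> Y x -> Y y ->
  b i (act (theta h) x) - b i (act (theta h) y) = b i x - b i y.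
Proof.
move=> Hh ik Yx Yy; have lT := sys.1 i ik.
have := split_cos lT 1 (thY Hh Yx) (thY Hh Yy).
by rewrite thT// !act_isometric (split_cos lT)//; lra.
Qed.

Let th_trans h x y : H h -> Y x -> Y y ->
  trans k b (act (theta h) x) (act (theta h) y) = trans k b x y.
Proof.
move=> Hh Yx Yy; rewrite /trans /trans2 act_isometric; congr (Num.sqrt (_ - _)).
by apply: eq_bigr => i _; rewrite th_coord.
Qed.

Definition slice := [set y | Y y /\ forall i, (i < k)%N -> b i y = b i o].
(** The action on the quotient by the translations, represented on the slice through [o]. *)
Definition slice_act h x := level b T k o (act (theta h) x).

Let slice_in y : Y y -> slice (level b T k o y).
Proof.
by move=> Yy; split; [exact: (level_in sys)|move=> i ik; exact: (level_coord sys)].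
Qed.

Let slice_trans x y : slice x -> slice y -> trans k b x y = d x y.
Proof. by move=> [_ h1] [_ h2]; apply: trans_same => i ik; rewrite h1// h2. Qed.

Let slice_eq x y : slice x -> slice y -> trans k b x y <= 0 -> x = y.
Proof. by move=> sx sy; rewrite slice_trans//; exact: dist_eq0. Qed.

Lemma slice_cconvex : cconvex slice.
Proof.
split.
  move=> x y [Yx hx] [Yy hy]; split; first exact: cY.1.
  move=> i ik; rewrite (split_affine (sys.1 i ik) HX cY.1)// hx// hy//; lra.
move=> x H1; have Yx : Y x by apply: cY.2 => e /H1[y [Yy _]]; exists y.
split=> // i ik; apply/eqP; rewrite -subr_eq0 -normr_le0.
apply: (@le0_of_eps R 1) => // e /H1[y [Yy hy] xy]; rewrite -(hy i ik) mul1r.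
by apply: (le_trans (split_lip1 (sys.1 i ik) Yx Yy)); exact: ltW.
Qed.

(** [theta h] preserves the transverse distance, which ignores the correction made by [level] and
    separates the points of a slice. *)
Lemma slice_isom : isom_on H slice slice_act.
Proof.
split.
- by move=> h x Hh [Yx _]; apply: slice_in; exact: thY.
- move=> x sx; have [Yx _] := sx; have [a1 _] := act_action.
  rewrite /slice_act th1 a1; apply: slice_eq => //; first exact: slice_in.
  by rewrite trans_sym (trans_level0 sys).
- move=> g h x Hg Hh sx; have [Yx _] := sx.
  have Hgh := subgroupM sH Hg Hh.
  have Yh : Y (slice_act h x) by have [] := slice_in (thY Hh Yx).
  have Yghx : Y (act (theta g) (act (theta h) x)) by apply: thY => //; exact: thY.
  apply: slice_eq; [exact/slice_in/thY|exact/slice_in/thY|].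
  rewrite /slice_act thM// aM.
  apply: (le_trans (trans_tri sys (slice_in Yghx).1 Yghx (slice_in (thY Hg Yh)).1)).
  rewrite (trans_sym k b (level _ _ _ _ _)) (trans_level0 sys)// add0r.
  apply: (le_trans (trans_tri sys Yghx (thY Hg Yh) (slice_in (thY Hg Yh)).1)).
  rewrite (trans_level0 sys); last exact: thY.
  by rewrite addr0 th_trans// ?(trans_level0 sys)//; exact: thY.
- move=> h x y Hh sx sy; have [[Yx _] [Yy _]] := (sx, sy).
  by rewrite /slice_act -(trans_level sys)// ?th_trans// ?slice_trans//; exact: thY.
Qed.

Lemma slice_in_self : slice o.
Proof. by split. Qed.

Lemma level_act h y : H h -> Y y ->
  level b T k o (act (theta h) y) = slice_act h (level b T k o y).
Proof.
move=> Hh Yy; have [Yl _] := slice_in Yy.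
apply: slice_eq; [exact/slice_in/thY|exact/slice_in/thY|].
rewrite /slice_act -(trans_level0 sys o (thY Hh Yl)).
apply: (le_trans (trans_tri sys (slice_in (thY Hh Yy)).1 (thY Hh Yy) (slice_in (thY Hh Yl)).1)).
rewrite trans_sym (trans_level0 sys) ?add0r; last exact: thY.
apply: (le_trans (trans_tri sys (thY Hh Yy) (thY Hh Yl) (slice_in (thY Hh Yl)).1)).
by rewrite th_trans// (trans_level0 sys)// add0r.
Qed.

(** The part of the displacement along the lines is the same at all points of the slice, so it can
    be read off at [o]. *)
Lemma slice_disp h x : H h -> slice x ->
  d x (act (theta h) x) <= d x (slice_act h x) + d (slice_act h o) (act (theta h) o).
Proof.
move=> Hh [Yx hx]; have key y : slice y -> d (slice_act h y) (act (theta h) y) ^+ 2 =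
    \sum_(i < k) (b i o - b i (act (theta h) o)) ^+ 2.
  move=> [Yy hy]; have Yt := thY Hh Yy; have [Yl hl] := slice_in Yt.
  have := trans_level0 sys o Yt.
  rewrite trans_sym => /(congr1 (fun a => a ^+ 2)); rewrite (sqr_trans sys)// expr0n /trans2.
  move/eqP; rewrite subr_eq0 => /eqP ->; apply: eq_bigr => i _.
  by rewrite hl//; have := th_coord Hh (ltn_ord i) Yy Yo; rewrite hy// subrr => /eqP;
    rewrite subr_eq0 => /eqP ->.
have <- : d (slice_act h x) (act (theta h) x) = d (slice_act h o) (act (theta h) o).
  by apply: sqr_dist_eq; rewrite !key//; exact: slice_in_self.
exact: dist_tri.
Qed.

Section Escape.
Variables (x : nat -> X) (M : Gamma -> R) (D : R) (gam : nat -> Gamma).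
Hypotheses (sx : forall n, slice (x n)) (xinf : forall n, n%:R < d o (x n)).
Hypothesis xM : forall h n, H h -> d (x n) (act (theta h) (x n)) <= M h.
Hypothesis oM : forall h, H h -> d o (act (theta h) o) <= M h.
Let z n := mid o (x n).
Hypothesis zD : forall n, d (act (gam n) (z n)) o <= D.
Variable U : set_system nat.
Hypotheses (UU : UltraFilter U) (Un : forall n, U [set k | (n <= k)%N]).

(** After recentring by [gam n], the points [p n] and [q n] are the ends of a segment whose midpoint
    [ze n] stays within [D] of [o]. *)
Let p n := act (gam n) (x n).
Let q n := act (gam n) o.
Let ze n := act (gam n) (z n).
Let th n h := (gam n * theta h * (gam n)^-1)%g.
Let Ys n := [set y | Y (act (gam n)^-1%g y)].

Let UT (P : nat -> Prop) : (forall n, P n) -> U [set n | P n].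
Proof. by move=> PT; apply: filterS filterT => n _; exact: PT. Qed.

Let sz n : slice (z n).
Proof. by apply: slice_cconvex.1; [exact: slice_in_self|exact: sx]. Qed.

Let Yze n : Ys n (ze n). Proof. by rewrite /Ys /= aK; have [] := sz n. Qed.
Let zM h n : H h -> d (z n) (act (theta h) (z n)) <= M h.
Proof.
move=> Hh; rewrite /z act_mid; apply: (le_trans (dist_mid_mid HX _ _ _ _)).
by have := xM n Hh; have := oM Hh; rlra.
Qed.

Let dist_th h n y : d (act (gam n) y) (act (th n h) (act (gam n) y)) = d y (act (theta h) y).
Proof. by rewrite /th !aM aK act_isometric. Qed.

Let cYs n : cconvex (Ys n).
Proof.
split; first by move=> u v Yu Yv; rewrite /Ys /= act_mid; exact: cY.1.
move=> u H1; apply: cY.2 => e /H1[v Yv uv]; exists (act (gam n)^-1%g v) => //.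
by rewrite act_isometric.
Qed.

Let Ysne n : Ys n !=set0. Proof. by exists (ze n). Qed.

Let thYs n h u : H h -> Ys n u -> Ys n (act (th n h) u).
Proof. by move=> Hh Yu; rewrite /Ys /= /th !aM aK; exact: thY. Qed.

Let zeD : U [set n | d o (ze n) <= D].
Proof. by apply: UT => n; rewrite distC; exact: zD. Qed.

(** [th n h] moves [ze n] by at most [M h], hence [o] by at most [D + M h + D]; only finitely many
    elements do so. *)
Let theta_limit : exists th' : Gamma -> Gamma, forall h, H h -> U [set n | th n h = th' h].
Proof.
suff /choice[th' th'P] : forall h, exists g, H h -> U [set n | th n h = g] by exists th'.
move=> h; have [Hh|nH] := pselect (H h); last by exists 1%g.
have fin := finite_displacement act_action act_pd HX o (D + M h + D).
have [|g _ gP] := @ultra_finite _ _ U (fun n => th n h) _ UU fin; last by exists g.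
apply: UT => n /=.
have := dist_tri (act (th n h) (ze n)) (act (th n h) o) o.
have := dist_tri (ze n) (act (th n h) (ze n)) o.
rewrite act_isometric (distC _ (ze n)) dist_th; have := zM n Hh; have := zD n.
by rewrite -/(ze n) (distC o); rlra.
Qed.

Let sysn n : split_sys (Ys n) k (fun j => b j \o act (gam n)^-1%g)
  (fun j t => act (gam n) \o T j t \o act (gam n)^-1%g).
Proof.
apply: (@sys_conj R X Y (Ys n) k b T (act (gam n)) (act (gam n)^-1%g)) => //.
by move=> y Yy; rewrite /Ys /= aK.
Qed.

Let L_inf (K : R) : U [set n | K < d o (x n) / 2].
Proof.
apply: filterS (Un (Num.bound (2 * `|K|))) => n /= nb.
have := archi_boundP (mulr_ge0 (ler0n _ 2) (normr_ge0 K)) : 2 * `|K| < _.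
have : (Num.bound (2 * `|K|))%:R <= n%:R :> R by rewrite ler_nat.
by have := xinf n; have := ler_norm K; rlra.
Qed.

Let dzep n : d (ze n) (p n) = d o (x n) / 2.
Proof. by rewrite act_isometric dist_midr. Qed.
Let dzeq n : d (ze n) (q n) = d o (x n) / 2.
Proof. by rewrite act_isometric distC dist_midl. Qed.
Let dpq n : d (p n) (q n) = d o (x n).
Proof. by rewrite act_isometric distC. Qed.

Let net_bound u y : d (u n) y @[n --> U] --> (0 : R) -> U [set n | d (u n) (ze n) <= 1 + d y o + D].
Proof.
move=> uy; apply: filterS (filterI ((net_cvgP UU _ _).1 uy _ ltr01) zeD) => n [/= h1 h2].
by have := dist_tri y (u n) (ze n); have := dist_tri o y (ze n); rlra.
Qed.

Section Busemann.
(** Treats both ends at once: [r] is [p] with [w = x], or [q] with [w] constantly [o]. *)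
Variables (r : nat -> X) (w : nat -> X) (br : X -> R).
Hypotheses (rE : forall n, r n = act (gam n) (w n)) (sw : forall n, slice (w n)).
Hypothesis wM : forall h n, H h -> d (w n) (act (theta h) (w n)) <= M h.
Hypothesis dzer : forall n, d (ze n) (r n) = d o (x n) / 2.
Hypothesis brP : forall u y, (forall n, Ys n (u n)) -> d (u n) y @[n --> U] --> (0 : R) ->
  d (u n) (r n) - d (ze n) (r n) @[n --> U] --> br y.

Let r_inf u y : d (u n) y @[n --> U] --> (0 : R) -> forall K : R, U [set n | K < d (u n) (r n)].
Proof.
move=> uy K; apply: filterS (filterI (net_bound uy) (L_inf (K + (1 + d y o + D)))) => n [/= h1 h2].
by have := dist_tri (u n) (ze n) (r n); rewrite dzer (distC (ze n)); rlra.
Qed.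

Lemma busemann_convex : mid_convex (limit_set U Ys) br.
Proof.
move=> y y' [u Yu uy] [v Yv vy].
have [m1 m2] : limit_set U Ys (mid y y') /\
    d (mid (u n) (v n)) (mid y y') @[n --> U] --> (0 : R).
  split; first by apply: (limit_set_cconvex HX UU Ysne cYs).1; [exists u|exists v].
  have := lim_add UU uy vy; rewrite addr0; apply: squeeze0.
  apply: UT => n /=; rewrite dist_ge0 /=.
  have := dist_mid_mid HX (u n) (v n) y y'; have := dist_ge0 (u n) y.
  by have := dist_ge0 (v n) y'; rlra.
have Ym n : Ys n (mid (u n) (v n)) by exact: (cYs n).1.
have -> : (br y + br y') / 2 = 2^-1 * (br y + br y') by rewrite mulrC.
apply: (lim_le UU (brP Ym m2) (lim_scale UU (c := 2^-1) (lim_add UU (brP Yu uy) (brP Yv vy)))).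
by apply: UT => n /=; have := @dist_convex R X HX setT (r n) (u n) (v n) I I; rlra.
Qed.

(** Moving the arguments by [th n h] amounts to moving [r n] by the inverse, a bounded amount, which
    [horofunction_shift] absorbs. *)
Lemma busemann_quasi_inv th' h y y' : H h -> U [set n | th n h = th' h] ->
  limit_set U Ys y -> limit_set U Ys y' ->
  [/\ limit_set U Ys (act (th' h) y), limit_set U Ys (act (th' h) y') &
  br (act (th' h) y) - br (act (th' h) y') = br y - br y'].
Proof.
move=> Hh thh [u Yu uy] [v Yv vy].
have key u0 y0 : d (u0 n) y0 @[n --> U] --> (0 : R) ->
    d (act (th n h) (u0 n)) (act (th' h) y0) @[n --> U] --> (0 : R).
  by move=> uy0; apply: lim_eq uy0 => //; apply: filterS thh => n /= ->; rewrite act_isometric.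
have Yu' n : Ys n (act (th n h) (u n)) by exact: thYs.
have Yv' n : Ys n (act (th n h) (v n)) by exact: thYs.
split.
- by exists (fun n => act (th n h) (u n)) => //; exact: key.
- by exists (fun n => act (th n h) (v n)) => //; exact: key.
have c1 := lim_sub UU (brP Yu' (key _ _ uy)) (brP Yv' (key _ _ vy)).
have c2 := lim_sub UU (brP Yu uy) (brP Yv vy).
apply/eqP; rewrite eq_sym -subr_eq0; apply/eqP.
apply: (real_cvg_unique UU (lim_sub UU c2 c1)).
have h1 : U [set n | d (u n) (v n) <= 1 + d y o + D + (1 + d y' o + D)].
  apply: filterS (filterI (net_bound uy) (net_bound vy)) => n [/= h1 h2].
  by have := dist_tri (ze n) (u n) (v n); rewrite (distC (ze n)); rlra.
have h2 : U [set n | d (r n) (act (th n h)^-1%g (r n)) <= M h].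
  by apply: UT => n /=; rewrite distC dist_actl invgK rE dist_th; exact: wM.
apply: lim_eq (horofunction_shift HX UU h1 h2 (r_inf vy)) => //; apply: UT => n /=.
by rewrite !dist_actl; ring.
Qed.

(** [r n] and [ze n] have the same [j]-th coordinate, so the translation changes the squared
    distance to [r n] by a bounded amount; the distance itself tends to infinity. *)
Lemma busemann_level (T' : nat -> R -> X -> X) j t y : (j < k)%N -> limit_set U Ys y ->
  (forall u, (forall n, Ys n (u n)) -> d (u n) y @[n --> U] --> (0 : R) ->
   d ((act (gam n) \o T j t \o act (gam n)^-1%g) (u n)) (T' j t y) @[n --> U] --> (0 : R)) ->
  br (T' j t y) = br y.
Proof.
move=> jk [u Yu uy] /(_ u Yu uy) Tu.
have sj n := (sysn n).1 j jk.
set Tn := fun n => (act (gam n) \o T j t \o act (gam n)^-1%g) (u n).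
have YT n : Ys n (Tn n) by exact: (split_in (sj n)).
apply/eqP; rewrite -subr_eq0; apply/eqP.
apply: (real_cvg_unique UU (lim_sub UU (brP YT Tu) (brP Yu uy))).
pose C := t ^+ 2 + 2 * `|t| * (1 + d y o + D).
apply: (@lim_inv0 R nat U UU (fun n => d (u n) (r n)) C); first exact: r_inf uy.
apply: filterS (net_bound uy) => n /= h1.
have -> : d (Tn n) (r n) - d (ze n) (r n) - (d (u n) (r n) - d (ze n) (r n)) =
  d (Tn n) (r n) - d (u n) (r n) by ring.
have Yr : Ys n (r n) by rewrite /Ys /= rE aK; have [] := sw n.
have := split_cos (sj n) t Yr (Yu n); rewrite /= -/(Tn n).
have -> : b j (act (gam n)^-1%g (r n)) = b j (act (gam n)^-1%g (ze n)).
  by rewrite rE !aK; have [_ ->//] := sw n; have [_ ->//] := sz n.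
have := split_lip1 (sj n) (Yze n) (Yu n); rewrite /= (distC (ze n)) !(distC (r n)).
rewrite -[d (act _ _) (r n)]/(d (Tn n) (r n)).
move: (b j _ - b j _) => be l1 e1.
have A0 := dist_ge0 (Tn n) (r n); have B0 := dist_ge0 (u n) (r n).
have l2 : `|be| <= 1 + d y o + D by exact: le_trans h1.
have : `|t * be| <= `|t| * (1 + d y o + D) by rewrite normrM ler_wpM2l.
move: e1 A0 B0; move: (d (Tn n) (r n)) (d (u n) (r n)) => A B e1 A0 B0 l3.
have e2 : (A - B) * (A + B) = t ^+ 2 - 2 * (t * be) by lra.
have l4 : `|(A - B) * (A + B)| <= C.
  rewrite e2 /C; apply: (le_trans (ler_normB _ _)).
  rewrite (ger0_norm (sqr_ge0 t)) lerD2l normrM (ger0_norm (ler0n _ 2)).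
  by rewrite -mulrA ler_pM2l.
apply: le_trans l4; rewrite normrM ler_wpM2l//.
by rewrite ger0_norm; lra.
Qed.

Lemma busemann_ray t y : 0 <= t -> limit_set U Ys y ->
  exists y', [/\ limit_set U Ys y', d y y' <= t & br y' <= br y - t].
Proof.
move=> t0 [u Yu uy].
have /choice[eta etaP] : forall n, exists v, Ys n v /\ (t < d (u n) (r n) ->
    d (u n) v = t /\ d v (r n) = d (u n) (r n) - t).
  move=> n; have [tn|_] := ltrP t (d (u n) (r n)); last by exists (u n).
  have [|v [v1 v2]] := hadamard_between HX (x := u n) (y := r n) (t := t).
    by rewrite t0 ltW.
  exists v; split=> //.
  have Yr : Ys n (r n) by rewrite /Ys /= rE aK; have [] := sw n.
  by apply: (between_in HX (cYs n) (Yu n) Yr); rewrite v1 v2; lra.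
have Ye n : Ys n (eta n) by have [] := etaP n.
have ue : U [set n | d (u n) (eta n) <= t].
  by apply: filterS (r_inf uy t) => n /=; have [_ H1] := etaP n; move=> /H1[-> _].
have [|y' y'P] := hadamard_net HX UU (o := y) (u := eta) (M := 1 + t).
  apply: filterS (filterI ((net_cvgP UU _ _).1 uy _ ltr01) ue) => n [/= h1 h2].
  by have := dist_tri (u n) y (eta n); rewrite (distC y (u n)); rlra.
exists y'; split; first by exists eta.
  exact: (lim_le UU (dist_cvg UU uy y'P) (lim_const UU t)).
apply: (lim_le UU (brP Ye y'P) (lim_sub UU (brP Yu uy) (lim_const UU t))).
by apply: filterS (r_inf uy t) => n /=; have [_ H1] := etaP n; move=> /H1[_ ->]; lra.
Qed.

End Busemann.

(* The points at which the Busemann functions of the two ends of the limit line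
   add up to zero form a convex set which splits off this line. *)
Lemma escape_split : exists th' Y' b' T', equivariant_sys th' Y' k.+1 b' T'.
Proof.
have [th' th'P] := theta_limit.
have [b' [T' [sys' sysP]]] := @sys_limit R X HX nat U UU Ys ze o D Yze zeD k _ _ sysn.
have lipr (r : nat -> X) n : lip1 (Ys n) (d ^~ (r n)) by exact: lip1_dist.
have [bp lbp bpP] := @lip_limit R X nat U UU Ys ze o D Yze zeD _ (lipr p).
have [bm lbm bmP] := @lip_limit R X nat U UU Ys ze o D Yze zeD _ (lipr q).
have pE n : p n = act (gam n) (x n) by [].
have qE n : q n = act (gam n) ((fun=> o) n) by [].
have so n : slice ((fun _ : nat => o) n) by exact: slice_in_self.
have oM' h (n : nat) : H h -> d o (act (theta h) o) <= M h by exact: oM.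
pose L := limit_set U Ys.
have cL : cconvex L := limit_set_cconvex HX UU Ysne cYs.
have [zeta zetaP] := hadamard_net HX UU zeD.
have Lzeta : L zeta by exists ze.
have cbp : mid_convex L bp := busemann_convex bpP.
have cbm : mid_convex L bm := busemann_convex bmP.
pose s y := bp y + bm y.
have s_ge0 y : L y -> 0 <= s y.
  move=> [u Yu uy]; apply: (lim_le UU (lim_const UU 0) (lim_add UU (bpP _ _ Yu uy) (bmP _ _ Yu uy))).
  apply: UT => n /=; rewrite dzep dzeq; have := dist_tri (u n) (p n) (q n).
  by rewrite dpq (distC (p n)); rlra.
have s_zeta : s zeta = 0.
  have c := lim_add UU (bpP _ _ Yze zetaP) (bmP _ _ Yze zetaP).
  apply: (real_cvg_unique UU c); apply: lim_eq (lim_const UU 0) => //; apply: UT => n /=.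
  by rewrite !subrr addr0.
(* The factor one half makes the sum of two 1-Lipschitz functions 1-Lipschitz, as [sublevel_cconvex]
   asks. *)
pose W := L `&` [set y | s y / 2 <= 0].
have cW : cconvex W.
  apply: sublevel_cconvex => //.
    by move=> y y' Ly Ly'; have := cbp _ _ Ly Ly'; have := cbm _ _ Ly Ly'; rewrite /s; rlra.
  move=> y y' Ly Ly'; have := lbp _ _ Ly Ly'; have := lbm _ _ Ly Ly'.
  by rewrite /s !ler_norml => /andP[? ?] /andP[? ?]; apply/andP; split; lra.
have WL : W `<=` L by move=> y [].
have Ws y : W y -> s y = 0.
  by move=> [Ly /= sy]; apply/le_anti; rewrite s_ge0// andbT; lra.
have sW y : L y -> s y <= 0 -> W y by move=> Ly sy; split => //=; lra.
have Wzeta : W zeta by apply: sW; rewrite ?s_zeta.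
have qip h y y' (Hh : H h) := @busemann_quasi_inv p x bp pE xM dzep bpP th' h y y' Hh (th'P h Hh).
have qim h y y' (Hh : H h) := @busemann_quasi_inv q (fun=> o) bm qE oM' dzeq bmP th' h y y' Hh (th'P h Hh).
have thM' g h : H g -> H h -> th' (g * h)%g = (th' g * th' h)%g.
  move=> Hg Hh; have Hgh := subgroupM sH Hg Hh.
  have [n [/= [+ <-] <-]] := ultra_ex UU (filterI (filterI (th'P _ Hgh) (th'P _ Hg)) (th'P _ Hh)).
  by move=> <-; rewrite /th thM// !mulgA mulgVK.
have thI' g h : H g -> H h -> th' g = th' h -> g = h.
  move=> Hg Hh gh; have [n [/= e1 e2]] := ultra_ex UU (filterI (th'P _ Hg) (th'P _ Hh)).
  apply: thI => //; move: gh; rewrite -e1 -e2 /th.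
  by move=> /mulIg/mulgI.
have act1 y : act 1%g y = y by case: act_action.
have th'1 : th' 1%g = 1%g.
  have H1 := subgroup1 sH; have := thM' _ _ H1 H1; rewrite mulg1.
  by move=> /(congr1 (fun g => (th' 1%g)^-1 * g)%g); rewrite mulVg mulKg.
have th'L h y : H h -> L y -> L (act (th' h) y).
  by move=> Hh Ly; have [] := qip h y y Hh Ly Ly.
have sq h y : H h -> L y -> s (act (th' h) y) = s y + s (act (th' h) zeta).
  move=> Hh Ly; have [_ _] := qip h y zeta Hh Ly Lzeta.
  have [_ _] := qim h y zeta Hh Ly Lzeta.
  by move: s_zeta; rewrite /s; lra.
(* [h] shifts [s] by the constant [s (act (th' h) zeta) >= 0]; the shifts of [h] and [h^-1] add up
   to zero. *)
have s_inv h y : H h -> L y -> s (act (th' h) y) = s y.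
  move=> Hh Ly; have Hh' := subgroupV sH Hh.
  have k1 := s_ge0 _ (th'L h _ Hh Lzeta); have k2 := s_ge0 _ (th'L _ _ Hh' Lzeta).
  have := sq _ _ Hh (th'L _ _ Hh' Lzeta); rewrite -aM -thM'// mulgV th'1 act1 s_zeta => k3.
  by rewrite sq//; lra.
have lvl_p j t y : (j < k)%N -> L y -> bp (T' j t y) = bp y.
  move=> jk Ly; apply: (busemann_level pE sx dzep bpP jk Ly) => u Yu uy.
  by have [_] := sysP u y Yu uy j jk; exact.
have lvl_m j t y : (j < k)%N -> L y -> bm (T' j t y) = bm y.
  move=> jk Ly; apply: (busemann_level qE so dzeq bmP jk Ly) => u Yu uy.
  by have [_] := sysP u y Yu uy j jk; exact.
have sysW : split_sys W k b' T'.
  apply: (sys_sub sys' WL) => j t y jk Wy; apply: sW.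
    by apply: (split_in (sys'.1 j jk)); exact: WL.
  by rewrite /s lvl_p ?lvl_m//; [have := Ws y Wy; rewrite /s => ->|exact: WL|exact: WL].
have bpm y : W y -> bm y = - bp y by move=> /Ws; rewrite /s; rlra.
have abp : mid_affine W bp.
  move=> y y' Wy Wy'; have Wm := cW.1 _ _ Wy Wy'; apply/le_anti.
  have := cbp _ _ (WL _ Wy) (WL _ Wy'); have := cbm _ _ (WL _ Wy) (WL _ Wy').
  by rewrite !bpm// => ? ?; apply/andP; split; lra.
have raysW t y : W y -> exists y', [/\ W y', d y y' <= `|t| & bp y' = bp y - t].
  move=> Wy; have Ly := WL _ Wy; have [t0|t0] := lerP 0 t.
    (* Along this ray [bp] drops by [t] while [bm] grows by at most [t], so the ray stays in [W]. *)
    have [y' [Ly' yy' by']] := busemann_ray pE sx dzep bpP t0 Ly.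
    have := lbm _ _ Ly' Ly; rewrite (distC y') ler_norml => /andP[_ m'].
    have Wy' : W y' by apply: sW => //; have := Ws _ Wy; rewrite /s; rlra.
    exists y'; split=> //; first by rewrite ger0_norm.
    have := bpm _ Wy; have := bpm _ Wy' => h1 h2.
    by apply/le_anti/andP; split; lra.
  have [|y' [Ly' yy' by']] := busemann_ray qE so dzeq bmP (t := - t) _ Ly.
    by rewrite oppr_ge0 ltW.
  have := lbp _ _ Ly' Ly; rewrite (distC y') ler_norml => /andP[_ m'].
  have Wy' : W y' by apply: sW => //; have := Ws _ Wy; rewrite /s; rlra.
  exists y'; split=> //; first by rewrite ltr0_norm.
  have := bpm _ Wy; have := bpm _ Wy' => h1 h2.
  by apply/le_anti/andP; split; lra.
have [T1 lT1] := affine_line_split HX cW.1 abp (lip1_sub WL lbp) raysW.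
exists th', W, (fun i => if (i < k)%N then b' i else fun y => - bp y).
exists (fun i => if (i < k)%N then T' i else T1); split.
- by split.
- by split => //; exists zeta.
- by move=> h y Hh Wy; apply: sW; [apply: th'L => //; exact: WL|rewrite s_inv ?Ws//; exact: WL].
- by apply: sys_extend => // i t y ik Wy; rewrite lvl_p//; exact: WL.
move=> h i t y Hh _ Wy; have Ly := WL _ Wy.
case: ltnP => [ik|_].
  have [u Yu uy] := Ly.
  have thu v w : d (v n) w @[n --> U] --> (0 : R) ->
      d (act (th n h) (v n)) (act (th' h) w) @[n --> U] --> (0 : R).
    by move=> vw; apply: lim_eq vw => //; apply: filterS (th'P h Hh) => n /= ->; rewrite act_isometric.
  have [_ /(_ t) Tu] := sysP u y Yu uy i ik.
  have [_ /(_ t) Tthu] := sysP _ _ (fun n => thYs Hh (Yu n)) (thu _ _ uy) i ik.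
  apply: (net_unique UU Tthu); apply: lim_eq (thu _ _ Tu) => //; apply: UT => n /=.
  by rewrite /th !aM !aK thT//; exact: Yu.
have Wth : W (act (th' h) y).
  by apply: sW; [exact: th'L|rewrite s_inv ?Ws].
have WT : W (T1 t y) by exact: (split_in lT1).
have WthT : W (act (th' h) (T1 t y)).
  by apply: sW; [apply: th'L => //; exact: WL|rewrite s_inv ?Ws//; exact: WL].
(* The image of [T1 t y] has the distance and the coordinate that characterize the translate of the
   image of [y]. *)
apply/esym/(split_uniq lT1 Wth WthT).
  by rewrite act_isometric (split_disp lT1).
have [_ _] := qip h (T1 t y) y Hh (WL _ WT) Ly; have := split_coord lT1 t Wy; lra.
Qed.

End Escape.

Lemma no_escape_or_split : no_escape H slice slice_act o \/
  exists th' Y' b' T', equivariant_sys th' Y' k.+1 b' T'.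
Proof.
have [|esc] := pselect (no_escape H slice slice_act o); first by left.
right; move: esc => /existsNP[M /forallNP M'].
have /choice[x xP] : forall n : nat, exists x, [/\ slice x,
    forall h, H h -> d x (slice_act h x) <= M h & n%:R < d o x].
  move=> n; apply: contrapT => no; apply: (M' n%:R) => x sx xM.
  by rewrite leNgt; apply/negP => nx; apply: no; exists x.
have [D DP] := cocompact_dist act_action act_cc o.
have /choice[gam gamP] : forall n, exists g, d (act g (mid o (x n))) o <= D.
  by move=> n; exact: DP.
have [U UU Un] := nat_ultra.
(* [slice_disp] turns the transverse bound into one on the true displacement of [x n]; the maximum
   also covers [o]. *)
pose M1 h := Num.max (M h + d (slice_act h o) (act (theta h) o)) (d o (act (theta h) o)).
apply: (@escape_split x M1 D gam _ _ _ _ gamP U UU Un).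
- by move=> n; have [] := xP n.
- by move=> n; have [] := xP n.
- move=> h n Hh; have [sx xM _] := xP n; rewrite le_max; apply/orP; left.
  by apply: (le_trans (slice_disp Hh sx)); rewrite lerD2r; exact: xM.
- by move=> h Hh; rewrite le_max lexx orbT.
Qed.

End OneSystem.

(** A group element brings a point of [Y] within [D] of [o] and carries the system along, so
    [sys_bound] is uniform in [Y]. *)
Lemma maximal_equivariant_sys (o : X) : exists theta Y k b T y,
  [/\ equivariant_sys theta Y k b T, Y y & no_escape H (slice Y k b y) (slice_act theta k b T y) y].
Proof.
have [D DP] := cocompact_dist act_action act_cc o.
have [N NP] := sys_bound HX o D.
have [|k [th [Y [b [T E]]]]|k [[th [Y [b [T E]]]] max]] := @maximal_nat
   (fun k => exists th Y b T, equivariant_sys th Y k b T) N.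
- exists id, setT, (fun _ _ => 0), (fun _ _ x => x); split => //.
  by split; [exists o|split].
- have [_ [[y Yy] cY] _ sys _] := E; have [g gy] := DP y.
  have sys' := @sys_conj R X Y [set z | Y (act g^-1%g z)] k b T (act g) (act g^-1%g).
  apply: (NP _ _ _ _ (act g y) (sys' _ _ _ _ _ sys)) => //=.
  + by move=> z Yz; rewrite aK.
  + by rewrite aK.
  + by rewrite distC.
have [_ [[y Yy] cY] _ _ _] := E.
exists th, Y, k, b, T, y; split=> //.
by have [//|] := no_escape_or_split E Yy.
Qed.

End Outer.

(** * Discrete groups of Euclidean isometries *)

Section MatrixNorm.
Variable R : realType.

Definition mdot m n (A B : 'M[R]_(m, n)) := \tr (A *m B^T).
Definition mnorm m n (A : 'M[R]_(m, n)) := Num.sqrt (mdot A A).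

Lemma mdotE m n (A B : 'M[R]_(m, n)) : mdot A B = \sum_i \sum_j A i j * B i j.
Proof.
rewrite /mdot /mxtrace; apply: eq_bigr => i _; rewrite mxE.
by apply: eq_bigr => j _; rewrite mxE.
Qed.

Lemma mdotC m n (A B : 'M[R]_(m, n)) : mdot A B = mdot B A.
Proof. by rewrite /mdot -mxtrace_tr trmx_mul trmxK. Qed.

Lemma mdotDl m n (A B C : 'M[R]_(m, n)) : mdot (A + B) C = mdot A C + mdot B C.
Proof. by rewrite /mdot mulmxDl raddfD. Qed.

Lemma mdotZl m n a (A B : 'M[R]_(m, n)) : mdot (a *: A) B = a * mdot A B.
Proof. by rewrite /mdot -scalemxAl linearZ. Qed.

Lemma mdotNl m n (A B : 'M[R]_(m, n)) : mdot (- A) B = - mdot A B.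
Proof. by rewrite -scaleN1r mdotZl mulN1r. Qed.

Lemma mdotDr m n (A B C : 'M[R]_(m, n)) : mdot C (A + B) = mdot C A + mdot C B.
Proof. by rewrite mdotC mdotDl !(mdotC C). Qed.

Lemma mdotZr m n a (A B : 'M[R]_(m, n)) : mdot B (a *: A) = a * mdot B A.
Proof. by rewrite mdotC mdotZl (mdotC B). Qed.

Lemma mdotNr m n (A B : 'M[R]_(m, n)) : mdot A (- B) = - mdot A B.
Proof. by rewrite mdotC mdotNl mdotC. Qed.

Lemma mdot_ge0 m n (A : 'M[R]_(m, n)) : 0 <= mdot A A.
Proof.
by rewrite mdotE; apply: sumr_ge0 => i _; apply: sumr_ge0 => j _; rewrite -expr2 sqr_ge0.
Qed.

Lemma mdot_eq0 m n (A : 'M[R]_(m, n)) : mdot A A = 0 -> A = 0.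
Proof.
rewrite mdotE => /eqP; rewrite psumr_eq0; last first.
  by move=> i _; apply: sumr_ge0 => j _; rewrite -expr2 sqr_ge0.
move=> /allP H; apply/matrixP => i j; rewrite mxE.
have := H i (mem_index_enum _); rewrite psumr_eq0; last first.
  by move=> k _; rewrite -expr2 sqr_ge0.
by move=> /allP/(_ j (mem_index_enum _)) /=; rewrite -expr2 sqrf_eq0 => /eqP.
Qed.

Lemma sqr_mnorm m n (A : 'M[R]_(m, n)) : mnorm A ^+ 2 = mdot A A.
Proof. by rewrite sqr_sqrtr// mdot_ge0. Qed.

Lemma mnorm_ge0 m n (A : 'M[R]_(m, n)) : 0 <= mnorm A.
Proof. exact: sqrtr_ge0. Qed.

Lemma mnorm_eq0 m n (A : 'M[R]_(m, n)) : mnorm A <= 0 -> A = 0.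
Proof.
move=> A0; apply: mdot_eq0; rewrite -sqr_mnorm.
have -> : mnorm A = 0 by apply/le_anti; rewrite A0 mnorm_ge0.
by rewrite expr0n.
Qed.

Lemma mdot_CS m n (A B : 'M[R]_(m, n)) : mdot A B ^+ 2 <= mdot A A * mdot B B.
Proof.
have := mdot_ge0 B; rewrite le_eqVlt => /orP[/eqP/esym B0|B0].
  by rewrite (mdot_eq0 B0) -[0 : 'M_(_, _)](scale0r A) !mdotZr !mul0r expr0n mulr0.
have := mdot_ge0 (mdot B B *: A - mdot A B *: B).
rewrite !(mdotDl, mdotDr, mdotZl, mdotZr, mdotNl, mdotNr) (mdotC B A).
move: (mdot A A) (mdot A B) (mdot B B) B0 => a b c c0 h.
by rewrite -(ler_pM2l c0); lra.
Qed.

Lemma mdot_le m n (A B : 'M[R]_(m, n)) : mdot A B <= mnorm A * mnorm B.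
Proof.
apply: ler_of_sqr; first by rewrite mulr_ge0 ?mnorm_ge0.
by rewrite exprMn !sqr_mnorm mdot_CS.
Qed.

Lemma mnormD m n (A B : 'M[R]_(m, n)) : mnorm (A + B) <= mnorm A + mnorm B.
Proof.
apply: ler_of_sqr; first by rewrite addr_ge0 ?mnorm_ge0.
rewrite sqr_mnorm mdotDl !mdotDr (mdotC B A); have := mdot_le A B.
have := sqr_mnorm A; have := sqr_mnorm B; rnra.
Qed.

Lemma mnormN m n (A : 'M[R]_(m, n)) : mnorm (- A) = mnorm A.
Proof. by rewrite /mnorm mdotNl mdotNr opprK. Qed.

Lemma mnormB m n (A B : 'M[R]_(m, n)) : mnorm (A - B) <= mnorm A + mnorm B.
Proof. by apply: (le_trans (mnormD _ _)); rewrite mnormN. Qed.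

Lemma mnorm0 m n : mnorm (0 : 'M[R]_(m, n)) = 0.
Proof. by rewrite /mnorm -[0 : 'M_(_, _)](scale0r 0) mdotZl mul0r sqrtr0. Qed.

Lemma mnormZ m n a (A : 'M[R]_(m, n)) : mnorm (a *: A) = `|a| * mnorm A.
Proof.
by rewrite /mnorm mdotZl mdotZr mulrA -expr2 sqrtrM ?sqr_ge0// sqrtr_sqr.
Qed.

Lemma mnorm_sum m n (J : Type) (s : seq J) (F : J -> 'M[R]_(m, n)) :
  mnorm (\sum_(j <- s) F j) <= \sum_(j <- s) mnorm (F j).
Proof.
elim: s => [|j s IH]; first by rewrite !big_nil mnorm0.
by rewrite !big_cons; apply: (le_trans (mnormD _ _)); rewrite lerD2l.
Qed.

Lemma mnormM m n p (A : 'M[R]_(m, n)) (B : 'M[R]_(n, p)) :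
  mnorm (A *m B) <= mnorm A * mnorm B.
Proof.
apply: ler_of_sqr; first by rewrite mulr_ge0 ?mnorm_ge0.
rewrite exprMn !sqr_mnorm !mdotE [X in _ * X]exchange_big /= mulr_suml.
apply: ler_sum => i _; rewrite mulr_sumr; apply: ler_sum => j _.
have := mdot_CS (row i A) (row j B^T).
rewrite !mdotE !big_ord1 mxE expr2; congr (_ * _ <= _ * _).
- by apply: eq_bigr => k _; rewrite !mxE.
- by apply: eq_bigr => k _; rewrite !mxE.
- by apply: eq_bigr => k _; rewrite !mxE.
- by apply: eq_bigr => k _; rewrite !mxE.
Qed.

Lemma mnorm_orthr m n (A : 'M[R]_(m, n)) (C : 'M[R]_n) : C *m C^T = 1%:M ->
  mnorm (A *m C) = mnorm A.
Proof.
move=> oC; rewrite /mnorm /mdot trmx_mul mulmxA -(mulmxA A) oC mulmx1 //.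
Qed.

Lemma mnorm_orthl m n (A : 'M[R]_(m, n)) (C : 'M[R]_m) : C *m C^T = 1%:M ->
  mnorm (C *m A) = mnorm A.
Proof.
move=> /mulmx1C oC; rewrite /mnorm /mdot trmx_mul mulmxA mxtrace_mulC !mulmxA oC mul1mx //.
Qed.

(** Normalized to fix 0, the map preserves inner products; expressing coordinates as products with
    the images of the basis shows that [C^T] inverts it. *)
Lemma isometry_affine n (f : 'rV[R]_n -> 'rV[R]_n) :
  (forall u v, mnorm (f u - f v) = mnorm (u - v)) ->
  exists2 C : 'M[R]_n, C *m C^T = 1%:M & forall v, f v = v *m C + f 0.
Proof.
move=> fI; have [g gE] : exists g, forall v, g v = f v - f 0 by exists (fun v => f v - f 0).
have gI u v : mdot (g u - g v) (g u - g v) = mdot (u - v) (u - v).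
  by rewrite -!sqr_mnorm !gE -(fI u v); congr (mnorm _ ^+ 2); rewrite opprB addrA subrK.
have g0 v : mdot (g v) (g v) = mdot v v.
  by have := gI v 0; rewrite (gE 0) subrr !subr0.
have gdot u v : mdot (g u) (g v) = mdot u v.
  have := gI u v; rewrite !(mdotDl, mdotDr, mdotNl, mdotNr) !g0.
  by rewrite (mdotC (g v)) (mdotC v); lra.
pose e (i : 'I_n) : 'rV[R]_n := delta_mx 0 i.
have edot v i : mdot v (e i) = v 0 i.
  rewrite mdotE big_ord1 (bigD1 i)//= big1 ?addr0 => [|j ji].
    by rewrite !mxE !eqxx mulr1.
  by rewrite !mxE (negPf ji) andbF mulr0.
pose C : 'M[R]_n := \matrix_(i, j) g (e i) 0 j.
have gC v : g v *m C^T = v.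
  apply/rowP => i; rewrite mxE -edot -gdot mdotE big_ord1.
  by apply: eq_bigr => j _; rewrite !mxE.
have oC : C *m C^T = 1%:M.
  apply/row_matrixP => i; rewrite row_mul row1 -[RHS]gC; congr (_ *m _).
  by apply/rowP => j; rewrite !mxE.
exists C => // v; rewrite -[in RHS](gC v) -mulmxA (mulmx1C oC) mulmx1 gE subrK //.
Qed.

End MatrixNorm.

(** * Finite index, generation and finite spanning families *)

Section FiniteIndex.
Variable G : groupType.
Implicit Types (H K N : set G).

Lemma subgroupP H : H 1%g -> (forall x y, H x -> H y -> H (x * y)%g) ->
  (forall x, H x -> H x^-1%g) -> subgroup H.
Proof.
move=> H1 HM HV; split; first exact/mem_set.
move=> x y; rewrite !unfold_in /= => /set_mem Hx /set_mem Hy; apply/mem_set.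
by apply: HM => //; exact: HV.
Qed.

(** The criterion used throughout: a colouring by finitely many values with each fibre inside one
    left coset. *)
Lemma finite_index_map (T : eqType) H K (S : set T) (kap : G -> T) : subgroup H ->
  subgroup K -> finite_set S -> (forall h, H h -> S (kap h)) ->
  (forall g h, H g -> H h -> kap g = kap h -> K (g^-1 * h)%g) -> finite_index K H.
Proof.
move=> sH sK fS HS kK; rewrite /finite_index.
pose r t := xget 1%g [set h | H h /\ kap h = t].
apply: sub_finite_set (finite_image (fun t => ltranslate (r t) K) fS) => _ [h Hh <-].
exists (kap h); first exact: HS.
have [Hr rh] : [set h' | H h' /\ kap h' = kap h] (r (kap h)).
  by apply: xgetPex; exists h.
have Kr := kK _ _ Hr Hh rh.
apply/seteqP; split=> [_ [k Kk <-]|_ [k Kk <-]].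
  exists (((r (kap h))^-1 * h)^-1 * k)%g; first by apply: subgroupM => //; exact: subgroupV.
  by rewrite invgM invgK !mulgA mulgV mul1g.
by exists ((r (kap h))^-1 * h * k)%g; [exact: subgroupM|rewrite !mulgA mulgV mul1g].
Qed.

Lemma ltranslate_eq K g h : subgroup K -> ltranslate g K = ltranslate h K -> K (g^-1 * h)%g.
Proof.
move=> sK gh; have : ltranslate h K h by exists 1%g; [exact: subgroup1|rewrite mulg1].
by rewrite -gh => -[k Kk <-]; rewrite mulKg.
Qed.

Lemma finite_index_trans H N K : subgroup H -> subgroup N -> subgroup K ->
  N `<=` H -> finite_index N H -> finite_index K N -> finite_index K H.
Proof.
move=> sH sN sK NH fN fK.
pose r C := xget 1%g [set h | H h /\ ltranslate h N = C].
have rP h : H h -> H (r (ltranslate h N)) /\ ltranslate (r (ltranslate h N)) N = ltranslate h N.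
  by move=> Hh; apply: (@xgetPex _ 1%g [set h' | H h' /\ ltranslate h' N = ltranslate h N]); exists h.
pose kap h := (ltranslate h N, ltranslate ((r (ltranslate h N))^-1 * h)%g K).
apply: (finite_index_map (kap := kap) sH sK (finite_setX fN fK)).
  move=> h Hh; split; first by exists h.
  have [Hr rN] := rP h Hh; exists ((r (ltranslate h N))^-1 * h)%g => //.
  exact: ltranslate_eq.
move=> g h Hg Hh [e1 e2]; rewrite e1 in e2; have := ltranslate_eq sK e2.
by rewrite invgM invgK !mulgA mulgK.
Qed.

Lemma finite_index_refl H : subgroup H -> finite_index H H.
Proof.
move=> sH; apply: (finite_index_map (kap := fun=> tt) (S := [set tt]) sH sH (finite_set1 _)) => //.
by move=> g h Hg Hh _; apply: subgroupM => //; exact: subgroupV.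
Qed.

Lemma generated_subgroup (S : set G) : subgroup (generated S).
Proof.
apply: subgroupP.
- by move=> K [sK _]; exact: subgroup1.
- by move=> x y Sx Sy K KP; apply: subgroupM; [case: KP|exact: Sx|exact: Sy].
- by move=> x Sx K KP; apply: subgroupV; [case: KP|exact: Sx].
Qed.

Lemma sub_generated (S : set G) : S `<=` generated S.
Proof. by move=> x Sx K [_]; exact. Qed.

Lemma generated_min (S K : set G) : subgroup K -> S `<=` K -> generated S `<=` K.
Proof. by move=> sK SK x; apply. Qed.

End FiniteIndex.

Section Spans.

(** The finite list maximizes the dimension of its span, so no further member of the family can
    leave that span. *)
Lemma family_span (F : fieldType) (V : vectType F) (T : eqType) (Q : set T) (phi : T -> V) (x0 : T) :
  exists s : seq T, (forall t, t \in s -> Q t) /\ forall t, Q t ->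
    exists c : 'I_(size s) -> F, phi t = \sum_i c i *: phi (nth x0 s i).
Proof.
pose P k := exists s : seq T, (forall t, t \in s -> Q t) /\ \dim <<map phi s>> = k.
have P0 : exists k, `[< P k >] by exists 0%N; apply/asboolP; exists [::]; split; rewrite //= span_nil dimv0.
have Pb k : `[< P k >] -> (k <= \dim {: V})%N.
  by move=> /asboolP[s [_ <-]]; apply: dimvS; exact: subvf.
case: (ex_maxnP P0 Pb) => k /asboolP[s [sQ sk]] kmax.
exists s; split=> // t Qt.
have tin : phi t \in <<map phi s>>%VS.
  apply/negPn/negP => nin.
  have : (\dim <<map phi (t :: s)>> <= k)%N.
    apply: kmax; apply/asboolP; exists (t :: s); split=> // t'.
    by rewrite in_cons => /orP[/eqP ->//|]; exact: sQ.
  have sub : (<<map phi s>> <= <<map phi (t :: s)>>)%VS.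
    by apply: sub_span => x; rewrite /= in_cons => ->; rewrite orbT.
  rewrite -sk => le.
  have := (dimv_leqif_sup sub).2; rewrite eqn_leq le (dimv_leqif_sup sub).1 /= => /esym/subvP H.
  move/negP: nin; apply; apply: H; apply: memv_span.
  by rewrite /= mem_head.
have [X XE] : exists X : (size s).-tuple V, X = map phi s :> seq V.
  by exists (map_tuple phi (in_tuple s)).
exists (fun i => coord X i (phi t)).
rewrite -XE in tin; rewrite (coord_span tin).
apply: eq_bigr => i _; congr (_ *: _); rewrite -?(coord_span tin)//.
by rewrite XE (nth_map x0).
Qed.

Lemma finite_min (R : realType) (T : eqType) (F : set T) (s : T -> R) x0 :
  finite_set F -> F x0 -> exists2 x, F x & forall y, F y -> s x <= s y.
Proof.
move=> /finite_seqP[l ->] x0l.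
suff : exists2 x, x \in l & forall y, y \in l -> s x <= s y by case=> x xl xm; exists x.
elim: l x0 x0l => //= a l IH x0 _.
case: l IH => [|b l] IH.
  by exists a; rewrite ?mem_head// => y; rewrite inE => /eqP ->.
have [x xl xm] := IH b (mem_head _ _).
have [ax|xa] := leP (s a) (s x).
  exists a; first exact: mem_head.
  by move=> y; rewrite in_cons => /orP[/eqP ->//|/xm]; exact: le_trans.
exists x; first by rewrite in_cons xl orbT.
by move=> y; rewrite in_cons => /orP[/eqP ->|/xm//]; exact: ltW.
Qed.

Lemma min_nat (P : nat -> Prop) n : P n -> exists k, P k /\ forall j, P j -> (k <= j)%N.
Proof.
move=> Pn; have ex : exists k, `[< P k >] by exists n; apply/asboolP.
case: (ex_minnP ex) => k /asboolP Pk kmin; exists k; split=> // j Pj.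
by apply: kmin; apply/asboolP.
Qed.

Lemma max_nat (P : nat -> Prop) n N : P n -> (forall k, P k -> (k <= N)%N) ->
  exists k, P k /\ forall j, P j -> (j <= k)%N.
Proof.
move=> Pn PN; have ex : exists k, `[< P k >] by exists n; apply/asboolP.
have ub k : `[< P k >] -> (k <= N)%N by move=> /asboolP; exact: PN.
case: (ex_maxnP ex ub) => k /asboolP Pk kmax; exists k; split=> // j Pj.
by apply: kmax; apply/asboolP.
Qed.

End Spans.

Section TranslationSubgroup.
Variables (R : realType) (G : groupType) (H K : set G) (n : nat) (a : G -> 'rV[R]_n).
Hypotheses (sH : subgroup H) (sK : subgroup K) (KH : K `<=` H) (fK : finite_index K H).
Hypothesis aM : forall g h, K g -> K h -> a (g * h)%g = a g + a h.
Hypothesis aP : forall M, finite_set [set h | K h /\ mnorm (a h) <= M].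

Let a1 : a 1%g = 0.
Proof.
have K1 := subgroup1 sK; have := aM K1 K1; rewrite mulg1 => e.
by apply: (addrI (a 1%g)); rewrite -e addr0.
Qed.

Let aV g : K g -> a g^-1%g = - a g.
Proof.
move=> Kg; have := aM Kg (subgroupV sK Kg); rewrite mulgV a1 => /esym/eqP.
by rewrite addrC addr_eq0 => /eqP.
Qed.

Let aJ g h : K g -> K h -> a (g * h * g^-1)%g = a h.
Proof.
move=> Kg Kh; have Kg' := subgroupV sK Kg.
by rewrite aM ?aM ?aV//; [rewrite addrAC subrr add0r|exact: subgroupM].
Qed.

(* Rounding the coordinates on a spanning family to integers. *)
Lemma translations_fg : exists M, generated [set h | K h /\ mnorm (a h) <= M] = K.
Proof.
have [s [sK' sP]] := family_span K a 1%g.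
exists (\sum_(i < size s) mnorm (a (nth 1%g s i))).
set M := \sum_(i < _) _; set Q := [set h | _].
have sQ := generated_subgroup Q.
apply/seteqP; split; first by apply: generated_min => // x [].
have Ki i : (i < size s)%N -> K (nth 1%g s i) by move=> /(mem_nth 1%g)/sK'.
have Qi (i : 'I_(size s)) : Q (nth 1%g s i).
  split; first exact: Ki.
  by rewrite /M (bigD1 i)//= lerDl; apply: sumr_ge0 => j _; exact: mnorm_ge0.
have GK : generated Q `<=` K by apply: generated_min => // x [].
have power (g : G) (z : int) : generated Q g ->
    exists2 w, generated Q w & a w = z%:~R *: a g.
  move=> Qg; have nat_power (k : nat) : exists2 w, generated Q w & a w = k%:R *: a g.
    elim: k => [|k [w Qw aw]]; first by exists 1%g; [exact: (subgroup1 sQ)|rewrite a1 scale0r].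
    exists (w * g)%g; first exact: (subgroupM sQ).
    by rewrite aM ?aw; [rewrite -natr1 scalerDl scale1r|exact: GK|exact: GK].
  case: z => k.
    by have [w Qw aw] := nat_power k; exists w.
  have [w Qw aw] := nat_power k.+1; exists w^-1%g; first exact: (subgroupV sQ).
  by rewrite aV ?aw; [rewrite NegzE mulrNz scaleNr|exact: GK].
move=> h Kh; have [c cE] := sP h Kh.
have [w Qw aw] : exists2 w, generated Q w &
    a w = \sum_i (Num.floor (c i))%:~R *: a (nth 1%g s i).
  elim: (index_enum _) => [|i l [w Qw aw]].
    by exists 1%g; [exact: (subgroup1 sQ)|rewrite big_nil a1].
  have [w' Qw' aw'] := power _ (Num.floor (c i)) (sub_generated (Qi i)).
  exists (w' * w)%g; first exact: (subgroupM sQ).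
  by rewrite big_cons aM ?aw ?aw'//; exact: GK.
have Kw := GK _ Qw.
have -> : h = (h * w^-1 * w)%g by rewrite mulgVK.
apply: (subgroupM sQ) => //; apply: sub_generated; split.
  by apply: (subgroupM sK) => //; exact: (subgroupV sK).
rewrite aM ?aV//; last exact: (subgroupV sK).
rewrite cE aw -sumrB; apply: (le_trans (mnorm_sum _ _)); apply: ler_sum => i _.
rewrite -scalerBl mnormZ -[leRHS]mul1r ler_wpM2r ?mnorm_ge0//.
have /andP[] := floor_itv (c i); rewrite intrD => f1 f2.
by rewrite ler_norml; apply/andP; split; lra.
Qed.

(** [a] may have a finite kernel, so [K] need not be abelian and its centre is used. The finite
    generating set [Q] is stable under conjugation because [a] is constant on conjugacy classes;
    elements acting alike on it differ by a central one. *)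
Lemma virtually_abelian_of_translations : virtually_abelian H /\ finitely_generated H.
Proof.
have [M QK] := translations_fg; set Q := [set h | _] in QK.
have fQ : finite_set Q := aP M; have [qs qsE] := (finite_seqP _).1 fQ.
split.
  pose Z := [set z | K z /\ forall g, K g -> (z * g = g * z)%g].
  have sZ : subgroup Z.
    apply: subgroupP.
    - by split=> [|g _]; [exact: subgroup1|rewrite mulg1 mul1g].
    - move=> x y [Kx cx] [Ky cy]; split=> [|g Kg]; first exact: subgroupM.
      by rewrite -mulgA cy// !mulgA cx.
    - move=> x [Kx cx]; split=> [|g Kg]; first exact: subgroupV.
      by apply: (mulgI x); rewrite mulVKg mulgA cx// mulgK.
  exists Z; split=> //.
  - by move=> z [Kz _]; exact: KH.
  - by move=> x y [Kx cx] [Ky _]; exact: cx.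
  apply: (finite_index_trans sH sK sZ KH fK).
  pose kap h := [ffun i : 'I_(size qs) =>
    inord (index (h * nth 1%g qs i * h^-1)%g qs) : 'I_(size qs).+1].
  apply: (finite_index_map (kap := kap) (S := setT) sK sZ) => //; first exact: finite_finset.
  move=> g h Kg Kh gh; split; first by apply: subgroupM => //; exact: subgroupV.
  have comm : [set x | K x /\ (g^-1 * h * x = x * (g^-1 * h))%g] `&` K = K.
    apply/seteqP; split=> [x [] //|]; rewrite -[in X in X `<=` _]QK.
    apply: generated_min.
      apply: subgroupP.
      - by split; [split|]; try exact: subgroup1; rewrite mulg1 mul1g.
      - move=> x y [[Kx cx] _] [[Ky cy] _]; have Kxy := subgroupM sK Kx Ky.
        by split=> //; split=> //; rewrite mulgA cx -mulgA cy mulgA.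
      - move=> x [[Kx cx] _]; have Kx' := subgroupV sK Kx; split=> //; split=> //.
        by apply: (mulgI x); rewrite mulVKg mulgA -cx mulgK.
    move=> q Qq; have [Kq _] := Qq; split=> //; split=> //.
    have qin : q \in qs by move: Qq; rewrite qsE.
    have conj_in k : K k -> (k * q * k^-1)%g \in qs.
      move=> Kk; suff : Q (k * q * k^-1)%g by rewrite qsE.
      have Kk' := subgroupV sK Kk.
      split; first by apply: subgroupM => //; exact: subgroupM.
      by rewrite aJ//; case: Qq.
    have iq : (index q qs < size qs)%N by rewrite index_mem.
    have := congr1 (fun f : {ffun _ -> _} => f (Ordinal iq)) gh.
    rewrite !ffunE /= nth_index// => /(congr1 (@nat_of_ord (size qs).+1)); rewrite !inordK ?ltnS ?index_size//.
    move=> /(congr1 (nth 1%g qs)); rewrite !nth_index ?conj_in// => e.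
    have e' : (g^-1 * (g * q * g^-1) * h = g^-1 * (h * q * h^-1) * h)%g by rewrite e.
    by move: e'; rewrite !mulgA mulVg mul1g mulgVK => ->; rewrite -!mulgA.
  by move=> k Kk; have [[_ ->]] : ([set x | K x /\ (g^-1 * h * x = x * (g^-1 * h))%g] `&` K) k by rewrite comm.
pose C := [set ltranslate h K | h in H].
pose r (D : set G) := xget 1%g [set h | H h /\ ltranslate h K = D].
exists (Q `|` r @` C).
  by rewrite finite_setU; split=> //; exact: finite_image.
have rP h : H h -> H (r (ltranslate h K)) /\ ltranslate (r (ltranslate h K)) K = ltranslate h K.
  by move=> Hh; apply: (@xgetPex _ 1%g [set h' | H h' /\ ltranslate h' K = ltranslate h K]); exists h.
apply/seteqP; split.
  apply: generated_min => // x [[Kx _]|[_ [h Hh <-] <-]]; first exact: KH.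
  by have [] := rP h Hh.
move=> h Hh; have [Hr rE] := rP h Hh; have Kr := ltranslate_eq sK rE.
rewrite -[h](mulVKg (r (ltranslate h K))).
apply: (subgroupM (generated_subgroup _)).
- by apply: sub_generated; right; exists (ltranslate h K) => //; exists h.
- have : K `<=` generated (Q `|` r @` C).
    rewrite -{1}QK; apply: generated_min; first exact: generated_subgroup.
    by move=> x Qx; apply: sub_generated; left.
  exact.
Qed.

End TranslationSubgroup.

Section Bieberbach.
Variables (R : realType) (G : groupType) (H : set G) (n : nat) (A : G -> 'M[R]_n).
Hypothesis sH : subgroup H.
Hypothesis oA : forall h, H h -> A h *m (A h)^T = 1%:M.
(** The order is reversed because matrices act on row vectors from the right. *)
Hypothesis AM : forall g h, H g -> H h -> A (g * h)%g = A h *m A g.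

Let AVl g : H g -> (A g)^T *m A g = 1%:M.
Proof. by move=> Hg; apply: mulmx1C; exact: oA. Qed.

Let A1 : A 1%g = 1%:M.
Proof.
have H1 := subgroup1 sH; have := AM H1 H1; rewrite mulg1 => e.
by have := congr1 (mulmx (A 1%g)^T) e; rewrite mulmxA AVl// mul1mx => <-.
Qed.

Let AV g : H g -> A g^-1%g = (A g)^T.
Proof.
move=> Hg; have := AM (subgroupV sH Hg) Hg; rewrite mulVg A1 => e.
by rewrite -[LHS]mul1mx -(AVl Hg) -mulmxA -e mulmx1.
Qed.

(* [N] acts through the linear parts [A] and the translation parts [a],
   preserving the row space of [D] and properly discontinuously on it. *)
Definition affine_state (N : set G) (a : G -> 'rV[R]_n) (D : 'M[R]_n) :=
  [/\ subgroup N, N `<=` H, finite_index N H &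
    [/\ forall g h, N g -> N h -> a (g * h)%g = a h *m A g + a g,
        forall M, finite_set [set h | N h /\ mnorm (a h) <= M],
        forall h, N h -> (a h <= D)%MS & forall h, N h -> (D *m A h <= D)%MS]].

(** A vector fixed by an orthogonal [C] is fixed by its transpose, hence orthogonal to the image of
    [C - 1]. *)
Lemma orth_ker_sqr m (X : 'M[R]_(m, n)) C : C *m C^T = 1%:M ->
  X *m (C - 1%:M) *m (C - 1%:M) = 0 -> X *m (C - 1%:M) = 0.
Proof.
move=> oC; set Y := X *m _ => YE; apply: mdot_eq0; rewrite /mdot {1}/Y -mulmxA.
have YC : Y *m C = Y by apply/eqP; rewrite -subr_eq0 -{2}[Y]mulmx1 -mulmxBr YE.
have YC' : Y *m C^T = Y by rewrite -{1}YC -mulmxA oC mulmx1.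
have -> : (C - 1%:M) *m Y^T = 0.
  by rewrite -{1}[C]trmxK -trmx1 -linearB /= -trmx_mul mulmxBr YC' mulmx1 subrr trmx0.
by rewrite mulmx0 mxtrace0.
Qed.

Section State.
(** The extremality of [D] and [V] ranges over other subgroups than [N], so that it can still be
    used after passing to a subgroup of finite index. *)
Variables (N : set G) (a : G -> 'rV[R]_n) (D V : 'M[R]_n).
Hypothesis st : affine_state N a D.
Hypothesis Dmin : forall N' a' D', affine_state N' a' D' -> (\rank D <= \rank D')%N.
Hypotheses (VD : (V <= D)%MS) (VA : forall h, N h -> V *m A h = V).
Hypothesis Vmax : forall N' (V' : 'M[R]_n), affine_state N' a D -> (V' <= D)%MS ->
  (forall h, N' h -> V' *m A h = V') -> (\rank V' <= \rank V)%N.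

Let sN : subgroup N. Proof. by case: st. Qed.
Let NH : N `<=` H. Proof. by case: st. Qed.
Let fN : finite_index N H. Proof. by case: st. Qed.
Let aM g h : N g -> N h -> a (g * h)%g = a h *m A g + a g.
Proof. by case: st => _ _ _ [+ _ _ _]; exact. Qed.
Let aP M : finite_set [set h | N h /\ mnorm (a h) <= M].
Proof. by case: st => _ _ _ []. Qed.
Let aD h : N h -> (a h <= D)%MS.
Proof. by case: st => _ _ _ [_ _ + _]; exact. Qed.
Let DA h : N h -> (D *m A h <= D)%MS.
Proof. by case: st => _ _ _ [_ _ _]; exact. Qed.

Let bact g (v : 'rV[R]_n) := v *m A g + a g.

Let bactM g h v : N g -> N h -> bact (g * h)%g v = bact g (bact h v).
Proof.
move=> Ng Nh; rewrite /bact aM// AM; [|exact: NH|exact: NH].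
by rewrite mulmxDl mulmxA addrA.
Qed.

Let bact_in g v : N g -> (v <= D)%MS -> (bact g v <= D)%MS.
Proof.
move=> Ng vD; apply: addmx_sub; last exact: aD.
by apply: submx_trans (DA Ng); exact: submxMr.
Qed.

Let a1 : a 1%g = 0.
Proof.
have N1 := subgroup1 sN; have := aM N1 N1; rewrite mulg1 A1 mulmx1 => e.
by apply: (addrI (a 1%g)); rewrite -e addr0.
Qed.

Let bact1 v : bact 1%g v = v. Proof. by rewrite /bact A1 mulmx1 a1 addr0. Qed.

Let bactK g v : N g -> bact g^-1%g (bact g v) = v.
Proof. by move=> Ng; rewrite -bactM ?mulVg//; exact: subgroupV. Qed.

Let bactVK g v : N g -> bact g (bact g^-1%g v) = v.
Proof. by move=> Ng; rewrite -bactM ?mulgV//; exact: subgroupV. Qed.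

Definition aff_comm g c := forall v, (v <= D)%MS -> bact g (bact c v) = bact c (bact g v).

Let comm_subgroup c : N c -> subgroup [set g | N g /\ aff_comm g c].
Proof.
move=> Nc; apply: subgroupP.
- by split=> [|v vD]; [exact: subgroup1|rewrite !bact1].
- move=> x y [Nx cx] [Ny cy]; split=> [|v vD]; first exact: subgroupM.
  by rewrite !bactM// cy// cx//; exact: bact_in.
- move=> x [Nx cx]; have Nx' := subgroupV sN Nx; split=> // v vD.
  by rewrite -{1}(bactVK v Nx) -cx ?bactK//; exact: bact_in.
Qed.

Let sub_state K : subgroup K -> K `<=` N -> finite_index K H -> affine_state K a D.
Proof.
move=> sK KN fK; split=> //; first exact: subset_trans NH.
split.
- by move=> g h /KN Ng /KN; exact: aM.
- by move=> M; apply: sub_finite_set (aP M) => h [/KN].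
- by move=> h /KN; exact: aD.
- by move=> h /KN; exact: DA.
Qed.

(* The displacement of a central element is minimal along an invariant affine
   subspace, which is everything by minimality of [D]. *)
Lemma central_translation K c : subgroup K -> K `<=` N -> finite_index K H -> K c ->
  (forall h, K h -> aff_comm h c) ->
  [/\ D *m A c = D, forall h, K h -> a c *m A h = a c & (a c <= V)%MS].
Proof.
move=> sK KN fK Kc cc; have Nc := KN _ Kc; have oc := oA (NH Nc).
have ac_comm h : K h -> a c *m A h + a h = a h *m A c + a c.
  by move=> Kh; have := cc h Kh 0 (sub0mx _ _); rewrite /bact !mul0mx !add0r.
have lin_comm h : K h -> D *m A c *m A h = D *m A h *m A c.
  move=> Kh; apply/row_matrixP => i; rewrite !row_mul.
  have := cc h Kh (row i D) (row_sub _ _); rewrite /bact !mulmxDl -!addrA ac_comm//.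
  by move/addIr.
have lin_commX m (X : 'M_(m, n)) h : K h -> (X <= D)%MS -> X *m A c *m A h = X *m A h *m A c.
  by move=> Kh /submxP[Y ->]; rewrite -!mulmxA 2!(mulmxA D) lin_comm// !mulmxA.
pose E := A c - 1%:M.
have DE : (D *m E <= D)%MS.
  by rewrite mulmxBr mulmx1 addmx_sub ?DA// eqmx_opp.
have cap0 : (D *m E :&: kermx E)%MS = 0.
  have /submxP[Y YE] := capmxSl (D *m E)%MS (kermx E).
  have : ((D *m E :&: kermx E)%MS *m E) = 0 by apply/sub_kermxP; exact: capmxSr.
  by rewrite {1}YE mulmxA => /(orth_ker_sqr oc); rewrite -mulmxA -YE.
have DEE : (D *m E <= D *m E *m E)%MS.
  have s1 : (D *m E *m E <= D *m E)%MS by exact: submxMr.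
  have := mxrank_mul_ker (D *m E) E; rewrite cap0 mxrank0 addn0 => e.
  by rewrite -(mxrank_leqif_sup s1) e.
have /submxP[y yE] : (a c *m E <= D *m E *m E)%MS.
  by apply: submx_trans DEE; apply: submxMr; exact: aD.
(* A new origin, at which the displacement [a' c] is fixed by [A c], hence is as short as
   possible. *)
pose q := - (y *m D).
have qD : (q <= D)%MS by rewrite eqmx_opp submxMl.
have qE : q *m E *m E = - (a c *m E) by rewrite yE !mulNmx !mulmxA.
clearbody q.
pose a' h := a h + q *m A h - q.
have a'D h : K h -> (a' h <= D)%MS.
  move=> Kh; have Nh := KN _ Kh; rewrite !addmx_sub ?aD// ?eqmx_opp ?submxMl//.
  by apply: submx_trans (DA Nh); exact: submxMr.
have wE : a' c *m E = 0.
  have -> : a' c = a c + q *m E by rewrite /a' /E mulmxBr mulmx1 addrA.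
  by rewrite mulmxDl qE subrr.
have wc : a' c *m A c = a' c.
  by apply/eqP; rewrite -subr_eq0 -{2}[a' c]mulmx1 -mulmxBr wE.
have a'E : forall h, K h -> a' h *m E = 0.
  move=> h Kh; apply: (orth_ker_sqr oc); rewrite -/E.
  have -> : a' h *m E = a' c *m A h - a' c.
    have e1 := ac_comm h Kh; have e2 := lin_commX _ _ _ Kh qD.
    rewrite /E mulmxBr mulmx1 /a' !mulmxDl !mulNmx e2.
    move: e1; move: (a c *m A h) (a h) (a h *m A c) (a c) => x1 x2 x3 x4.
    move: (q *m A h *m A c) (q *m A c) (q *m A h) => x5 x6 x7.
    by move=> /rowP e1; apply/rowP => i; have := e1 i; rewrite !mxE; lra.
  rewrite mulmxBl wE subr0 /E mulmxBr mulmx1 -lin_commX ?wc ?subrr//; exact: a'D.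
have stK : affine_state K a' (D :&: kermx E)%MS.
  split=> //; first exact: subset_trans NH.
  split.
  - move=> g h Kg Kh; rewrite /a' aM ?AM; [|exact/NH/KN|exact/NH/KN|exact: KN|exact: KN].
    rewrite !mulmxDl mulNmx !mulmxA.
    move: (a h *m A g) (a g) (q *m A h *m A g) (q *m A g) => x1 x2 x3 x4.
    by apply/rowP => i; rewrite !mxE; lra.
  - move=> M; apply: sub_finite_set (aP (M + 2 * mnorm q)) => h [Kh hM].
    split; first exact: KN.
    have -> : a h = a' h + (q - q *m A h).
      by rewrite /a'; move: (q *m A h) => x; apply/rowP => i; rewrite !mxE; lra.
    apply: (le_trans (mnormD _ _)); have := mnormB q (q *m A h).
    by rewrite mnorm_orthr; [lra|exact/oA/NH/KN].
  - move=> h Kh; rewrite sub_capmx a'D//; exact/sub_kermxP/a'E.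
  - move=> h Kh; have Nh := KN _ Kh; rewrite sub_capmx; apply/andP; split.
      by apply: submx_trans (DA Nh); apply: submxMr; exact: capmxSl.
    apply/sub_kermxP; rewrite /E mulmxBr mulmx1 -lin_commX//; last exact: capmxSl.
    have : (D :&: kermx E)%MS *m E = 0 by apply/sub_kermxP; exact: capmxSr.
    rewrite /E mulmxBr mulmx1 => /eqP; rewrite subr_eq0 => /eqP ->.
    by rewrite subrr.
have Dker : D *m E = 0.
  apply/sub_kermxP; apply: submx_trans (capmxSr D _).
  by rewrite -(mxrank_leqif_sup (capmxSl D (kermx E))) eqn_leq (Dmin stK) mxrankS ?capmxSl.
have Dc : D *m A c = D.
  by apply/eqP; rewrite -subr_eq0 -{2}[D]mulmx1 -mulmxBr Dker.
have acA h : K h -> a c *m A h = a c.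
  move=> Kh; have := ac_comm h Kh; have /submxP[Y ->] := aD (KN _ Kh).
  by rewrite -mulmxA Dc addrC => /addrI.
split=> //.
(* [a c] is fixed by the linear parts, so adding it to [V] would contradict maximality unless it is
   already there. *)
have s1 : (V <= V + a c)%MS by exact: addsmxSl.
have VaA h : K h -> (V + a c)%MS *m A h = (V + a c)%MS.
  move=> Kh; have /sub_addsmxP[[u1 u2] /= ->] := submx_refl (V + a c)%MS.
  by rewrite mulmxDl -!mulmxA acA// VA//; exact: KN.
apply: submx_trans (addsmxSr V _) _; rewrite -(mxrank_leqif_sup s1) eqn_leq mxrankS//=.
apply: (Vmax (sub_state sK KN fK)) => //.
by rewrite addsmx_sub VD aD.
Qed.

Let VT h : N h -> A h *m V^T = V^T.
Proof.
move=> Nh; have := VA (subgroupV sN Nh); rewrite AV; last exact: NH.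
by move=> /(congr1 trmx); rewrite trmx_mul trmxK.
Qed.

(** The component of the translation part along [V] is additive, so commutators have none. *)
Let aMV g h : N g -> N h -> a (g * h)%g *m V^T = a h *m V^T + a g *m V^T.
Proof. by move=> Ng Nh; rewrite aM// mulmxDl -mulmxA VT. Qed.

(** With this bound the factor [2 * mnorm (A u - 1%:M)] in the commutator estimate is at most
    [4^-1]. *)
Let U := [set h | N h /\ mnorm (A h - 1%:M) <= 8^-1].
Let K := generated U.
Let trivial_on c := forall v, (v <= D)%MS -> bact c v = v.

Let UN : U `<=` N. Proof. by move=> h []. Qed.
Let sK : subgroup K. Proof. exact: generated_subgroup. Qed.
Let KN : K `<=` N. Proof. exact: generated_min. Qed.
Let UK : U `<=` K. Proof. exact: sub_generated. Qed.

Let comm_K c : N c -> (forall u, U u -> aff_comm u c) -> forall h, K h -> aff_comm h c.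
Proof.
move=> Nc cU h Kh.
have : K `<=` [set g | N g /\ aff_comm g c].
  apply: generated_min; first exact: comm_subgroup.
  by move=> u Uu; split; [exact: UN|exact: cU].
by case/(_ h Kh).
Qed.

(** Pigeonhole in the orthogonal group: matrix entries in [[-1, 1]] are sorted into intervals of
    length [1 / m], and elements with equal labels have a quotient within [n / m < 1 / 8] of the
    identity. *)
Let fK : finite_index K H.
Proof.
apply: (finite_index_trans sH sN sK NH fN).
pose m := (8 * n).+1.
have m0 : 0 < m%:R :> R by rewrite ltr0n.
have Aij h i j : N h -> `|A h i j| <= 1.
  move=> Nh; rewrite -(ler_sqr (normr_ge0 _) ler01) real_normK ?num_real// expr1n.
  have := congr1 (fun M : 'M_n => M i i) (oA (NH Nh)); rewrite !mxE eqxx => e.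
  rewrite -[leRHS]/(true%:R) -e (bigD1 j)//= mxE -expr2 lerDl; apply: sumr_ge0 => k _.
  by rewrite mxE -expr2 sqr_ge0.
pose kap h := [ffun ij : 'I_n * 'I_n =>
  inord (Num.truncn ((A h ij.1 ij.2 + 1) * m%:R)) : 'I_(2 * m).+1].
apply: (finite_index_map (kap := kap) (S := setT) sN sK) => //; first exact: finite_finset.
move=> g h Ng Nh gh; apply: UK; split; first exact: (subgroupM sN (subgroupV sN Ng) Nh).
rewrite AM; [|exact/NH/(subgroupV sN)|exact: NH].
rewrite AV; last exact: NH.
have -> : A h *m (A g)^T - 1%:M = (A h - A g) *m (A g)^T by rewrite mulmxBl oA//; exact: NH.
rewrite mnorm_orthr; last by rewrite trmxK AVl//; exact: NH.
have close i j : `|A h i j - A g i j| <= m%:R^-1.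
  have bnd k : N k -> 0 <= (A k i j + 1) * m%:R /\
      (Num.truncn ((A k i j + 1) * m%:R) < (2 * m).+1)%N.
    move=> Nk; have := Aij k i j Nk; rewrite ler_norml => /andP[l1 l2].
    have p : 0 <= (A k i j + 1) * m%:R by apply: mulr_ge0; [lra|exact: ltW].
    split=> //; rewrite ltnS -(ler_nat R); have /andP[t1 _] := truncn_itv p.
    by apply: (le_trans t1); rewrite natrM ler_pM2r//; lra.
  have [pg tg] := bnd g Ng; have [ph th] := bnd h Nh.
  have := congr1 (fun f : {ffun _ -> _} => f (i, j)) gh.
  rewrite !ffunE /= => /(congr1 (@nat_of_ord (2 * m).+1)); rewrite !inordK// => e.
  have := truncn_itv pg; have := truncn_itv ph; rewrite e -natr1 => /andP[h1 h2] /andP[g1 g2].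
  rewrite -(ler_pM2r m0) mulVf ?gt_eqF// -[X in _ * X](gtr0_norm m0) -normrM ler_norml.
  by apply/andP; split; rewrite mulrBl; lra.
apply: ler_of_sqr; first by lra.
rewrite sqr_mnorm mdotE.
apply: (@le_trans _ _ (\sum_(i < n) \sum_(j < n) m%:R^-1 ^+ 2)).
  apply: ler_sum => i _; apply: ler_sum => j _; rewrite !mxE -expr2.
  by rewrite -real_normK ?num_real// lerXn2r ?nnegrE ?invr_ge0 ?ler0n.
rewrite !sumr_const card_ord -mulrnA -[leLHS]mulr_natl natrM -expr2 -exprMn.
rewrite lerXn2r ?nnegrE ?mulr_ge0 ?invr_ge0 ?ler0n// ler_pdivrMr//.
have -> : m%:R = 8 * n%:R + 1 :> R by rewrite /m -natr1 natrM.
by have := ler0n R n; lra.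
Qed.

(** Up to an orthogonal factor, [A k - 1] is the commutator of [A c - 1] and [A u - 1], hence of
    second order. This contracts the rotation part, and the translation part up to a multiple of the
    rotation part of [c]. *)
Let commutator u c : U u -> U c -> exists k,
  [/\ U k, mnorm (A k - 1%:M) <= 4^-1 * mnorm (A c - 1%:M),
      mnorm (a k) <= 4^-1 * mnorm (a c) + 2 * mnorm (a u) * mnorm (A c - 1%:M),
      a k *m V^T = 0 & trivial_on k -> aff_comm u c].
Proof.
move=> [Nu Uu] [Nc Uc]; pose k := (u * c * (c * u)^-1)%g.
have Nuc := subgroupM sN Nu Nc; have Ncu := subgroupM sN Nc Nu.
have Nk : N k by exact: (subgroupM sN Nuc (subgroupV sN Ncu)).
have kE : (k * (c * u) = u * c)%g by rewrite /k mulgVK.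
clearbody k.
have Ak : A u *m A c *m A k = A c *m A u.
  by rewrite -!AM ?kE//; exact: NH.
have ak : a c *m A u + a u = (a u *m A c + a c) *m A k + a k.
  by rewrite -!aM ?kE.
have Ak1 : mnorm (A k - 1%:M) <= 2 * mnorm (A u - 1%:M) * mnorm (A c - 1%:M).
  have e : A u *m A c *m (A k - 1%:M) =
      (A c - 1%:M) *m (A u - 1%:M) - (A u - 1%:M) *m (A c - 1%:M).
    rewrite mulmxBr Ak !(mulmxBl, mulmxBr) !(mulmx1, mul1mx).
    move: (A c *m A u) (A u *m A c) (A c) (A u) => x1 x2 x3 x4.
    by apply/matrixP => i j; rewrite !mxE; lra.
  have o : A u *m A c *m (A u *m A c)^T = 1%:M.
    by rewrite -AM ?oA//; exact: NH.
  rewrite -(mnorm_orthl _ o) e; apply: (le_trans (mnormB _ _)).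
  have := mnormM (A c - 1%:M) (A u - 1%:M); have := mnormM (A u - 1%:M) (A c - 1%:M).
  rlra.
have akE : a k = a c *m (A u - 1%:M) - a u *m (A c - 1%:M) - (a u *m A c + a c) *m (A k - 1%:M).
  move: ak; rewrite !(mulmxBr _ _ 1%:M) !mulmx1.
  move: (a c *m A u) (a u *m A c) ((_ + _) *m A k) => x1 x2 x3 /rowP e.
  by apply/rowP => i; have := e i; rewrite !mxE; lra.
have p1 := mnorm_ge0 (A c - 1%:M); have p2 := mnorm_ge0 (a c); have p3 := mnorm_ge0 (a u).
have Ak2 : mnorm (A k - 1%:M) <= 4^-1 * mnorm (A c - 1%:M).
  by move: Ak1; nra.
exists k; split=> //.
- by split=> //; lra.
- rewrite akE; apply: (le_trans (mnormB _ _)).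
  have := mnormB (a c *m (A u - 1%:M)) (a u *m (A c - 1%:M)).
  have := mnormM (a c) (A u - 1%:M); have := mnormM (a u) (A c - 1%:M).
  have := mnormM (a u *m A c + a c) (A k - 1%:M).
  have := mnormD (a u *m A c) (a c); rewrite mnorm_orthr; last exact/oA/NH.
  have := mnorm_ge0 (a u *m A c + a c); move: (mnorm (a u *m _ + _)) => w5 h0 h5 h4 h2 h1 h3.
  have q1 : mnorm (a c) * mnorm (A u - 1%:M) <= mnorm (a c) * 8^-1 by rewrite ler_wpM2l.
  have q4 : w5 * mnorm (A k - 1%:M) <=
      (mnorm (a u) + mnorm (a c)) * (4^-1 * mnorm (A c - 1%:M)).
    by apply: ler_pM => //; exact: mnorm_ge0.
  have q5 : mnorm (a c) * mnorm (A c - 1%:M) <= mnorm (a c) * 8^-1 by rewrite ler_wpM2l.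
  have q6 : 0 <= mnorm (a u) * mnorm (A c - 1%:M) by rewrite mulr_ge0.
  lra.
- have := congr1 (fun g => a g *m V^T) kE; rewrite /= aMV// !aMV//.
  rewrite [RHS]addrC -[RHS]addr0 => /addrI; exact.
- move=> tk v vD; rewrite -!bactM// -kE bactM// tk//; exact: bact_in.
Qed.

(* Zassenhaus: commutation with [u] contracts, so that a shortest nontrivial
   element without translation part along [V] is central. *)
Let U_comm u c : U u -> U c -> aff_comm u c.
Proof.
move=> Uu Uc; apply: contrapT => nuc.
pose P := [set c | [/\ U c, ~ trivial_on c & a c *m V^T = 0]].
have [c0 Pc0] : exists c0, P c0.
  by have [k [Uk _ _ kV kt]] := commutator Uu Uc; exists k; split=> // /kt.
(* The coordinate 1 forces coefficients of sum 1: each [h] in [U] acts as an affine combination of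
   finitely many elements, and commuting with those is enough. *)
pose phi h : (R^o * 'rV[R]_n * 'M[R]_n)%type := (1, a h, A h).
have [s [sU sP]] := family_span U phi 1%g.
pose M := \sum_(i < size s) mnorm (a (nth 1%g s i)).
have Us (i : 'I_(size s)) : U (nth 1%g s i) by apply: sU; rewrite mem_nth.
have aM' (i : 'I_(size s)) : mnorm (a (nth 1%g s i)) <= M.
  by rewrite /M (bigD1 i)//= lerDl; apply: sumr_ge0 => j _; exact: mnorm_ge0.
have M0 : 0 <= M by apply: sumr_ge0 => j _; exact: mnorm_ge0.
(* The weight lets the gain on the rotation part absorb the term [2 * M * mnorm (A c - 1%:M)] of the
   commutator estimate, so [w] decreases unless both parts vanish. *)
pose w c := mnorm (a c) + 8 * (M + 1) * mnorm (A c - 1%:M).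
have aw h : mnorm (a h) <= w h.
  by rewrite /w lerDl mulr_ge0 ?mnorm_ge0//; lra.
have [||c1 [Pc1 _] c1min] := @finite_min R _ [set h | P h /\ w h <= w c0] w c0.
- apply: sub_finite_set (aP (w c0)) => h [[[Nh _] _ _] wh]; split=> //.
  exact: le_trans wh.
- by split.
have {}c1min h : P h -> w c1 <= w h.
  move=> Ph; have [wh|/ltW wh] := leP (w h) (w c0); first exact: c1min.
  by apply: le_trans wh; apply: c1min; split.
have [Uc1 nt c1V] := Pc1; have [Nc1 _] := Uc1.
have cs (i : 'I_(size s)) : aff_comm (nth 1%g s i) c1.
  have [k [Uk k1 k2 kV kt]] := commutator (Us i) Uc1.
  have [/kt//|ntk] := pselect (trivial_on k).
  have wk : w c1 <= w k by apply: c1min.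
  have p1 := mnorm_ge0 (A c1 - 1%:M); have p2 := mnorm_ge0 (a c1).
  have q1 : mnorm (a (nth 1%g s i)) * mnorm (A c1 - 1%:M) <= M * mnorm (A c1 - 1%:M).
    by rewrite ler_wpM2r.
  have q2 : 8 * (M + 1) * mnorm (A k - 1%:M) <= 8 * (M + 1) * (4^-1 * mnorm (A c1 - 1%:M)).
    by rewrite ler_wpM2l//; lra.
  have q3 : 0 <= M * mnorm (A c1 - 1%:M) by rewrite mulr_ge0.
  rewrite /w in wk.
  have A0 : A c1 - 1%:M = 0 by apply: mnorm_eq0; lra.
  have a0 : a c1 = 0 by apply: mnorm_eq0; lra.
  case: nt => v vD; rewrite /bact a0 addr0.
  by move/eqP: A0; rewrite subr_eq0 => /eqP ->; rewrite mulmx1.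
have cU h : U h -> aff_comm h c1.
  move=> Uh v vD; have [x xE] := sP h Uh.
  have x1 : \sum_i x i = 1.
    have := congr1 (fun p => p.1.1) xE; rewrite /= => ->.
    rewrite (big_morph (fun p : R^o * 'rV[R]_n * 'M[R]_n => p.1.1)
      (id1 := 0) (op1 := +%R))//.
    by apply: eq_bigr => i _; exact: (esym (mulr1 _)).
  have xa : a h = \sum_i x i *: a (nth 1%g s i).
    have := congr1 (fun p => p.1.2) xE; rewrite /= => ->.
    by rewrite (big_morph (fun p : R^o * 'rV[R]_n * 'M[R]_n => p.1.2)
      (id1 := 0) (op1 := +%R)).
  have xA : A h = \sum_i x i *: A (nth 1%g s i).
    have := congr1 snd xE; rewrite /= => ->.
    by rewrite (big_morph (fun p : R^o * 'rV[R]_n * 'M[R]_n => p.2)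
      (id1 := 0) (op1 := +%R)).
  have bE z : bact h z = \sum_i x i *: bact (nth 1%g s i) z.
    rewrite /bact xa xA mulmx_sumr -big_split /=.
    by apply: eq_bigr => i _; rewrite scalerDr -scalemxAr.
  rewrite bE (eq_bigr (fun i => x i *: bact c1 (bact (nth 1%g s i) v))); last first.
    by move=> i _; rewrite cs.
  rewrite bE /bact mulmx_suml -[X in _ = _ + X]scale1r -x1 scaler_suml -big_split /=.
  by apply: eq_bigr => i _; rewrite scalerDr -scalemxAl.
(* [a c1] lies in [V] and is orthogonal to [V], hence vanishes: [c1] would be trivial on [D]. *)
have [Dc _ /submxP[y yE]] := central_translation sK KN fK (UK Uc1) (comm_K Nc1 cU).
have a0 : a c1 = 0.
  apply: mdot_eq0; rewrite /mdot {2}yE trmx_mul mulmxA c1V mul0mx mxtrace0 //.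
case: nt => v /submxP[z ->]; by rewrite /bact a0 addr0 -mulmxA Dc.
Qed.

(** All of [K] commutes as affine maps of [D], so [central_translation] applies to each element and
    [a] becomes additive. [K] may still be noncommutative through elements trivial on [D]. *)
Lemma state_translations : virtually_abelian H /\ finitely_generated H.
Proof.
have Kcomm c : K c -> forall h, K h -> aff_comm h c.
  move=> Kc; apply: comm_K => [|u Uu]; first exact: KN.
  have uc := comm_K (UN Uu) (fun v Uv => U_comm Uv Uu) Kc.
  by move=> v vD; rewrite uc.
apply: (virtually_abelian_of_translations (K := K) (a := a) sH sK) => //.
- exact: subset_trans NH.
- move=> g h Kg Kh; rewrite aM; [|exact: KN|exact: KN].
  have [_ -> // _] := central_translation sK KN fK Kh (Kcomm h Kh).
  by rewrite addrC.
- by move=> M; apply: sub_finite_set (aP M) => h [/KN].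
Qed.

End State.
End Bieberbach.

Theorem bieberbach (R : realType) (G : groupType) (H : set G) n
    (alpha : G -> 'rV[R]_n -> 'rV[R]_n) : subgroup H ->
  (forall g h v, H g -> H h -> alpha (g * h)%g v = alpha g (alpha h v)) ->
  (forall h u v, H h -> mnorm (alpha h u - alpha h v) = mnorm (u - v)) ->
  (forall M, finite_set [set h | H h /\ mnorm (alpha h 0) <= M]) ->
  virtually_abelian H /\ finitely_generated H.
Proof.
move=> sH alM alI alP.
have /choice[A AP] : forall h, exists C : 'M[R]_n, H h ->
    C *m C^T = 1%:M /\ forall v, alpha h v = v *m C + alpha h 0.
  move=> h; have [Hh|nH] := pselect (H h); last by exists 1%:M.
  by have [C oC aC] := isometry_affine (fun u v => alI h u v Hh); exists C.
have oA h : H h -> A h *m (A h)^T = 1%:M by move=> /AP[].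
have alE h v : H h -> alpha h v = v *m A h + alpha h 0 by move=> /AP[_]; exact.
pose a0 h := alpha h 0.
have a0M g h : H g -> H h -> a0 (g * h)%g = a0 h *m A g + a0 g.
  by move=> Hg Hh; rewrite /a0 alM// alE.
have AM g h : H g -> H h -> A (g * h)%g = A h *m A g.
  move=> Hg Hh; have Hgh := subgroupM sH Hg Hh.
  apply/row_matrixP => i; rewrite !rowE mulmxA.
  have := alM g h (delta_mx 0 i) Hg Hh; rewrite alE// (alE h _ Hh) (alE g _ Hg) mulmxDl.
  by rewrite -addrA -a0M// => /addIr.
pose P r := exists N a (D : 'M[R]_n), affine_state H A N a D /\ \rank D = r.
have [r [[N [a [D [st rD]]]] rmin]] : exists r, P r /\ forall j, P j -> (r <= j)%N.
  apply: (@min_nat P n); exists H, a0, 1%:M; split; last by rewrite mxrank1.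
  split=> //; first exact: finite_index_refl.
  by split=> // h Hh; exact: submx1.
have Dmin N' a' D' : affine_state H A N' a' D' -> (\rank D <= \rank D')%N.
  by move=> st'; rewrite rD; apply: rmin; exists N', a', D'.
pose Q r' := exists N' (V : 'M[R]_n), [/\ affine_state H A N' a D, (V <= D)%MS,
  forall h, N' h -> V *m A h = V & \rank V = r'].
have [r' [[N' [V [st' VD VA rV]]] rmax]] : exists r', Q r' /\ forall j, Q j -> (j <= r')%N.
  apply: (@max_nat Q 0%N n).
    exists N, 0; split; rewrite ?sub0mx ?mxrank0//.
    by move=> h _; rewrite mul0mx.
  by move=> k [N' [V [_ _ _ <-]]]; exact: rank_leq_row.
apply: (state_translations sH oA AM st' Dmin VD VA).
by move=> N'' V' st'' V'D V'A; rewrite rV; apply: rmax; exists N'', V'.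
Qed.

(** * Charts of flats *)

Lemma sys_coords (R : realType) (X : metricType R) (Y : set X) k b
    (T : nat -> R -> X -> X) (c : nat -> R) (y : X) : split_sys Y k b T -> Y y ->
  exists z, [/\ Y z, forall i, (i < k)%N -> b i z = c i & trans k b y z = 0].
Proof.
move=> sys Yy; have [lT oT] := sys.
suff key n : (n <= k)%N ->
    exists z, [/\ Y z, forall i, (i < n)%N -> b i z = c i & trans k b y z = 0].
  exact: key.
elim: n => [_|n IH nk]; first by exists y; split=> //; exact: (transxx sys).
have [z [Yz zc yz]] := IH (ltnW nk); have lTn := lT n nk.
exists (T n (c n - b n z) z); have YT := split_in lTn (c n - b n z) Yz; split=> //.
  move=> i; rewrite ltnS leq_eqVlt => /orP[/eqP ->|lt_in].
    by rewrite (split_coord lTn)//; ring.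
  by rewrite oT ?zc ?(ltn_eqF lt_in) ?(ltn_trans lt_in nk).
apply/le_anti/andP; split; last exact: trans_ge0.
apply: (le_trans (trans_tri sys Yy Yz YT)); rewrite yz add0r.
suff -> : trans k b z (T n (c n - b n z) z) = 0 by [].
rewrite /trans -[RHS]sqrtr0; congr Num.sqrt; rewrite /trans2 (split_disp lTn)//.
rewrite real_normK ?num_real// (bigD1 (Ordinal nk))//= (split_coord lTn)//.
rewrite big1 => [|i ni]; first by ring.
by rewrite oT ?subrr ?expr0n//; apply: contraNneq ni => e; apply/eqP/val_inj.
Qed.

Section Chart.
Variables (R : realType) (X : metricType R) (Y Y1 : set X) (k l : nat).
Variables (b : nat -> X -> R) (T : nat -> R -> X -> X).
Variables (c : nat -> X -> R) (S : nat -> R -> X -> X) (o : X).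
Local Notation d := (@mdist R X).
Hypotheses (sys : split_sys Y k b T) (sys1 : split_sys Y1 l c S).
Hypotheses (Y1o : Y1 `<=` slice Y k b o) (flat1 : forall x y, Y1 x -> Y1 y -> trans l c x y = 0).

(** The product of the [k] lines with the flat [Y1] of dimension [l] found in the slice. *)
Definition flat := [set v | Y v /\ Y1 (level b T k o v)].

Definition chart v : 'rV[R]_(k + l) :=
  row_mx (\row_(i < k) b i v) (\row_(j < l) c j (level b T k o v)).

Lemma chart_isometry v w : flat v -> flat w -> mnorm (chart v - chart w) = d v w.
Proof.
move=> [Yv v1] [Yw w1]; rewrite -[RHS]ger0_norm ?dist_ge0// -sqrtr_sqr; congr Num.sqrt.
have entB (p q : 'rV[R]_(k + l)) i : (p - q) ord0 i = p ord0 i - q ord0 i.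
  by rewrite mxE [X in _ + X]mxE.
rewrite mdotE big_ord1 big_split_ord /=.
have -> : d v w ^+ 2 = trans2 k b v w + \sum_(i < k) (b i v - b i w) ^+ 2 by rewrite /trans2 subrK.
rewrite -(level_dist sys o)// -[d (level _ _ _ _ _) _ ^+ 2](subrK
  (\sum_(j < l) (c j (level b T k o v) - c j (level b T k o w)) ^+ 2)).
rewrite -[X in _ = X + _ + _]/(trans2 _ _ _ _) -(sqr_trans sys1)// flat1// expr0n add0r.
rewrite [RHS]addrC; congr (_ + _); apply: eq_bigr => i _.
  by rewrite -expr2 entB /chart !row_mxEl !mxE.
by rewrite -expr2 entB /chart !row_mxEr !mxE.
Qed.

Lemma chart_surj u : Y1 !=set0 -> exists2 v, flat v & chart v = u.
Proof.
move=> [w0 w0Y].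
(* Coordinates are indexed by natural numbers, so the vector is completed by 0 outside its range. *)
pose cu j := if ltnP j l is LtnNotGeq jl then u 0 (rshift k (Ordinal jl)) else 0.
pose bu i := if ltnP i k is LtnNotGeq ik then u 0 (lshift l (Ordinal ik)) else 0.
have [w [wY wc _]] := sys_coords cu sys1 w0Y; have [Yw wo] := Y1o wY.
have [v [Yv vb wv]] := sys_coords bu sys Yw.
have Yl := level_in sys o Yv.
have lE : level b T k o v = w.
  apply: dist_eq0; rewrite distC -(trans_same (k := k) (b := b)); last first.
    by move=> i ik; rewrite (level_coord sys)// wo.
  by apply: (le_trans (trans_tri sys Yw Yv Yl)); rewrite wv add0r (trans_level0 sys).
exists v; first by split; rewrite ?lE.
apply/rowP => i; rewrite /chart lE; case: (splitP i) => j ij.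
  have -> : i = lshift l j by apply: val_inj.
  rewrite row_mxEl mxE vb// /bu; case: ltnP => [jk|]; last by rewrite leqNgt ltn_ord.
  by congr (u 0 (lshift l _)); apply: val_inj.
have -> : i = rshift k j by apply: val_inj.
rewrite row_mxEr mxE wc// /cu; case: ltnP => [jl|]; last by rewrite leqNgt ltn_ord.
by congr (u 0 (rshift k _)); apply: val_inj.
Qed.

End Chart.

Theorem corollary1p3 (R : realType) (X : completeMetricType R)
    (Gamma : groupType) (act : Gamma -> X -> X)
    (act_action : group_action act) (act_isometric : isometric act)
    (act_pd : properly_discontinuous act) (act_cocompact : cocompact act)
    (X_CAT0 : CAT0 X) (H : set Gamma) (H_subgroup : subgroup H)
    (H_amenable : amenable R H) :
  virtually_abelian H /\ finitely_generated H.
Proof.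
have HX := CAT0_proper_hadamard act_action act_isometric act_pd act_cocompact X_CAT0.
have [I mI] := amenable_mean H_subgroup H_amenable.
have [th [Y [k [b [T [o [E Yo NE]]]]]]] :=
  maximal_equivariant_sys act_action act_isometric act_pd act_cocompact HX H_subgroup point.
have [[thM thI] [_ cY] thY sys _] := E.
have [Y1 [l [c [S [[Y1o Y1ne _ Y1act] sys1 flat1]]]]] := amenable_flat HX H_subgroup
  (slice_isom act_action act_isometric H_subgroup E o)
  (slice_in_self k b Yo) (slice_cconvex HX E o) NE mI.
pose F := flat Y Y1 k b T o; pose P := chart k l b T c o.
have PI : forall v w, F v -> F w -> mnorm (P v - P w) = mdist v w.
  by move=> v w; exact: (chart_isometry sys sys1 flat1).
have /choice[Q QP] : forall u, exists v, F v /\ P v = u.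
  by move=> u; have [v Fv vu] := chart_surj sys sys1 Y1o u Y1ne; exists v.
have QF u : F (Q u) by have [] := QP u.
have QK u : P (Q u) = u by have [] := QP u.
have PK v : F v -> Q (P v) = v.
  by move=> Fv; apply: dist_eq0; rewrite -PI// QK subrr mnorm0.
have Fact h v : H h -> F v -> F (act (th h) v).
  move=> Hh [Yv v1]; split; first exact: thY.
  by rewrite (level_act act_isometric E)//; exact: Y1act.
apply: (bieberbach (alpha := fun h u => P (act (th h) (Q u))) H_subgroup).
- move=> g h u Hg Hh; rewrite PK; last exact: Fact.
  by rewrite thM//; have [_ ->] := act_action.
- move=> h u v Hh; rewrite PI; [|exact: Fact|exact: Fact].
  by rewrite act_isometric -PI// !QK.
(* [mnorm] of the image of 0 is the displacement of [Q 0] by [th h]; injectivity of [th] pulls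
   finiteness back from [Gamma] to [H]. *)
- move=> M; pose inv g := xget 1%g [set h | H h /\ th h = g].
  apply: sub_finite_set (finite_image inv (finite_displacement act_action act_pd HX (Q 0) M)).
  move=> h [Hh hM]; exists (th h).
    rewrite /= -PI//; [|exact: Fact].
    by rewrite QK subr0.
  have [Hi iE] : [set h' | H h' /\ th h' = th h] (inv (th h)) by apply: xgetPex; exists h.
  exact: thI.
Qed.
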